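(* Let $\pi$ and $\pi'$ be smooth representations of $G=\mathrm{GL}_2(F)$ with $\pi$ supersingular. Then every $P$-equivariant linear map $\pi\to\pi'$ is $G$-equivariant, i.e. $\mathrm{Hom}_P(\pi,\pi')=\mathrm{Hom}_G(\pi,\pi')$.
   Context: $F$ non-Archimedean local field of residual characteristic $p$. $P$ the upper triangular Borel subgroup of $G$, $T$ the diagonal torus. Representations are smooth on $\overline{\mathbf F}_p$-vector spaces. For a smooth character $\chi$ of $T$ viewed as a character of $P$, $\mathrm{Ind}_P^G\chi$ is the smooth induction. A supersingular representation is an irreducible smooth representation of $G$ admitting a central character which is not isomorphic to a subquotient of $\mathrm{Ind}_P^G\chi$ for any smooth character $\chi$ of $T$. *)

(* Defs.v *)
From HB Require Import structures.
From mathcomp Require Import all_boot all_order all_algebra.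
Set Implicit Arguments. Unset Strict Implicit. Unset Printing Implicit Defensive.
Import Order.TTheory GRing.Theory Num.Theory.
Local Open Scope ring_scope.

(* v x is meaningful only for x != 0 (v 0 = +oo by convention, encoded by vge). *)
Definition vge (F : fieldType) (v : F -> int) (x : F) (n : int) : Prop :=
  x = 0 \/ n <= v x.

Definition nonarch_local_field (p : nat) (F : fieldType) (v : F -> int) : Prop :=
  [/\ (forall x y : F, x != 0 -> y != 0 -> v (x * y) = v x + v y) /\
      (forall (x y : F) (n : int), vge v x n -> vge v y n -> vge v (x + y) n),
      (exists w : F, w != 0 /\ v w = 1),
      (forall a : nat -> F,
          (forall N : int, exists M : nat, forall m n : nat,
              (M <= m)%N -> (M <= n)%N -> vge v (a m - a n) N) ->
          exists L : F, forall N : int, exists M : nat, forall n : nat,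
              (M <= n)%N -> vge v (a n - L) N),
      (exists s : seq F, (forall y, y \in s -> vge v y 0) /\
          forall x, vge v x 0 -> exists2 y, y \in s & vge v (x - y) 1)
    &
      (prime p /\ vge v (p%:R : F) 1) ].

Definition is_Fpbar (p : nat) (C : closedFieldType) : Prop :=
  p \in [pchar C] /\ forall x : C, exists n : nat, (0 < n)%N /\ x ^+ (p ^ n) = x.

Definition inGL2 (F : fieldType) (g : 'M[F]_2) : Prop := g \in unitmx.

Definition inP (F : fieldType) (b : 'M[F]_2) : Prop :=
  b \in unitmx /\ b ord_max ord0 = 0.

(* Principal congruence subgroup K_{n+1} = 1 + varpi^{n+1} M_2(O); these
   form a basis of neighbourhoods of 1 in G. *)
Definition inK (F : fieldType) (v : F -> int) (n : nat) (k : 'M[F]_2) : Prop :=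
  k \in unitmx /\ forall i j, vge v (k i j - (1%:M : 'M[F]_2) i j) (n.+1)%:Z.

Definition is_rep (F : fieldType) (C : fieldType) (V : lmodType C)
    (rho : 'M[F]_2 -> V -> V) : Prop :=
  [/\ (forall g, inGL2 g -> forall (a : C) (x y : V),
          rho g (a *: x + y) = a *: rho g x + rho g y),
      (forall x, rho 1%:M x = x)
    & (forall g h, inGL2 g -> inGL2 h -> forall x, rho (g *m h) x = rho g (rho h x))].

Definition smooth_rep (F : fieldType) (v : F -> int) (C : fieldType)
    (V : lmodType C) (rho : 'M[F]_2 -> V -> V) : Prop :=
  is_rep rho /\ forall x : V, exists n : nat, forall k, inK v n k -> rho k x = x.

Definition has_central_character (F : fieldType) (C : fieldType) (V : lmodType C)
    (rho : 'M[F]_2 -> V -> V) : Prop :=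
  exists omega : F -> C, forall (a : F) (x : V), a != 0 -> rho a%:M x = omega a *: x.

Definition irreducible_rep (F : fieldType) (C : fieldType) (V : lmodType C)
    (rho : 'M[F]_2 -> V -> V) : Prop :=
  (exists x : V, x != 0) /\
  forall S : V -> Prop,
    S 0 -> (forall (a : C) x y, S x -> S y -> S (a *: x + y)) ->
    (forall g x, inGL2 g -> S x -> S (rho g x)) ->
    (forall x, S x -> x = 0) \/ (forall x, S x).

(* chi a d is the value of the character at diag(a, d). *)
Definition smooth_char_T (F : fieldType) (v : F -> int) (C : fieldType)
    (chi : F -> F -> C) : Prop :=
  [/\ (forall a d, a != 0 -> d != 0 -> chi a d != 0),
      (forall a a' d d', a != 0 -> a' != 0 -> d != 0 -> d' != 0 ->
          chi (a * a') (d * d') = chi a d * chi a' d')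
    & exists n : nat, forall a d, vge v (a - 1) (n.+1)%:Z ->
          vge v (d - 1) (n.+1)%:Z -> chi a d = 1].

(* phi belongs to Ind_P^G chi: phi is a function on G (extended by 0 off G),
   phi(b g) = chi(b) phi(g) for b in P, and phi is smooth for right
   translation.  G acts by (h . phi)(g) = phi(g h). *)
Definition in_Ind (F : fieldType) (v : F -> int) (C : fieldType)
    (chi : F -> F -> C) (phi : 'M[F]_2 -> C) : Prop :=
  [/\ (forall g, ~ inGL2 g -> phi g = 0),
      (forall b g, inP b -> inGL2 g -> phi (b *m g) = chi (b 0 0) (b 1 1) * phi g)
    & exists n : nat, forall g k, inGL2 g -> inK v n k -> phi (g *m k) = phi g].

(* (V, rho) is isomorphic to a subquotient W/W' of Ind_P^G chi, i.e. there is a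
   G-stable subspace W of Ind_P^G chi and a G-equivariant linear surjection
   q : W ->> V (W' = ker q). *)
Definition subquotient_of_Ind (F : fieldType) (v : F -> int) (C : fieldType)
    (chi : F -> F -> C) (V : lmodType C) (rho : 'M[F]_2 -> V -> V) : Prop :=
  exists (W : ('M[F]_2 -> C) -> Prop) (q : ('M[F]_2 -> C) -> V),
    [/\ (forall phi, W phi -> in_Ind v chi phi),
        (W (fun _ => 0) /\
         (forall (a : C) phi psi, W phi -> W psi -> W (fun g => a * phi g + psi g)) /\
        (forall h phi, inGL2 h -> W phi -> W (fun g => phi (g *m h)))),
        (forall (a : C) phi psi, W phi -> W psi ->
            q (fun g => a * phi g + psi g) = a *: q phi + q psi),
        (forall h phi, inGL2 h -> W phi -> q (fun g => phi (g *m h)) = rho h (q phi))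
      & (forall x : V, exists phi, W phi /\ q phi = x)].

Definition supersingular (F : fieldType) (v : F -> int) (C : fieldType)
    (V : lmodType C) (rho : 'M[F]_2 -> V -> V) : Prop :=
  [/\ smooth_rep v rho, irreducible_rep rho, has_central_character rho
    & forall chi : F -> F -> C, smooth_char_T v chi -> ~ subquotient_of_Ind v chi rho].

Definition is_linear (C : fieldType) (V V' : lmodType C) (f : V -> V') : Prop :=
  forall (a : C) (x y : V), f (a *: x + y) = a *: f x + f y.

Definition equivariant_on (F : fieldType) (C : fieldType) (V V' : lmodType C)
    (H : 'M[F]_2 -> Prop) (rho : 'M[F]_2 -> V -> V) (rho' : 'M[F]_2 -> V' -> V')
    (f : V -> V') : Prop :=
  forall g, H g -> forall x, f (rho g x) = rho' g (f x).

(* Main.v *)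
Require Import Defs.
From HB Require Import structures.
From mathcomp Require Import all_boot all_order all_algebra.
From mathcomp Require Import zify ring.
From mathcomp Require Import boolp functions.
Set Implicit Arguments. Unset Strict Implicit. Unset Printing Implicit Defensive.
Import Order.TTheory GRing.Theory Num.Theory.
Local Open Scope ring_scope.

(* Write t = diag(w, 1) with w a uniformizer, Pi = s t, I_1 for the pro-p Iwahori group and
   S = sum_(l in O/p) (1 l; 0 1) t for the resulting Hecke operator on pi^(I_1).

   If x in pi^(I_1) satisfies S x = 0, the Bruhat decomposition rewrites S x = 0 as
     Pi x = - sum_(l <> 0) (1 1/l; 0 1) diag(-1/l, l) t x,
   so Pi x lies in the P-span of x.  Let f be P-equivariant.  By smoothness f(x) is fixed by
   the lower unipotents of some level p^j, and applying any (1 m; 0 1) h t with m integral and h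
   a unit diagonal matrix lowers j by one as long as j > 1.  Hence f takes the K-span of Pi x
   to vectors of level j - 1.  Choose inside this K-span an irreducible K-subrepresentation
   sigma; its I_1-invariants form a line C x'.  If S is nilpotent on x', the last nonzero
   S^n x' is a new kernel vector of S, of level j - 1.  At level 1 the vector f(x) is fixed
   by I_1, so the displayed identity also holds for f(x), whence f(Pi x) = Pi f(x), and
   G = P I_1 u P Pi I_1 together with irreducibility gives the equivariance of f.

   Nilpotence of S on x' is where supersingularity enters.  If x' satisfies no polynomial
   relation P(S) x' = 0, then pi is the direct sum of the P-translates of sigma (a relation
   between translates would have an (1 O; 0 1)-invariant consequence, which only involves the
   S^n x'); a U-invariant functional on sigma then extends to a P-eigenfunctional on pi, and
   Frobenius reciprocity embeds pi in a principal series.  If there is a relation and S is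
   not nilpotent, S has an eigenvector y with nonzero eigenvalue, and mapping the
   function supported on P s U(O) to y makes pi a quotient of a subrepresentation of a
   principal series. *)

(** * Linear algebra *)

Section LinearAlgebra.
Variables (C : closedFieldType) (V : lmodType C).

(** No admissibility of pi is available, so S may have no eigenvector on pi^(I_1). What is finite is
    the K-span of a vector fixed by K_1, where K acts through GL_2(O/p): sigma and x' are found
    there, and only the orbit of x' under S is followed. This is why the dichotomy concerns
    relations between the S^n x' and not the spectrum of S. The K-span is taken at Pi x rather than
    at x because both cells of K then lead to combinations of P t x: s Pi x = t x outright, and Pi x
    by the identity obtained from S x = 0. So f(x) determines f on the whole K-span, and every
    vector met there carries a factor t, which lowers the level. The descent stops at level 1
    because moving (1 0; c 1) across (1 m; 0 1) requires 1 + c m to be a unit. Characteristic p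
    enters in three ways: p-groups have nonzero fixed vectors, they have nonzero coinvariants, and
    the cardinality of O/p is 0 in C. *)

Definition subspace (W : V -> Prop) : Prop :=
  W 0 /\ forall (a : C) x y, W x -> W y -> W (a *: x + y).

Section Subspace.
Variable W : V -> Prop.
Hypothesis sW : subspace W.

Lemma subspace0 : W 0. Proof. by case: sW. Qed.
Lemma subspaceP a x y : W x -> W y -> W (a *: x + y).
Proof. by case: sW => _; apply. Qed.
Lemma subspaceZ a x : W x -> W (a *: x).
Proof. by move=> Wx; rewrite -[_ *: _]addr0; apply: subspaceP => //; exact: subspace0. Qed.
Lemma subspaceD x y : W x -> W y -> W (x + y).
Proof. by move=> Wx Wy; rewrite -[x]scale1r; apply: subspaceP. Qed.
Lemma subspaceN x : W x -> W (- x).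
Proof. by move=> Wx; rewrite -scaleN1r; apply: subspaceZ. Qed.
Lemma subspaceB x y : W x -> W y -> W (x - y).
Proof. by move=> Wx Wy; apply: subspaceD => //; apply: subspaceN. Qed.
Lemma subspace_sum (I : eqType) (r : seq I) (P : pred I) (G : I -> V) :
  (forall i, i \in r -> P i -> W (G i)) -> W (\sum_(i <- r | P i) G i).
Proof.
move=> H; rewrite big_seq_cond; elim/big_ind: _ => //; first exact: subspace0.
- exact: subspaceD.
- by move=> i /andP[ir Pi]; apply: H.
Qed.
End Subspace.

Section LinearMap.
Variables (V' : lmodType C) (T : V -> V').
Hypothesis lT : is_linear T.
Lemma linD x y : T (x + y) = T x + T y.
Proof. by have := lT 1 x y; rewrite !scale1r. Qed.
Lemma lin0 : T 0 = 0.
Proof. by apply: (addrI (T 0)); rewrite -linD !addr0. Qed.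
Lemma linZ a x : T (a *: x) = a *: T x.
Proof. by have := lT a x 0; rewrite lin0 !addr0. Qed.
Lemma linN x : T (- x) = - T x.
Proof. by rewrite -scaleN1r linZ scaleN1r. Qed.
Lemma linB x y : T (x - y) = T x - T y.
Proof. by rewrite linD linN. Qed.
Lemma lin_sum (I : Type) (r : seq I) (P : pred I) (G : I -> V) :
  T (\sum_(i <- r | P i) G i) = \sum_(i <- r | P i) T (G i).
Proof. exact: (big_morph T linD lin0). Qed.
End LinearMap.

(** * Polynomials in one linear operator *)

Section PolyAct.
Variable T : V -> V.
Hypothesis lT : is_linear T.

Implicit Types P : {poly C}.
Definition pact (P : {poly C}) (w : V) : V :=
  \sum_(i < size P) P`_i *: iter i T w.

Lemma pact_wide (P : {poly C}) n w : (size P <= n)%N ->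
  pact P w = \sum_(i < n) P`_i *: iter i T w.
Proof.
move=> le; rewrite /pact -!(big_mkord predT (fun i => P`_i *: iter i T w)).
rewrite [RHS](big_cat_nat (leq0n _) le) /= [X in _ + X]big1_seq ?addr0 //.
by move=> i; rewrite mem_index_iota => /andP[_ /andP[h _]]; rewrite nth_default ?scale0r.
Qed.

Lemma iter_linear n : is_linear (iter n T).
Proof. by elim: n => [|n IH] a x y //=; rewrite IH lT. Qed.

Lemma pactMXsubC P r w : pact (P * ('X - r%:P)) w = pact P (T w - r *: w).
Proof.
have sz : (size (P * ('X - r%:P))%R <= (size P).+1)%N.
  by have := size_polyMleq P ('X - r%:P); rewrite size_XsubC addn2.
rewrite (pact_wide w sz) {sz} (eq_bigr (fun i : 'I__ => (P * 'X)`_i *: iter i T w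
   - (r * P`_i) *: iter i T w)); last first.
  by move=> i _; rewrite mulrBr coefB coefMC scalerBl [_ * r]mulrC.
rewrite sumrB big_ord_recl coefMX eqxx scale0r add0r.
rewrite [X in _ - X]big_ord_recr /= nth_default // mulr0 scale0r addr0.
rewrite -sumrB; apply: eq_bigr => i _.
rewrite /bump /= add1n coefMX /= -iterS iterSr (linB (@iter_linear i)).
by rewrite (linZ (@iter_linear i)) scalerBr scalerA mulrC.
Qed.

Lemma pact_XsubC_exp n w : pact (('X - 1%:P) ^+ n) w = iter n (fun x => T x - x) w.
Proof.
elim: n w => [|n IH] w.
  by rewrite expr0 /pact size_poly1 big_ord1 coef1 eqxx scale1r.
by rewrite exprSr pactMXsubC scale1r IH iterSr.
Qed.

Lemma pact_Xn_sub1 n w : pact ('X^n - 1%:P) w = iter n T w - w.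
Proof.
case: n => [|n]; first by rewrite expr0 subrr /pact size_poly0 big_ord0 subrr.
rewrite /pact size_XnsubC // (eq_bigr (fun i : 'I__ => ('X^(n.+1) : {poly C})`_i *: iter i T w
   - (1%:P : {poly C})`_i *: iter i T w)); last by move=> i _; rewrite coefB scalerBl.
rewrite sumrB big_ord_recr /= coefXn eqxx scale1r big1 ?add0r; last first.
  by move=> i _; rewrite coefXn ltn_eqF ?scale0r.
congr (_ - _); rewrite big_ord_recl big1 ?addr0 ?coefC ?eqxx ?scale1r //.
by move=> i _; rewrite coefC /= scale0r.
Qed.

(** In characteristic p, (X - 1)^(p^N) and X^(p^N) - 1 are the same polynomial; the two preceding
    lemmas evaluate both forms at T. Hence T - 1 is nilpotent on vectors with T^(p^N) w = w. *)
Lemma iter_sub1_pchar p N w : p \in [pchar C] ->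
  iter (p ^ N) (fun x => T x - x) w = iter (p ^ N) T w - w.
Proof.
move=> pC; rewrite -pact_XsubC_exp -pact_Xn_sub1; congr (pact _ w).
have pP : p \in [pchar {poly C}] by rewrite pchar_poly.
elim: N => [|N IH]; first by rewrite expn0 !expr1.
rewrite expnSr !exprM IH -!(pFrobenius_autE pP) pFrobenius_autB_comm; last exact: mulrC.
by rewrite [X in _ - X]pFrobenius_autE expr1n.
Qed.

(** Split off a root r of P and pass to w' = T w - r w, killed by a polynomial of smaller degree.
    Either no iterate of w' vanishes and the induction continues, or T^k w' = 0 and T^k w is an
    eigenvector. That no iterate of w vanishes is what makes the eigenvalue nonzero. *)
Lemma eigenvector_of_relation (W : V -> Prop) (P : {poly C}) (w : V) :
  subspace W -> (forall x, W x -> W (T x)) -> W w ->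
  (forall k, iter k T w <> 0) -> P != 0 -> pact P w = 0 ->
  exists r x, [/\ r != 0, W x, x <> 0 & T x = r *: x].
Proof.
move=> sW TW; have [n] := ubnP (size P); elim: n P w => // n IH P w ltn Ww nz P0 Pw.
have sP : size P != 1%N.
  apply/negP => /size_poly1P [c c0 Pc]; move: Pw.
  rewrite Pc /pact size_polyC c0 big_ord1 coefC eqxx => /eqP.
  by rewrite scaler_eq0 (negPf c0) => /eqP; apply: (nz 0%N).
have /closed_rootP [r /factor_theorem [Q PQ]] := sP.
have Q0 : Q != 0 by apply: contraNneq P0 => Q0; rewrite PQ Q0 mul0r.
have sQ : size P = (size Q).+1 by rewrite PQ size_mul ?polyXsubC_eq0 // size_XsubC addn2.
set w' := T w - r *: w.
case: (pselect (forall k, iter k T w' <> 0)) => [nz'|].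
  apply: (IH Q w') => //; first by rewrite -ltnS -sQ.
    by apply: subspaceB => //; [exact: TW | exact: subspaceZ].
  by rewrite -pactMXsubC -PQ.
move=> /existsNP [k /contrapT]; rewrite (linB (iter_linear k)) (linZ (iter_linear k)) -iterSr.
move=> /eqP; rewrite subr_eq0 => /eqP Tk.
exists r, (iter k T w); split => //.
- by apply: contra_notN (nz k.+1) => /eqP r0; rewrite Tk r0 scale0r.
- by elim: k {Tk} => //= k IHk; apply: TW.
Qed.

End PolyAct.

(** Periodicity provides the relation X^b - X^a, and injectivity keeps all iterates nonzero, so each
    operator has an eigenvector. Its eigenspace in W is stable under the remaining operators because
    they commute with it. *)
Lemma exists_common_eigenvector (I : eqType) (g : I -> V -> V) (l : seq I) (W : V -> Prop) :
  (forall i, i \in l -> is_linear (g i)) ->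
  (forall i x, i \in l -> W x -> W (g i x)) ->
  (forall i j x, i \in l -> j \in l -> W x -> g i (g j x) = g j (g i x)) ->
  (forall i x, i \in l -> W x -> g i x = 0 -> x = 0) ->
  (forall i x, i \in l -> W x ->
     exists a b, (a < b)%N /\ iter a (g i) x = iter b (g i) x) ->
  subspace W -> (exists2 x, W x & x <> 0) ->
  exists x, [/\ W x, x <> 0 & forall i, i \in l -> exists c, g i x = c *: x].
Proof.
elim: l W => [|i l IH] W lin st cm inj per sW [x Wx x0]; first by exists x.
have il : i \in i :: l by rewrite mem_head.
have li := lin i il.
have [a [b [ab xab]]] := per i x il Wx.
have [|k|||r [y [r0 Wy y0 Ty]]] := @eigenvector_of_relation (g i) li W ('X^b - 'X^a) x sW _ Wx.
- by move=> z; apply: st.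
- elim: k => //= k IHk e; apply: IHk; apply: (inj _ _ il _ e).
  by elim: k {e} => //= m Wm; apply: st.
- by rewrite -lead_coef_eq0 lead_coefDl ?size_polyN ?size_polyXn // lead_coefXn oner_neq0.
- rewrite (@pact_wide _ _ b.+1); last first.
    apply: leq_trans (size_polyD _ _) _; rewrite size_polyN !size_polyXn geq_max leqnn /=.
    by rewrite ltnS ltnW.
  rewrite (eq_bigr (fun k : 'I_b.+1 => (k == b :> nat)%:R *: iter k (g i) x
     - (k == a :> nat)%:R *: iter k (g i) x)); last first.
    by move=> k _; rewrite coefB !coefXn scalerBl.
  rewrite sumrB; have ao : (a < b.+1)%N by rewrite ltnS ltnW.
  rewrite (bigD1 ord_max) //= eqxx scale1r big1 ?addr0; last first.
    by move=> k; rewrite -val_eqE /= => /negPf ->; rewrite scale0r.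
  rewrite (bigD1 (Ordinal ao)) //= eqxx scale1r big1 ?addr0 ?xab ?subrr //.
  by move=> k; rewrite -val_eqE /= => /negPf ->; rewrite scale0r.
pose W' z := W z /\ g i z = r *: z.
have sub j : j \in l -> j \in i :: l by rewrite inE orbC => ->.
have [|||||||z [[Wz gz] z0 hz]] := IH W'.
- by move=> j /sub; apply: lin.
- move=> j z jl [Wz gz]; split; first by apply: st; rewrite ?sub.
  by rewrite (cm i j z (mem_head _ _) (sub j jl) Wz) gz (linZ (lin j (sub j jl))).
- by move=> j k z /sub jl /sub kl [Wz _]; exact: cm.
- by move=> j z /sub jl [Wz _]; apply: inj.
- by move=> j z /sub jl [Wz _]; apply: per.
- split; first by split; [exact: subspace0 | rewrite (lin0 li) scaler0].
  move=> c u v [Wu gu] [Wv gv]; split; first exact: subspaceP.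
  by rewrite li gu gv scalerDr !scalerA mulrC.
- by exists y.
exists z; split => // j; rewrite inE => /orP[/eqP-> |]; last exact: hz.
by exists r.
Qed.

Lemma pchar_expp_eq1 p N (c : C) : p \in [pchar C] -> c ^+ (p ^ N) = 1 -> c = 1.
Proof.
move=> pC; elim: N => [|N IH]; first by rewrite expn0 expr1.
rewrite expnSr exprM => h; apply: IH; apply/eqP; rewrite -subr_eq0.
have: (c ^+ (p ^ N) - 1) ^+ p = 0.
  by rewrite -(pFrobenius_autE pC) pFrobenius_autB_comm ?pFrobenius_autE ?h ?expr1n ?subrr //; exact: mulrC.
by move=> /eqP; rewrite expf_eq0 => /andP[].
Qed.

(** * Commuting operators of p-power order in characteristic p *)

Section PGroup.
Variables (p N : nat) (I : eqType) (g : I -> V -> V) (l : seq I) (W : V -> Prop).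
Hypotheses (pC : p \in [pchar C])
  (lin : forall i, i \in l -> is_linear (g i))
  (st : forall i x, i \in l -> W x -> W (g i x))
  (cm : forall i j x, i \in l -> j \in l -> W x -> g i (g j x) = g j (g i x))
  (per : forall i x, i \in l -> W x -> iter (p ^ N) (g i) x = x)
  (sW : subspace W) (W0 : exists2 x, W x & x <> 0).

Let pN_gt0 : (0 < p ^ N)%N.
Proof. by rewrite expn_gt0 prime_gt0 //; case/andP: pC. Qed.

(** The eigenvalues of a common eigenvector are p^N-th roots of unity, and 1 is the only one in
    characteristic p. *)
Lemma pgroup_fixed_vector :
  exists x, [/\ W x, x <> 0 & forall i, i \in l -> g i x = x].
Proof.
have [||x [Wx x0 hx]] := exists_common_eigenvector lin st cm _ _ sW W0.
- move=> i x il Wx gx; rewrite -(per il Wx) -(prednK pN_gt0) iterSr gx.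
  exact: (lin0 (iter_linear (lin il) _)).
- by move=> i x il Wx; exists 0%N, (p ^ N)%N; rewrite (per il Wx).
exists x; split => // i il; have [c gc] := hx i il.
suff: c = 1 by move=> c1; rewrite gc c1 scale1r.
apply: (pchar_expp_eq1 (N := N) pC).
have it k : iter k (g i) x = c ^+ k *: x.
  elim: k => [|k IH] /=; first by rewrite scale1r.
  by rewrite IH (linZ (lin il)) gc scalerA exprSr.
have /eqP := it (p ^ N)%N; rewrite (per il Wx) -subr_eq0 -{1}[x]scale1r -scalerBl.
by rewrite scaler_eq0 => /orP[|/eqP //]; rewrite subr_eq0 => /eqP.
Qed.

(* Nakayama's lemma for the augmentation ideal of a p-group, one generator at a time:
   if S0 + (g - 1)W = W then iterating gives W = S0 + (g - 1)^(p^N) W = S0. *)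
Lemma pgroup_coinvariants_neq0 :
  exists S : V -> Prop, [/\ subspace S, (exists2 z, W z & ~ S z)
    & forall i x, i \in l -> W x -> S (g i x - x)].
Proof.
(* The induction over the generators carries the subspace S0 already divided out, stable only under
   the generators still to come. *)
suff H : forall l' : seq I, {subset l' <= l} -> forall S0 : V -> Prop, subspace S0 ->
    (forall x, S0 x -> W x) -> (exists2 z, W z & ~ S0 z) ->
    (forall i x, i \in l' -> S0 x -> S0 (g i x)) ->
    exists S : V -> Prop, [/\ subspace S, (exists2 z, W z & ~ S z),
      (forall x, S0 x -> S x) & forall i x, i \in l' -> W x -> S (g i x - x)].
  have [|||||S [sS zS _ hS]] := H l _ (fun x => x = 0) => //.
  - by split=> // a x y -> ->; rewrite scaler0 addr0.
  - by move=> x ->; exact: subspace0.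
  - by move=> i x il ->; rewrite (lin0 (lin il)).
  - by exists S; split.
elim=> [|i l' IH] ll S0 sS0 S0W [z Wz Sz] S0st; first by exists S0; split=> //; exists z.
have il : i \in l by apply: ll; rewrite mem_head.
have ll' : {subset l' <= l} by move=> j jl; apply: ll; rewrite inE jl orbT.
pose D x := g i x - x.
have lD : is_linear D.
  by move=> a x y; rewrite /D (lin il) scalerBr opprD addrACA.
have WD x : W x -> W (D x) by move=> Wx; apply: subspaceB => //; apply: st.
pose S1 x := exists y u, [/\ S0 y, W u & x = y + D u].
have sS1 : subspace S1.
  split; first by exists 0, 0; rewrite (lin0 lD) addr0; split => //; exact: subspace0.
  move=> a x y [x1 [x2 [h1 h2 ->]]] [y1 [y2 [k1 k2 ->]]].
  exists (a *: x1 + y1), (a *: x2 + y2); split; [exact: subspaceP|exact: subspaceP|].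
  by rewrite lD scalerDr addrACA.
have S1z : exists2 u, W u & ~ S1 u.
  apply: contrapT => nS.
  have all u : W u -> S1 u by move=> Wu; apply: contrapT => nu; apply: nS; exists u.
  have it k : forall u, W u -> exists y v, [/\ S0 y, W v & u = y + iter k D v].
    elim: k => [|k IHk] u Wu; first by exists 0, u; rewrite add0r; split=> //; exact: subspace0.
    have [y [v [S0y Wv ->]]] := IHk u Wu.
    have [y' [v' [S0y' Wv' ->]]] := all v Wv.
    have lk := iter_linear lD k.
    exists (y + iter k D y'), v'; split => //.
      apply: subspaceD => //; elim: k {IHk lk Wv v S0y y Wu} => //= k IHk.
      by apply: subspaceB => //; apply: S0st => //; rewrite mem_head.
    by rewrite (linD lk) addrA iterSr.
  have [y [v [S0y Wv zy]]] := it (p ^ N)%N z Wz.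
  apply: Sz; rewrite zy (iter_sub1_pchar (lin il) _ _ pC) (per il Wv) subrr addr0 //.
have [||S [sS zS SS hS]] := IH ll' S1 sS1 _ S1z.
- by move=> x [y [u [/S0W Wy Wu ->]]]; apply: subspaceD => //; apply: WD.
- move=> j x jl [y [u [S0y Wu ->]]]; have jl' := ll' j jl.
  exists (g j y), (g j u); split; [by apply: S0st; rewrite ?inE ?jl ?orbT | exact: st |].
  by rewrite (linD (lin jl')) /D (linB (lin jl')) cm.
exists S; split=> //.
  move=> x S0x; apply: SS; exists x, 0; rewrite (lin0 lD) addr0; split=> //; exact: subspace0.
move=> j x; rewrite inE => /orP[/eqP-> |jl] Wx; last exact: hS.
by apply: SS; exists 0, x; rewrite add0r; split=> //; exact: subspace0.
Qed.

End PGroup.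

End LinearAlgebra.

(** Gives a dimension to subspaces defined by a predicate: rows of X outside the current row space
    are added, and the rank bounds the number of additions. *)
Lemma row_subspace_mx (C : closedFieldType) n (X : 'rV[C]_n -> Prop) : subspace X ->
  exists A : 'M[C]_n, forall r, X r <-> (r <= A)%MS.
Proof.
move=> sX.
suff H : forall k (A : 'M[C]_n), (n - \rank A <= k)%N -> (forall r, (r <= A)%MS -> X r) ->
    exists A : 'M[C]_n, forall r, X r <-> (r <= A)%MS.
  apply: (H n 0); first by rewrite mxrank0 subn0.
  by move=> r; rewrite submx0 => /eqP ->; exact: subspace0.
elim=> [|k IH] A rk hA.
  exists A => r; split; last exact: hA.
  move=> _; apply: submx_full; rewrite /row_full eqn_leq rank_leq_col /=.
  by rewrite -subn_eq0 -leqn0.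
case: (pselect (forall r, X r -> (r <= A)%MS)) => [h|].
  by exists A => r; split; [exact: h | exact: hA].
move=> /existsNP [r /not_implyP [Xr /negP rA]].
apply: (IH (A + r)%MS).
  have lt : (A < A + r)%MS by rewrite ltmxE addsmxSl /= addsmx_sub submx_refl.
  have := rank_ltmx lt; have := rank_leq_col (A + r)%MS; move: rk.
  by move: (\rank A) (\rank (A + r)%MS) => a b; lia.
move=> u /sub_addsmxP [[u1 u2] ->] /=; apply: (subspaceD sX); first by apply: hA; exact: submxMl.
by rewrite [u2]mx11_scalar mul_scalar_mx; apply: subspaceZ.
Qed.

(** Descent on the rank of the space of coordinate vectors whose combination lies in E. The abstract
    [st] will be stability under K, so the minimal E' is an irreducible K-subrepresentation. *)
Lemma minimal_subspace (C : closedFieldType) (V : lmodType C) n (e : 'I_n -> V)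
    (st : (V -> Prop) -> Prop) (E : V -> Prop) :
  subspace E -> st E -> (exists2 x, E x & x <> 0) ->
  (forall x, E x -> exists r : 'I_n -> C, x = \sum_i r i *: e i) ->
  exists E' : V -> Prop, [/\ subspace E', st E', (exists2 x, E' x & x <> 0),
    (forall x, E' x -> E x)
   & forall D : V -> Prop, subspace D -> st D -> (exists2 x, D x & x <> 0) ->
       (forall x, D x -> E' x) -> forall x, E' x -> D x].
Proof.
move=> sE stE nE fE.
pose cb (r : 'rV[C]_n) := \sum_i r 0 i *: e i.
have lcb : is_linear cb.
  move=> a x y; rewrite /cb scaler_sumr -big_split /=; apply: eq_bigr => i _.
  by rewrite !mxE scalerDl scalerA.
have sub_cb D : subspace D -> subspace (fun r => D (cb r)).
  move=> sD; split; first by rewrite (lin0 lcb); exact: subspace0.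
  by move=> a x y Dx Dy; rewrite lcb; apply: subspaceP.
have [A hA] := row_subspace_mx (sub_cb E sE).
have [k] := ubnP (\rank A).
elim: k E sE stE nE fE A hA => // k IH E sE stE nE fE A hA rk.
case: (pselect (exists D : V -> Prop, [/\ subspace D, st D, (exists2 x, D x & x <> 0),
    (forall x, D x -> E x) & exists2 x, E x & ~ D x])); last first.
  move=> nD; exists E; split=> // D sD stD nzD DE x Ex; apply: contrapT => Dx.
  by apply: nD; exists D; split=> //; exists x.
move=> [D [sD stD nzD DE [x Ex Dx]]].
have [B hB] := row_subspace_mx (sub_cb D sD).
have [||E' [h1 h2 h3 h4 h5]] := IH D sD stD nzD _ B hB.
- by move=> y /DE; apply: fE.
- apply: leq_trans (rank_ltmx _) rk.
  rewrite ltmxE; apply/andP; split.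
    by apply/rV_subP => u /hB /DE /hA.
  apply/negP => AB; have [r xr] := fE x Ex.
  have xr' : x = cb (\row_i r i) by rewrite xr; apply: eq_bigr => i _; rewrite mxE.
  apply: Dx; rewrite xr'; apply/hB; apply: submx_trans AB; apply/hA.
  by rewrite -xr'.
by exists E'; split=> // y /h4 /DE.
Qed.

(** * Valuation and residue representatives *)

Section Valuation.
Variables (p : nat) (F : fieldType) (v : F -> int).
Hypothesis HF : nonarch_local_field p v.
Local Notation G := (vge v).

Lemma vM x y : x != 0 -> y != 0 -> v (x * y) = v x + v y.
Proof. by case: HF => [[h _] _ _ _ _]; apply: h. Qed.

Lemma v1 : v 1 = 0.
Proof.
have := @vM 1 1 (oner_neq0 _) (oner_neq0 _); rewrite mulr1 => /eqP.
by rewrite -subr_eq0 opprD addrA subrr add0r oppr_eq0 => /eqP.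
Qed.

Lemma vN1 : v (-1) = 0.
Proof.
have n0 : (-1 : F) != 0 by rewrite oppr_eq0 oner_neq0.
by have := vM n0 n0; rewrite mulrNN mulr1 v1; lia.
Qed.

Lemma vN x : v (- x) = v x.
Proof.
have [->|x0] := eqVneq x 0; first by rewrite oppr0.
have n0 : (-1 : F) != 0 by rewrite oppr_eq0 oner_neq0.
by rewrite -mulN1r vM // vN1 add0r.
Qed.

Lemma vV x : x != 0 -> v x^-1 = - v x.
Proof.
move=> x0; have := vM x0 (invr_neq0 x0); rewrite divff // v1; lia.
Qed.

Lemma vX x (n : nat) : x != 0 -> v (x ^+ n) = v x * n%:Z.
Proof.
move=> x0; elim: n => [|n IH]; first by rewrite expr0 v1 mulr0.
by rewrite exprS vM ?expf_neq0 // IH; lia.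
Qed.

Lemma vXz x (n : int) : x != 0 -> v (x ^ n) = v x * n.
Proof.
move=> x0; case: n => n; first by rewrite -exprnP vX.
by rewrite NegzE -exprnN -exprVn vX ?invr_neq0 // vV //; lia.
Qed.

Lemma vgeD x y n : G x n -> G y n -> G (x + y) n.
Proof. by case: HF => [[_ h] _ _ _ _]; apply: h. Qed.
Lemma vgeN x n : G x n -> G (- x) n.
Proof. by case=> [->|h]; [left; rewrite oppr0 | right; rewrite vN]. Qed.
Lemma vgeB x y n : G x n -> G y n -> G (x - y) n.
Proof. by move=> hx hy; apply: vgeD => //; apply: vgeN. Qed.
Lemma vgeBC x y n : G (x - y) n -> G (y - x) n.
Proof. by move/vgeN; rewrite opprB. Qed.
Lemma vge0 n : G 0 n. Proof. by left. Qed.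
Lemma vgeW x m n : n <= m -> G x m -> G x n.
Proof. by move=> le [->|h]; [left | right; apply: le_trans h]. Qed.
Lemma vgeM x y m n : G x m -> G y n -> G (x * y) (m + n).
Proof.
move=> [->|hx]; first by left; rewrite mul0r.
move=> [->|hy]; first by left; rewrite mulr0.
have [->|x0] := eqVneq x 0; first by left; rewrite mul0r.
have [->|y0] := eqVneq y 0; first by left; rewrite mulr0.
by right; rewrite vM // lerD.
Qed.
Lemma vge_mull x y n : G x 0 -> G y n -> G (x * y) n.
Proof. by move=> hx hy; rewrite -[n]add0r; apply: vgeM. Qed.
Lemma vge_mulr x y n : G x n -> G y 0 -> G (x * y) n.
Proof. by move=> hx hy; rewrite mulrC; apply: vge_mull. Qed.
Lemma vge1 : G 1 0. Proof. by right; rewrite v1. Qed.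
Lemma vge_id x : G x (v x). Proof. by right. Qed.
Lemma vge_sum (I : eqType) (r : seq I) (h : I -> F) n :
  (forall i, i \in r -> G (h i) n) -> G (\sum_(i <- r) h i) n.
Proof.
by move=> H; rewrite big_seq; elim/big_ind: _ => //; [exact: vge0 | move=> x y hx hy; exact: vgeD].
Qed.
Lemma vge_natmul n : G n%:R 0.
Proof. by elim: n => [|n IH]; [left | rewrite -addn1 natrD; apply: vgeD => //; exact: vge1]. Qed.

Lemma vge_trans x y z n : G (x - y) n -> G (y - z) n -> G (x - z) n.
Proof.
move=> h1 h2; have -> : x - z = (x - y) + (y - z) by ring.
exact: vgeD.
Qed.

Definition vgeb x n := (x == 0) || (n <= v x).
Lemma vgeP x n : reflect (G x n) (vgeb x n).
Proof.
apply: (iffP orP); first by case=> [/eqP|]; [left|right].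
by case=> [/eqP|]; [left|right].
Qed.

Definition vunit e := e != 0 /\ v e = 0.

Lemma vunit_neq0 e : vunit e -> e != 0. Proof. by case. Qed.
Lemma vunit_int e : vunit e -> G e 0. Proof. by case=> _ h; right; rewrite h. Qed.
Lemma vunitM e f : vunit e -> vunit f -> vunit (e * f).
Proof. by move=> [e0 he] [f0 hf]; split; rewrite ?mulf_neq0 // vM // he hf. Qed.
Lemma vunitV e : vunit e -> vunit e^-1.
Proof. by move=> [e0 he]; split; rewrite ?invr_neq0 // vV // he. Qed.
Lemma vunitN e : vunit e -> vunit (- e).
Proof. by move=> [e0 he]; split; rewrite ?oppr_eq0 // vN. Qed.
Lemma vunit1 : vunit 1. Proof. by split; [exact: oner_neq0 | exact: v1]. Qed.
Lemma not_vge1 e : vunit e -> ~ G e 1.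
Proof. by case=> e0 ve [/eqP|]; [rewrite (negPf e0) | rewrite ve]. Qed.
Lemma vunit_dec e : G e 0 -> G e 1 \/ vunit e.
Proof.
move=> ge; case: (vgeP e 1) => h; [by left | right].
have e0 : e != 0 by apply/eqP => e0; apply: h; left.
split=> //; case: ge => [/eqP|ge]; first by rewrite (negPf e0).
suff : ~ (1 <= v e) by lia.
by move=> le; apply: h; right.
Qed.
Lemma vunit_cong e f : vunit e -> G (f - e) 1 -> vunit f.
Proof.
move=> ue h.
have gf : G f 0.
  by rewrite -[f](subrK e); apply: vgeD (vunit_int ue); apply: vgeW h.
case: (vunit_dec gf) => // f1; case: (not_vge1 ue).
by rewrite -[e](subKr f) ; apply: vgeB.
Qed.
Lemma vunit_1cong f n : (0 < n)%R -> G (f - 1) n -> vunit f.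
Proof.
move=> n0 h; apply: (vunit_cong vunit1); apply: vgeW h.
by move: n0; rewrite -gtz0_ge1.
Qed.
Lemma vge_div x y : x != 0 -> G (y / x) 0 \/ y != 0 /\ G (x / y) 1.
Proof.
move=> x0; have [->|y0] := eqVneq y 0; first by left; rewrite mul0r; left.
case: (leP (v x) (v y)) => h; [left|right; split=> //]; right.
  by rewrite vM ?invr_neq0 // vV // subr_ge0.
by rewrite vM ?invr_neq0 // vV //; lia.
Qed.

Lemma pi_vge : G p%:R 1. Proof. by case: HF => _ _ _ _ []. Qed.
Lemma p_prime : prime p. Proof. by case: HF => _ _ _ _ []. Qed.
Lemma pX_vge n : G ((p ^ n)%:R) n.
Proof.
elim: n => [|n IH]; first by rewrite expn0; exact: vge1.
by rewrite expnS natrM -addn1 PoszD addrC; apply: vgeM IH; exact: pi_vge.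
Qed.

(** * Representatives of O modulo p^n and sums over them *)

Section Reps.

Definition isreps (n : int) (l : seq F) :=
  [/\ uniq l, (forall x, x \in l -> G x 0),
      (forall x, G x 0 -> exists2 y, y \in l & G (x - y) n)
    & (forall x y, x \in l -> y \in l -> G (x - y) n -> x = y)].

(** Sending x to its representative in the other list is a bijection. It allows sums over O/p^n to
    be reindexed by translations and by multiplication by units. *)
Lemma isreps_perm n l l' : isreps n l -> isreps n l' ->
  exists h : F -> F, (forall x, x \in l -> h x \in l' /\ G (x - h x) n) /\ perm_eq (map h l) l'.
Proof.
move=> [ul Ol cl il] [ul' Ol' cl' il'].
pose h x := nth 0 l' (find (fun y => vgeb (x - y) n) l').
have hP x : x \in l -> h x \in l' /\ G (x - h x) n.
  move=> xl; have [y yl' xy] := cl' x (Ol x xl).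
  have hs : has (fun y => vgeb (x - y) n) l' by apply/hasP; exists y => //; apply/vgeP.
  by split; [apply: mem_nth; rewrite -has_find | apply/vgeP; exact: (nth_find 0 hs)].
exists h; split=> //; apply: uniq_perm => //.
  rewrite map_inj_in_uniq // => x y xl yl hxy.
  apply: il => //; have [_ h1] := hP x xl; have [_ h2] := hP y yl.
  by apply: vge_trans h1 _; rewrite hxy; apply: vgeBC.
move=> y; apply/mapP/idP => [[x xl ->]|yl]; first by case: (hP x xl).
have [x xl xy] := cl y (Ol' y yl); exists x => //.
have [h1 h2] := hP x xl; apply: il' => //.
exact: vge_trans xy h2.
Qed.

Lemma sum_isreps (U : nmodType) n l l' (H : F -> U) : isreps n l -> isreps n l' ->
  (forall x y, G x 0 -> G y 0 -> G (x - y) n -> H x = H y) ->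
  \sum_(x <- l) H x = \sum_(x <- l') H x.
Proof.
move=> rl rl' inv; have [h [hP pe]] := isreps_perm rl rl'.
rewrite -(perm_big _ pe) big_map /=; apply: eq_big_seq => x xl.
have [hx hc] := hP x xl; apply: inv => //; first by case: rl => _ h1 _ _; apply: h1.
by case: rl' => _ h1 _ _; apply: h1.
Qed.

Lemma isreps_shift n l b : G b 0 -> isreps n l -> isreps n [seq x + b | x <- l].
Proof.
move=> gb [ul Ol cl il]; split.
- by rewrite map_inj_uniq // => x y; apply: addIr.
- by move=> x /mapP [y /Ol gy ->]; apply: vgeD.
- move=> x gx; have [y yl h] := cl (x - b) (vgeB gx gb).
  by exists (y + b); [apply: map_f | rewrite opprD addrCA addrC -addrA -opprD [b + y]addrC opprD addrA addrAC].
- move=> x y /mapP [x' xl ->] /mapP [y' yl ->] h.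
  by congr (_ + _); apply: il => //; move: h; rewrite opprD addrACA subrr addr0.
Qed.

Lemma isreps_scale n l e : vunit e -> isreps n l -> isreps n [seq e * x | x <- l].
Proof.
move=> ue [ul Ol cl il]; have e0 := vunit_neq0 ue; split.
- by rewrite map_inj_uniq // => x y; apply: mulfI.
- by move=> x /mapP [y /Ol gy ->]; apply: vge_mull => //; exact: vunit_int.
- move=> x gx; have [|y yl h] := cl (e^-1 * x).
    by apply: vge_mull => //; apply: vunit_int; apply: vunitV.
  exists (e * y); first exact: map_f.
  have -> : x - e * y = e * (e^-1 * x - y) by rewrite mulrBr mulVKf.
  by apply: vge_mull => //; exact: vunit_int.
- move=> x y /mapP [x' xl ->] /mapP [y' yl ->] h; congr (_ * _); apply: il => //.
  have -> : x' - y' = e^-1 * (e * x' - e * y') by rewrite -mulrBr mulKf.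
  by apply: vge_mull => //; apply: vunit_int; apply: vunitV.
Qed.

Lemma sum_shift (U : nmodType) n l (H : F -> U) b : isreps n l -> G b 0 ->
  (forall x y, G x 0 -> G y 0 -> G (x - y) n -> H x = H y) ->
  \sum_(x <- l) H (x + b) = \sum_(x <- l) H x.
Proof.
move=> rl gb inv; rewrite -(sum_isreps (isreps_shift gb rl) rl inv).
by rewrite big_map.
Qed.

Lemma sum_scale (U : nmodType) n l (H : F -> U) e : isreps n l -> vunit e ->
  (forall x y, G x 0 -> G y 0 -> G (x - y) n -> H x = H y) ->
  \sum_(x <- l) H (e * x) = \sum_(x <- l) H x.
Proof.
move=> rl ue inv; rewrite -(sum_isreps (isreps_scale ue rl) rl inv).
by rewrite big_map.
Qed.

(** Duplicates are removed from a finite covering of O/p. The class of p gets the representative 0,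
    so that all entries of [ks] are units and can be inverted in the Bruhat relation. *)
Lemma exists_isreps1 : exists ks, isreps 1 (0 :: ks).
Proof.
case: HF => _ _ _ [s [Os cs]] _.
have [ks [uk Ok ik ck]] : exists ks, [/\ uniq (0 :: ks), (forall x, x \in 0 :: ks -> G x 0),
    (forall x y, x \in 0 :: ks -> y \in 0 :: ks -> G (x - y) 1 -> x = y)
   & forall x, x \in s -> exists2 y, y \in 0 :: ks & G (x - y) 1].
  elim: s Os {cs} => [|z s IH] Os.
    exists [::]; split => //; first by move=> x; rewrite inE => /eqP->; exact: vge0.
    by move=> x y; rewrite !inE => /eqP-> /eqP->.
  have [|ks [uk Ok ik ck]] := IH; first by move=> y ys; apply: Os; rewrite inE ys orbT.
  case: (pselect (exists2 y, y \in 0 :: ks & G (z - y) 1)) => [h|nh].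
    by exists ks; split=> // x; rewrite inE => /orP[/eqP->|/ck].
  have nz y : y \in 0 :: ks -> ~ G (z - y) 1 by move=> yk h; apply: nh; exists y.
  have mem x : (x \in 0 :: z :: ks) = (x == z) || (x \in 0 :: ks).
    by rewrite !inE orbCA.
  exists (z :: ks); split.
  - have : z \notin 0 :: ks by apply/negP => /nz; apply; rewrite subrr; exact: vge0.
    move: uk; rewrite !cons_uniq !inE !negb_or => /andP[-> ->] /andP[nz0 ->].
    by rewrite eq_sym nz0.
  - by move=> x; rewrite mem => /orP[/eqP->|/Ok //]; apply: Os; rewrite mem_head.
  - move=> x y; rewrite !mem => /orP[/eqP->|xk] /orP[/eqP->|yk] //.
    + by move=> /(nz _ yk).
    + by move=> /vgeBC /(nz _ xk).
    + exact: ik.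
  - move=> x; rewrite inE => /orP[/eqP->|/ck [y yk h]].
      by exists z; rewrite ?mem ?eqxx // subrr; exact: vge0.
    by exists y; rewrite ?mem ?yk ?orbT.
exists ks; split=> // x gx; have [y ys xy] := cs x gx; have [z zk yz] := ck y ys.
by exists z => //; apply: vge_trans yz.
Qed.

Variable ks : seq F.
Hypothesis rk : isreps 1 (0 :: ks).

Lemma ks_vunit x : x \in ks -> vunit x.
Proof.
move=> xk; case: rk => uk Ok _ ik.
have xk' : x \in 0 :: ks by rewrite inE xk orbT.
case: (vunit_dec (Ok _ xk')) => // h; move: uk => /= /andP[/negP []].
by rewrite -(ik x 0) ?mem_head // subr0.
Qed.

(* Translating the representatives by 1 does not change their sum modulo the maximal
   ideal, so the residue cardinality lies in the maximal ideal, hence in pZ. *)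
Lemma dvdn_residue_card : (p %| size (0%R :: ks))%N.
Proof.
set l := 0 :: ks; have [h [hP pe]] := isreps_perm (isreps_shift vge1 rk) rk.
have q1 : G (size l)%:R 1.
  have -> : ((size l)%:R : F) = \sum_(x <- [seq x + 1 | x <- l]) (x - h x).
    rewrite sumrB -[X in _ - X](big_map h predT id) (perm_big _ pe) big_map big_split /=.
    by rewrite addrC addrK big_const_seq count_predT iter_addr_0.
  by apply: vge_sum => x /hP [].
apply/negPn/negP; rewrite -prime_coprime ?p_prime // => /eqP g1.
have [u w def _] := egcdnP (size l) (prime_gt0 p_prime).
suff : G 1 1 by apply: not_vge1 vunit1.
have -> : 1 = u%:R * p%:R - w%:R * (size l)%:R :> F.
  by rewrite -!natrM def g1 natrD addrAC subrr add0r.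
by apply: vgeB; apply: vge_mull; rewrite ?q1 //; [exact: vge_natmul|exact: pi_vge|exact: vge_natmul].
Qed.

(** Pigeonhole on the residues of the powers of e. This is the periodicity that
    [exists_common_eigenvector] asks of the unit torus. *)
Lemma vunit_exp_cong e : vunit e ->
  exists a b, (a < b)%N /\ G (e ^+ a - e ^+ b) 1.
Proof.
move=> ue; have Oe i : G (e ^+ i) 0.
  by elim: i => [|i IH]; [exact: vge1 | rewrite exprS; apply: vge_mull => //; exact: vunit_int].
have [|h hP] := @choice nat F (fun i y => y \in 0 :: ks /\ G (e ^+ i - y) 1).
  move=> i.
  by case: rk => _ _ /(_ _ (Oe i)) [y yk hy] _; exists y.
have : ~~ uniq [seq h i | i <- iota 0 (size (0%R :: ks)).+1].
  apply/negP => u.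
  have sub : {subset [seq h i | i <- iota 0 (size (0%R :: ks)).+1] <= 0 :: ks}.
    by move=> x /mapP [i _ ->]; case: (hP i).
  by have := uniq_leq_size u sub; rewrite size_map size_iota ltnn.
have key i j : h i = h j -> G (e ^+ i - e ^+ j) 1.
  move=> hij; have [_ h1] := hP i; have [_ h2] := hP j.
  by apply: vge_trans h1 _; rewrite hij; apply: vgeBC.
move=> /(uniqPn 0) [i [j [ij jk]]]; move: (jk); rewrite size_map => js.
have is_ : (i < size (iota 0 (size (0%R :: ks)).+1))%N by apply: ltn_trans js.
rewrite !(nth_map 0%N) // !nth_iota; last 2 first.
- by move: js; rewrite size_iota.
- by move: is_; rewrite size_iota.
by rewrite !add0n => /key; exists i, j.
Qed.

Variable w : F.
Hypotheses (w0 : w != 0) (vw : v w = 1).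

(** Truncated w-adic expansions with digits in [0 :: ks]. The recursion on the lowest digit matches
    the iteration of S, see [iter_Sop]. *)
Fixpoint reps (n : nat) : seq F :=
  if n is m.+1 then [seq a + w * x | a <- 0 :: ks, x <- reps m] else [:: 0].

Lemma vge_w : G w 1. Proof. by right; rewrite vw. Qed.

Lemma vge_wK n x : G (w * x) (n + 1) -> G x n.
Proof.
have [->|x0] := eqVneq x 0; first by left.
by case=> [/eqP|]; [rewrite mulf_eq0 (negPf w0) (negPf x0) | rewrite vM // vw => h; right; lia].
Qed.

Lemma vge_wzM n m x : G x m -> G (w ^ n * x) (n + m).
Proof. by move=> h; apply: vgeM h; right; rewrite vXz // vw mul1r. Qed.

Lemma vge_wXM (n : nat) m x : G x m -> G (w ^+ n * x) (n%:Z + m).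
Proof. exact: (@vge_wzM n). Qed.

Lemma vge_dvd n x : G x n -> exists2 y, G y 0 & x = w ^ n * y.
Proof.
move=> h; exists (w ^ (- n) * x); first by have := vge_wzM (- n) h; rewrite addNr.
by rewrite mulrA -expfzDr // subrr expr0z mul1r.
Qed.

Lemma isreps_reps (n : nat) : isreps n (reps n).
Proof.
case: (rk) => uk Ok ck ik.
elim: n => [|n [ul Ol cl il]].
  split=> //; first by move=> x; rewrite inE => /eqP->; exact: vge0.
    by move=> x gx; exists 0; rewrite ?mem_head // subr0.
  by move=> x y; rewrite !inE => /eqP-> /eqP->.
have inj a b x y : a \in 0 :: ks -> b \in 0 :: ks -> x \in reps n -> y \in reps n ->
    G (a + w * x - (b + w * y)) n.+1 -> a = b /\ x = y.
  move=> ak bk xl yl h.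
  have ab : a = b.
    apply: ik => //.
    have -> : a - b = a + w * x - (b + w * y) - w * (x - y) by ring.
    apply: vgeB; first by apply: vgeW h.
    by apply: vge_mulr; [exact: vge_w | apply: vgeB; apply: Ol].
  split=> //; apply: il => //; apply: vge_wK; move: h; rewrite ab opprD addrACA subrr add0r -mulrBr.
  by rewrite -PoszD addn1.
split.
- apply: allpairs_uniq => // -[a x] [b y] /allpairsP [[a' x'] [ak xl [-> ->]]].
  move=> /allpairsP [[b' y'] [bk yl [-> ->]]] e.
  have {}e : a' + w * x' = b' + w * y' := e.
  have [|-> -> //] := inj a' b' x' y' ak bk xl yl.
  by rewrite e subrr; exact: vge0.
- move=> x /allpairsP [[a y] [/= /Ok ga /Ol gy ->]].
  by apply: vgeD => //; apply: vge_mull => //; apply: vgeW vge_w.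
- move=> x gx; have [a ak h] := ck x gx.
  have [z gz xz] := vge_dvd h; have [y yl hy] := cl z gz.
  exists (a + w * y); first by apply/allpairsP; exists (a, y).
  have -> : x - (a + w * y) = w ^ 1 * (z - y) by rewrite opprD addrA xz expr1z; ring.
  by rewrite -add1n PoszD; exact: vge_wzM.
- move=> x y /allpairsP [[a x'] [ak xl ->]] /allpairsP [[b y'] [bk yl ->]] h.
  by have [-> ->] := inj a b x' y' ak bk xl yl h.
Qed.

Lemma reps_int n x : x \in reps n -> G x 0.
Proof. by case: (isreps_reps n) => _ h _ _; apply: h. Qed.

End Reps.

End Valuation.

(** * Two-by-two matrices and the Hecke operators *)

Section Matrices.
Variable F : fieldType.

Definition mx2 (a b c d : F) : 'M[F]_2 :=
  \matrix_(i, j) if i == 0 then (if j == 0 then a else b) else (if j == 0 then c else d).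

Lemma mx2E a b c d : (mx2 a b c d 0 0 = a) * (mx2 a b c d 0 1 = b) *
  (mx2 a b c d 1 0 = c) * (mx2 a b c d 1 1 = d).
Proof. by rewrite !mxE. Qed.

Lemma ord2 (i : 'I_2) : i = 0 \/ i = 1.
Proof. by case: i => [[|[|m]] h] //; [left | right]; apply: val_inj. Qed.

Lemma mx2_eta (A : 'M[F]_2) : A = mx2 (A 0 0) (A 0 1) (A 1 0) (A 1 1).
Proof. by apply/matrixP => i j; rewrite mxE; case: (ord2 i) => ->; case: (ord2 j) => ->. Qed.

Lemma mx2_mul a b c d a' b' c' d' :
  mx2 a b c d *m mx2 a' b' c' d' =
  mx2 (a * a' + b * c') (a * b' + b * d') (c * a' + d * c') (c * b' + d * d').
Proof.
apply/matrixP => i j; rewrite !mxE big_ord_recl big_ord1 !mxE.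
by case: (ord2 i) => ->; case: (ord2 j) => ->.
Qed.

Lemma mx2_unit a b c d : (mx2 a b c d \in unitmx) = (a * d - b * c != 0).
Proof.
rewrite unitmxE unitfE; congr (_ != 0).
rewrite (expand_det_row _ 0) big_ord_recl big_ord1 /cofactor !det_mx11 !mxE /=.
by rewrite /bump /= expr0 expr1; ring.
Qed.

Lemma mx2_scalar a : mx2 a 0 0 a = a%:M.
Proof. by apply/matrixP => i j; rewrite !mxE; case: (ord2 i) => ->; case: (ord2 j) => ->. Qed.

Definition um x := mx2 1 x 0 1.
Definition nm c := mx2 1 0 c 1.
Definition dg a d := mx2 a 0 0 d.
Definition sm := mx2 0 1 1 0.

Lemma um_GL x : um x \in unitmx.
Proof. by rewrite mx2_unit mulr1 mulr0 subr0 oner_neq0. Qed.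
Lemma nm_GL x : nm x \in unitmx.
Proof. by rewrite mx2_unit mulr1 mul0r subr0 oner_neq0. Qed.
Lemma dg_GL a d : a != 0 -> d != 0 -> dg a d \in unitmx.
Proof. by move=> a0 d0; rewrite mx2_unit mulr0 subr0 mulf_neq0. Qed.
Lemma sm_GL : sm \in unitmx.
Proof. by rewrite mx2_unit mulr1 mul0r sub0r oppr_eq0 oner_neq0. Qed.

Lemma inP_mx2 a b d : a != 0 -> d != 0 -> inP (mx2 a b 0 d).
Proof.
move=> a0 d0; split; first by rewrite mx2_unit mulr0 subr0 mulf_neq0.
by rewrite mxE.
Qed.
Lemma um_P x : inP (um x). Proof. by apply: inP_mx2; exact: oner_neq0. Qed.
Lemma dg_P a d : a != 0 -> d != 0 -> inP (dg a d). Proof. exact: inP_mx2. Qed.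

Lemma inPE (b : 'M[F]_2) : inP b -> exists x a d, [/\ a != 0, d != 0, b 0 0 = a, b 1 1 = d &
  b = um x *m dg a d].
Proof.
move=> [bu b10]; have e : b = mx2 (b 0 0) (b 0 1) 0 (b 1 1).
  have {}b10 : b 1 0 = 0 by rewrite -b10; congr (b _ _); apply: val_inj.
  by rewrite {1}[b]mx2_eta b10.
move: bu; rewrite {1}e mx2_unit mulr0 subr0 mulf_eq0 negb_or => /andP[a0 d0].
exists (b 0 1 / b 1 1), (b 0 0), (b 1 1); split=> //.
by rewrite {1}e mx2_mul; congr mx2; field.
Qed.

End Matrices.
Arguments sm {F}.

(** * Relations in GL_2(F), congruence-fixed vectors and the operators S and T *)

Section Representation.
Variables (p : nat) (F : fieldType) (v : F -> int).
Hypothesis HF : nonarch_local_field p v.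
Local Notation G := (vge v).
Variables (C : closedFieldType) (V : lmodType C) (rho : 'M[F]_2 -> V -> V).
Hypothesis Hr : is_rep rho.

Lemma act_lin g : g \in unitmx -> is_linear (rho g).
Proof. by case: Hr => h _ _ gu a x y; apply: h. Qed.
Lemma act1 x : rho 1%:M x = x. Proof. by case: Hr. Qed.
Lemma actM g h x : g \in unitmx -> h \in unitmx -> rho g (rho h x) = rho (g *m h) x.
Proof. by case: Hr => _ _ H gu hu; rewrite H. Qed.
Lemma actK g x : g \in unitmx -> rho (invmx g) (rho g x) = x.
Proof. by move=> gu; rewrite actM ?unitmx_inv // mulVmx // act1. Qed.
Lemma act_inj g x : g \in unitmx -> rho g x = 0 -> x = 0.
Proof. by move=> gu e; rewrite -(actK x gu) e (lin0 (act_lin _)) ?unitmx_inv. Qed.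

Let GLE := (unitmx_mul, @um_GL F, @nm_GL F, @sm_GL F).

Lemma um_lin x : is_linear (rho (um x)). Proof. exact/act_lin/um_GL. Qed.
Lemma nm_lin x : is_linear (rho (nm x)). Proof. exact/act_lin/nm_GL. Qed.
Lemma sm_lin : is_linear (rho sm). Proof. exact/act_lin/sm_GL. Qed.
Lemma dg_lin a d : a != 0 -> d != 0 -> is_linear (rho (dg a d)).
Proof. by move=> a0 d0; apply/act_lin/dg_GL. Qed.

Lemma um_um a b x : rho (um a) (rho (um b) x) = rho (um (a + b)) x.
Proof. by rewrite actM ?um_GL // mx2_mul; congr (rho (mx2 _ _ _ _) x); ring. Qed.
Lemma um0 x : rho (um 0) x = x.
Proof. by rewrite -[RHS]act1 -mx2_scalar. Qed.
Lemma dg11 x : rho (dg 1 1) x = x.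
Proof. by rewrite -[RHS]act1 -mx2_scalar. Qed.
Lemma dg_dg a d a' d' x : a != 0 -> d != 0 -> a' != 0 -> d' != 0 ->
  rho (dg a d) (rho (dg a' d') x) = rho (dg (a * a') (d * d')) x.
Proof. by move=> *; rewrite actM ?dg_GL // /um /nm /dg /sm mx2_mul; congr (rho (mx2 _ _ _ _) x); ring. Qed.
Lemma dg_um a d b x : a != 0 -> d != 0 ->
  rho (dg a d) (rho (um b) x) = rho (um (a * b / d)) (rho (dg a d) x).
Proof.
move=> a0 d0; rewrite !actM ?dg_GL ?um_GL // /um /nm /dg /sm !mx2_mul.
by congr (rho (mx2 _ _ _ _) x); field.
Qed.
Lemma nm_dg c a d x : a != 0 -> d != 0 ->
  rho (nm c) (rho (dg a d) x) = rho (dg a d) (rho (nm (c * a / d)) x).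
Proof.
move=> a0 d0; rewrite !actM ?dg_GL ?nm_GL // /um /nm /dg /sm !mx2_mul.
by congr (rho (mx2 _ _ _ _) x); field.
Qed.
Lemma sm_sm x : rho sm (rho sm x) = x.
Proof.
rewrite actM ?sm_GL // /sm mx2_mul -[RHS]act1 -mx2_scalar.
by congr (rho (mx2 _ _ _ _) x); ring.
Qed.
Lemma sm_dg a d x : a != 0 -> d != 0 ->
  rho sm (rho (dg a d) x) = rho (dg d a) (rho sm x).
Proof.
move=> a0 d0; rewrite !actM ?dg_GL ?sm_GL // /um /nm /dg /sm !mx2_mul.
by congr (rho (mx2 _ _ _ _) x); ring.
Qed.
Lemma um_sm c x : rho (um c) (rho sm x) = rho sm (rho (nm c) x).
Proof.
rewrite !actM ?um_GL ?nm_GL ?sm_GL // /um /nm /dg /sm !mx2_mul.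
by congr (rho (mx2 _ _ _ _) x); ring.
Qed.
Lemma nm_sm c x : rho (nm c) (rho sm x) = rho sm (rho (um c) x).
Proof.
rewrite !actM ?um_GL ?nm_GL ?sm_GL // /um /nm /dg /sm !mx2_mul.
by congr (rho (mx2 _ _ _ _) x); ring.
Qed.
(** The Bruhat relation of rank one, which puts s u(c) into the cell P N^-; all rewritings of Hecke
    sums below come from it. *)
Lemma sm_um c x : c != 0 -> rho sm (rho (um c) x) =
  rho (um c^-1) (rho (dg (- c^-1) c) (rho (nm c^-1) x)).
Proof.
move=> c0; have c1 : - c^-1 != 0 by rewrite oppr_eq0 invr_neq0.
rewrite !actM ?GLE ?dg_GL ?invr_neq0 // /um /nm /dg /sm !mx2_mul.
by congr (rho (mx2 _ _ _ _) x); field.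
Qed.
Lemma nm_um c b x : 1 + c * b != 0 -> rho (nm c) (rho (um b) x) =
  rho (um (b / (1 + c * b))) (rho (dg (1 + c * b)^-1 (1 + c * b))
    (rho (nm (c / (1 + c * b))) x)).
Proof.
move=> e0; rewrite !actM ?GLE ?dg_GL ?invr_neq0 // /um /nm /dg /sm !mx2_mul.
by congr (rho (mx2 _ _ _ _) x); field.
Qed.
(** Coordinates on the cell P N^-, and in the next lemma on P s U. For an element of K the first is
    used when c lies in p, the second when c is a unit; all factors are then integral, with unit
    diagonal parts. *)
Lemma mx2_bigcell a b c d x : d != 0 -> a * d - b * c != 0 ->
  rho (mx2 a b c d) x =
  rho (um (b / d)) (rho (dg ((a * d - b * c) / d) d) (rho (nm (c / d)) x)).
Proof.
move=> d0 D0; have D1 : (a * d - b * c) / d != 0 by rewrite mulf_neq0 ?invr_neq0.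
rewrite !actM ?GLE ?dg_GL ?invr_neq0 // /um /nm /dg /sm !mx2_mul.
by congr (rho (mx2 _ _ _ _) x); field.
Qed.
Lemma mx2_scell a b c d x : c != 0 -> a * d - b * c != 0 ->
  rho (mx2 a b c d) x =
  rho (um (a / c)) (rho (dg (- (a * d - b * c) / c) c) (rho sm (rho (um (d / c)) x))).
Proof.
move=> c0 D0; have D1 : - (a * d - b * c) / c != 0.
  by rewrite mulf_neq0 ?invr_neq0 // oppr_eq0.
rewrite !actM ?GLE ?dg_GL ?invr_neq0 // /um /nm /dg /sm !mx2_mul.
by congr (rho (mx2 _ _ _ _) x); field.
Qed.

(* [fixK n]: fixed by K_(n+1); [nfix j]: fixed by the lower unipotents of p^j; [fixI]: fixed
   by the pro-p Iwahori group, through its Iwahori decomposition. *)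
Definition fixK (n : nat) x := forall k, inK v n k -> rho k x = x.
Definition ufix x := forall b, G b 0 -> rho (um b) x = x.
Definition bfix x := ufix x /\
  forall a d, G (a - 1) 1 -> G (d - 1) 1 -> rho (dg a d) x = x.
Definition nfix (j : int) x := forall c, G c j -> rho (nm c) x = x.
Definition fixI x := bfix x /\ nfix 1 x.

Lemma inK_mx2 (n : nat) a b c d : G (a - 1) n.+1 -> G b n.+1 -> G c n.+1 -> G (d - 1) n.+1 ->
  inK v n (mx2 a b c d).
Proof.
move=> ha hb hc hd; split; last first.
  by move=> i j; rewrite !mxE; case: (ord2 i) => ->; case: (ord2 j) => -> /=; rewrite ?subr0.
rewrite mx2_unit; apply: (vunit_neq0 (v := v)); apply: (vunit_1cong HF (n := n.+1)) => //.
have -> : a * d - b * c - 1 = (a - 1) * (d - 1) + (a - 1) + (d - 1) - b * c by ring.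
have W x : G x n.+1 -> G x 0 by apply: vgeW.
apply: (vgeB HF); last by apply: (vge_mull HF) => //; exact: W.
by do 2![apply: (vgeD HF) => //]; apply: (vge_mull HF) => //; exact: W.
Qed.

Lemma inKE (n : nat) k : inK v n k -> exists a b c d, [/\ k = mx2 a b c d,
  G (a - 1) n.+1, G b n.+1, G c n.+1 & G (d - 1) n.+1].
Proof.
move=> [ku hk]; exists (k 0 0), (k 0 1), (k 1 0), (k 1 1); split.
- exact: mx2_eta.
- by have := hk 0 0; rewrite mxE eqxx.
- by have := hk 0 1; rewrite mxE /= subr0.
- by have := hk 1 0; rewrite mxE /= subr0.
- by have := hk 1 1; rewrite mxE eqxx.
Qed.

Definition intGL a b c d := [/\ G a 0, G b 0, G c 0, G d 0 & vunit v (a * d - b * c)].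

Lemma intGL_unit a b c d : intGL a b c d -> mx2 a b c d \in unitmx.
Proof. by case=> _ _ _ _ /vunit_neq0; rewrite mx2_unit. Qed.

(* Elements of GL_2(O) congruent modulo p^(n+1) differ by an element of K_(n+1). *)
Lemma cong_act (n : nat) x a b c d a' b' c' d' : fixK n x -> intGL a' b' c' d' ->
  G (a - a') n.+1 -> G (b - b') n.+1 -> G (c - c') n.+1 -> G (d - d') n.+1 ->
  rho (mx2 a b c d) x = rho (mx2 a' b' c' d') x.
Proof.
move=> fx g' ha hb hc hd; case: (g') => ga gb gc gd uD.
set D := a' * d' - b' * c' in uD; have D0 := vunit_neq0 uD.
have gD : G D^-1 0 by apply: vunit_int; exact: (vunitV HF uD).
pose k := mx2 ((d' * a - b' * c) / D) ((d' * b - b' * d) / D)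
              ((a' * c - c' * a) / D) ((a' * d - c' * b) / D).
have kK : inK v n k.
  apply: inK_mx2.
  - have -> : (d' * a - b' * c) / D - 1 = (d' * (a - a') - b' * (c - c')) * D^-1.
      by rewrite /D in D0 *; field.
    by apply: (vge_mulr HF) => //; apply: (vgeB HF); apply: (vge_mull HF).
  - have -> : (d' * b - b' * d) / D = (d' * (b - b') - b' * (d - d')) * D^-1.
      by rewrite /D in D0 *; field.
    by apply: (vge_mulr HF) => //; apply: (vgeB HF); apply: (vge_mull HF).
  - have -> : (a' * c - c' * a) / D = (a' * (c - c') - c' * (a - a')) * D^-1.
      by rewrite /D in D0 *; field.
    by apply: (vge_mulr HF) => //; apply: (vgeB HF); apply: (vge_mull HF).
  - have -> : (a' * d - c' * b) / D - 1 = (a' * (d - d') - c' * (b - b')) * D^-1.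
      by rewrite /D in D0 *; field.
    by apply: (vge_mulr HF) => //; apply: (vgeB HF); apply: (vge_mull HF).
have -> : mx2 a b c d = mx2 a' b' c' d' *m k.
  by rewrite /um /nm /dg /sm mx2_mul; congr (mx2 _ _ _ _); rewrite /D in D0 *; field.
rewrite -actM; first by rewrite fx.
  exact: intGL_unit.
by case: kK.
Qed.

Lemma one_cong_neq0 a : G (a - 1) 1 -> a != 0.
Proof. by move=> h; apply: (vunit_neq0 (v := v)); apply: (vunit_1cong HF) h. Qed.

Lemma fixI_K x : fixI x -> fixK 0 x.
Proof.
move=> [[ux dx] nx] k /inKE [a [b [c [d [-> ha hb hc hd]]]]].
have ud : vunit v d by apply: (vunit_1cong HF) hd.
have ua : vunit v a by apply: (vunit_1cong HF) ha.
have d0 := vunit_neq0 ud; have gd := vunit_int (vunitV HF ud).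
have bc : G (b * c) 1 by apply: (vge_mulr HF) => //; apply: vgeW hc.
have uD : vunit v (a * d - b * c).
  apply: (vunit_cong HF (vunitM HF ua ud)).
  by rewrite addrAC subrr add0r; apply: (vgeN HF).
rewrite mx2_bigcell //; last exact: vunit_neq0 uD.
rewrite nx; last exact: (vge_mulr HF).
rewrite dx; first by apply: ux; apply: (vge_mulr HF) => //; apply: vgeW hb.
  have -> : (a * d - b * c) / d - 1 = (a - 1) - b * c / d by field.
  by apply: (vgeB HF) => //; apply: (vge_mulr HF).
exact: hd.
Qed.

Lemma fixI_intro x : fixK 0 x -> ufix x -> fixI x.
Proof.
move=> Kx ux; split; [split=> //|].
  by move=> a d ha hd; apply: Kx; apply: inK_mx2 => //; left.
by move=> c hc; apply: Kx; apply: inK_mx2; rewrite ?subrr //; left.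
Qed.

Lemma subspace_fixI : subspace fixI.
Proof.
have z g : g \in unitmx -> rho g 0 = 0 by move=> gu; rewrite (lin0 (act_lin gu)).
split.
  split; [split|].
  - by move=> b _; rewrite z ?um_GL.
  - by move=> a d /one_cong_neq0 a0 /one_cong_neq0 d0; rewrite z ?dg_GL.
  - by move=> c _; rewrite z ?nm_GL.
move=> k x y [[ux dx] nx] [[uy dy] ny]; split; [split|].
- by move=> b hb; rewrite um_lin ux ?uy.
- move=> a d ha hd; rewrite (dg_lin (one_cong_neq0 ha) (one_cong_neq0 hd)).
  by rewrite dx ?dy.
- by move=> c hc; rewrite nm_lin nx ?ny.
Qed.

Lemma subspace_fixK n : subspace (fixK n).
Proof.
split; first by move=> k [ku _]; rewrite (lin0 (act_lin ku)).
by move=> c x y fx fy k hk; have [ku _] := hk; rewrite (act_lin ku) fx ?fy.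
Qed.

Lemma subspace_ufix : subspace ufix.
Proof.
split; first by move=> b _; rewrite (lin0 (um_lin b)).
by move=> c x y fx fy b hb; rewrite um_lin fx ?fy.
Qed.

Lemma dg_fixI a d x : vunit v a -> vunit v d -> fixI x -> fixI (rho (dg a d) x).
Proof.
move=> ua ud fx; have a0 := vunit_neq0 ua; have d0 := vunit_neq0 ud.
have := fx => -[[ux dx] nx]; split; [split|].
- move=> b hb; have -> : b = a * (a^-1 * d * b) / d by field; rewrite ?a0 ?d0.
  rewrite -dg_um // ux //; apply: (vge_mull HF) => //.
  by apply: vunit_int; apply: (vunitM HF) => //; apply: (vunitV HF).
- move=> a' d' ha hd; have a'0 := one_cong_neq0 ha; have d'0 := one_cong_neq0 hd.
  by rewrite dg_dg // mulrC [d' * d]mulrC -dg_dg // dx.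
- move=> c hc; rewrite nm_dg // nx //.
  rewrite -mulrA; apply: (vge_mulr HF) => //.
  by apply: vunit_int; apply: (vunitM HF) => //; apply: (vunitV HF).
Qed.

Variable w : F.
Hypotheses (w0 : w != 0) (vw : v w = 1).
Definition tm (m : int) := dg (w ^ m) (1 : F).
Lemma wX_neq0 (m : int) : w ^ m != 0. Proof. exact: expfz_neq0. Qed.
Lemma tm_GL m : tm m \in unitmx. Proof. by rewrite dg_GL ?wX_neq0 ?oner_neq0. Qed.
Lemma tm_P m : inP (tm m). Proof. by apply: dg_P; rewrite ?wX_neq0 ?oner_neq0. Qed.
Lemma tm_lin m : is_linear (rho (tm m)). Proof. exact/act_lin/tm_GL. Qed.
Lemma tm_tm m n x : rho (tm m) (rho (tm n) x) = rho (tm (m + n)) x.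
Proof. by rewrite dg_dg ?wX_neq0 ?oner_neq0 // mulr1 -expfzDr. Qed.
Lemma tm0 x : rho (tm 0) x = x. Proof. by rewrite /tm expr0z dg11. Qed.
Lemma tm_um m b x : rho (tm m) (rho (um b) x) = rho (um (w ^ m * b)) (rho (tm m) x).
Proof. by rewrite dg_um ?wX_neq0 ?oner_neq0 // divr1. Qed.
Lemma um_tm m b x : rho (um b) (rho (tm m) x) = rho (tm m) (rho (um (w ^ (- m) * b)) x).
Proof. by rewrite tm_um mulrA -expfzDr // subrr expr0z mul1r. Qed.
Lemma nm_tm m c x : rho (nm c) (rho (tm m) x) = rho (tm m) (rho (nm (c * w ^ m)) x).
Proof. by rewrite nm_dg ?wX_neq0 ?oner_neq0 // divr1. Qed.
Lemma um_dg a d b x : a != 0 -> d != 0 ->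
  rho (um b) (rho (dg a d) x) = rho (dg a d) (rho (um (b * d / a)) x).
Proof. by move=> a0 d0; rewrite dg_um //; congr (rho (um _) _); field; rewrite ?a0 ?d0. Qed.
Lemma um_tm_fix m b x : ufix x -> G b m -> rho (um b) (rho (tm m) x) = rho (tm m) x.
Proof.
move=> ux h; rewrite um_tm ux //.
have := vge_wzM HF w0 vw (- m) h; by rewrite addNr.
Qed.
Lemma dg_tm a d m x : a != 0 -> d != 0 ->
  rho (dg a d) (rho (tm m) x) = rho (tm m) (rho (dg a d) x).
Proof.
by move=> a0 d0; rewrite !dg_dg ?wX_neq0 ?oner_neq0 // mulrC [d * 1]mulrC.
Qed.

(* The lower unipotents are pushed one level down by conjugation with t; the upper
   unipotent is crossed by means of the identity [nm_um]. *)
Lemma contraction (j : int) mu a d y : 1 <= j -> bfix y -> nfix (j + 1) y -> G mu 0 ->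
  vunit v a -> vunit v d -> nfix j (rho (um mu) (rho (dg a d) (rho (tm 1) y))).
Proof.
move=> j1 [uy dy] ny gmu ua ud c hc.
have a0 := vunit_neq0 ua; have d0 := vunit_neq0 ud.
have hc1 : G c 1 by apply: vgeW hc.
have gcm : G (c * mu) 1 by apply: (vge_mulr HF).
have ue : vunit v (1 + c * mu).
  by apply: (vunit_1cong HF (n := 1)) => //; rewrite addrAC subrr add0r.
set e := 1 + c * mu in ue *; have e0 := vunit_neq0 ue.
have ge : G e^-1 0 by apply: vunit_int; exact: (vunitV HF ue).
have e1 : G (e - 1) 1 by rewrite /e addrAC subrr add0r.
rewrite nm_um // -/e nm_dg // nm_tm ny; last first.
  rewrite expr1z; apply: (vgeM HF); last by right; rewrite vw.
  rewrite -mulrA; apply: (vge_mulr HF); last first.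
    by apply: vunit_int; apply: (vunitM HF) => //; apply: (vunitV HF).
  exact: (vge_mulr HF).
rewrite dg_dg ?invr_neq0 // [_^-1 * a]mulrC [e * d]mulrC -dg_dg ?invr_neq0 //.
rewrite dg_tm ?invr_neq0 // dy //; last first.
  have -> : e^-1 - 1 = - (e - 1) * e^-1 by field.
  by apply: (vge_mulr HF) => //; apply: (vgeN HF).
(* mu/e and mu differ by an element of p, and t y is fixed by the unipotents of p = w O. *)
have -> : mu / e = mu + (mu / e - mu) by ring.
rewrite -um_um um_dg // um_tm_fix //.
have -> : mu / e - mu = - (e - 1) * (mu / e) by field.
rewrite -!mulrA; apply: (vge_mulr HF); first exact: (vgeN HF).
apply: (vge_mull HF) => //; apply: (vge_mull HF) => //.
by apply: vunit_int; apply: (vunitM HF) => //; apply: (vunitV HF).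
Qed.

Variable ks : seq F.
Hypothesis rk : isreps v 1 (0 :: ks).
Hypothesis pC : p \in [pchar C].

(* [Sop] is the operator S of the introduction, and [Top] the Hecke operator of the double
   coset of s in the finite group GL_2(O/p); S x = T (Pi x). *)
Definition Sop x := \sum_(l <- 0 :: ks) rho (um l) (rho (tm 1) x).
Definition Top x := \sum_(l <- 0 :: ks) rho (um l) (rho sm x).

Lemma ks_int l : l \in 0 :: ks -> G l 0.
Proof. by case: rk => _ h _ _; apply: h. Qed.
Lemma ks_unit l : l \in ks -> vunit v l.
Proof. exact: (ks_vunit rk). Qed.

Lemma Sop_lin : is_linear Sop.
Proof.
move=> a x y; rewrite /Sop scaler_sumr -big_split /=; apply: eq_bigr => l _.
by rewrite tm_lin um_lin.
Qed.
Lemma Top_lin : is_linear Top.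
Proof.
move=> a x y; rewrite /Top scaler_sumr -big_split /=; apply: eq_bigr => l _.
by rewrite sm_lin um_lin.
Qed.

Lemma card_residue_eq0 : (size (0%R :: ks))%:R = 0 :> C.
Proof. by apply/eqP; rewrite -(dvdn_pcharf pC); exact: (dvdn_residue_card HF rk). Qed.

Lemma sum_ks_const (x : V) : \sum_(l <- 0 :: ks) x = 0.
Proof.
by rewrite big_const_seq count_predT iter_addr_0 -scaler_nat card_residue_eq0 scale0r.
Qed.

Lemma um_cong_tm (m : int) x l l' : ufix x -> G (l - l') m ->
  rho (um l) (rho (tm m) x) = rho (um l') (rho (tm m) x).
Proof.
move=> ux h; have -> : l = l' + (l - l') by ring.
by rewrite -um_um um_tm_fix.
Qed.
Lemma um_cong_sm x l l' : nfix 1 x -> G (l - l') 1 ->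
  rho (um l) (rho sm x) = rho (um l') (rho sm x).
Proof.
move=> nx h; have -> : l = l' + (l - l') by ring.
by rewrite -um_um um_sm nx.
Qed.

Lemma Top_ufix x : nfix 1 x -> ufix (Top x).
Proof.
move=> nx b gb; rewrite /Top (lin_sum (um_lin b)).
rewrite -(sum_shift HF (H := fun l => rho (um l) (rho sm x)) rk gb); last first.
  by move=> l l' _ _; apply: um_cong_sm.
by apply: eq_bigr => l _; rewrite um_um addrC.
Qed.

Lemma Sop_nfix j x : 1 <= j -> bfix x -> nfix (j + 1) x -> nfix j (Sop x).
Proof.
move=> j1 bx nx c hc; rewrite /Sop (lin_sum (nm_lin c)); apply: eq_big_seq => l lk.
rewrite -[rho (tm 1) x]dg11 (contraction j1 bx nx) //; first exact: ks_int.
- exact: (vunit1 HF).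
- exact: (vunit1 HF).
Qed.

Lemma Sop_bfix x : bfix x -> bfix (Sop x).
Proof.
move=> [ux dx]; split.
  move=> b gb; rewrite /Sop (lin_sum (um_lin b)).
  rewrite -(sum_shift HF (H := fun l => rho (um l) (rho (tm 1) x)) rk gb); last first.
    by move=> l l' _ _; apply: um_cong_tm.
  by apply: eq_bigr => l _; rewrite um_um addrC.
move=> a d ha hd; have a0 := one_cong_neq0 ha; have d0 := one_cong_neq0 hd.
rewrite /Sop (lin_sum (dg_lin a0 d0)); apply: eq_big_seq => l lk.
rewrite dg_um // dg_tm // dx //; apply: um_cong_tm => //.
have -> : a * l / d - l = (a - 1 - (d - 1)) * (l / d) by field.
apply: (vge_mulr HF); first exact: (vgeB HF).
apply: (vge_mull HF); first exact: ks_int.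
by apply: vunit_int; apply: (vunitV HF); apply: (vunit_1cong HF) hd.
Qed.

Lemma nfixW j j' x : j <= j' -> nfix j x -> nfix j' x.
Proof. by move=> le nx c hc; apply: nx; apply: vgeW hc. Qed.

Lemma Sop_fixI x : fixI x -> fixI (Sop x).
Proof.
by move=> [bx nx]; split; [exact: Sop_bfix | apply: Sop_nfix => //; apply: nfixW nx].
Qed.

Lemma Sop_dg a d x : vunit v a -> vunit v d -> ufix x ->
  Sop (rho (dg a d) x) = rho (dg a d) (Sop x).
Proof.
move=> ua ud ux; have a0 := vunit_neq0 ua; have d0 := vunit_neq0 ud.
rewrite /Sop (lin_sum (dg_lin a0 d0)).
rewrite -(sum_scale HF (H := fun l => rho (um l) (rho (tm 1) (rho (dg a d) x))) rk
  (vunitM HF ua (vunitV HF ud))).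
  by apply: eq_bigr => l _; rewrite dg_um // dg_tm // mulrAC.
move=> l l' _ _ h; apply: um_cong_tm => // b gb.
rewrite um_dg // ux //; rewrite -mulrA; apply: (vge_mulr HF) => //.
by apply: vunit_int; apply: (vunitM HF) => //; apply: (vunitV HF).
Qed.

Lemma Top_dg a d x : vunit v a -> vunit v d -> fixI x ->
  Top (rho (dg a d) x) = rho (dg d a) (Top x).
Proof.
move=> ua ud fx; have a0 := vunit_neq0 ua; have d0 := vunit_neq0 ud.
rewrite /Top (lin_sum (dg_lin d0 a0)).
rewrite -(sum_scale HF (H := fun l => rho (um l) (rho sm (rho (dg a d) x))) rk
  (vunitM HF ud (vunitV HF ua))).
  by apply: eq_bigr => l _; rewrite dg_um // sm_dg // mulrAC.
move=> l l' _ _ h; apply: um_cong_sm => //.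
by case: (dg_fixI ua ud fx).
Qed.

Lemma sm_um_sm c x : c != 0 -> ufix x -> G c^-1 0 ->
  rho sm (rho (um c) (rho sm x)) = rho (um c^-1) (rho (dg (- c^-1) c) (rho sm x)).
Proof.
move=> c0 ux gc; by rewrite sm_um // nm_sm ux.
Qed.

(** Apply s to T x = 0: the term l = 0 becomes x, and the terms s u(l) s x with l a unit fall into
    the big cell, where the lower unipotent is absorbed by s x. *)
Lemma Top0_bigcell x : ufix x -> Top x = 0 ->
  x = - \sum_(l <- ks) rho (um l^-1) (rho (dg (- l^-1) l) (rho sm x)).
Proof.
move=> ux; rewrite /Top big_cons um0 => e.
have := congr1 (rho sm) e; rewrite (lin0 sm_lin) (linD sm_lin) sm_sm (lin_sum sm_lin).
move=> /eqP; rewrite addr_eq0 => /eqP e'; rewrite [LHS]e'; congr (- _).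
apply: eq_big_seq => l lk; have ul := ks_unit lk.
rewrite sm_um_sm //; first exact: vunit_neq0 ul.
by apply: vunit_int; apply: (vunitV HF).
Qed.

Lemma Top_sm_tm x : Top (rho sm (rho (tm 1) x)) = Sop x.
Proof. by apply: eq_bigr => l _; rewrite sm_sm. Qed.

(** This is [Top0_bigcell] at Pi x = s t x, since T (Pi x) = S x and s Pi x = t x. *)
Lemma Sop0_bigcell x : fixI x -> Sop x = 0 ->
  rho sm (rho (tm 1) x) =
  - \sum_(l <- ks) rho (um l^-1) (rho (dg (- l^-1) l) (rho (tm 1) x)).
Proof.
move=> fx Sx; rewrite {1}(@Top0_bigcell (rho sm (rho (tm 1) x))) ?Top_sm_tm //.
  by congr (- _); apply: eq_bigr => l _; rewrite sm_sm.
move=> b gb; rewrite um_sm nm_tm; case: fx => _ -> //.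
by apply: (vge_mull HF) => //; right; rewrite expr1z vw.
Qed.

(** The quadratic Hecke relation. In T (T x) the term of s x is the cardinality of O/p times x,
    which is 0 in C. For a unit m, s u(m) s x is u(1/m) times a torus translate of s x; the sum over
    residues absorbs the shift by 1/m. *)
Lemma Top_Top x (chi : F -> C) : fixI x ->
  (forall l, l \in ks -> rho (dg l (- l^-1)) x = chi l *: x) ->
  Top (Top x) = (\sum_(l <- ks) chi l) *: Top x.
Proof.
move=> fx hchi; have [[ux _] nx] := fx.
rewrite {2}/Top big_cons um0 (linD Top_lin) (lin_sum Top_lin).
have -> : Top (rho sm x) = 0.
  rewrite /Top (eq_big_seq (fun=> x)) ?sum_ks_const // => l lk.
  by rewrite sm_sm ux //; exact: ks_int.
rewrite add0r scaler_suml; apply: eq_big_seq => m mk.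
have um_ := ks_unit mk; have m0 := vunit_neq0 um_; have gm := vunit_int (vunitV HF um_).
have m1 : - m^-1 != 0 by rewrite oppr_eq0 invr_neq0.
rewrite {2}/Top scaler_sumr.
rewrite -[RHS](sum_shift HF (H := fun l => chi m *: rho (um l) (rho sm x)) rk gm); last first.
  by move=> l l' _ _ h; congr (_ *: _); apply: um_cong_sm.
apply: eq_bigr => l _.
by rewrite sm_um_sm // -sm_dg // hchi // (linZ sm_lin) (linZ (um_lin _)) (linZ (um_lin _)) um_um.
Qed.

End Representation.

(** * Irreducible K-subrepresentations *)

Section Weights.
Variables (p : nat) (F : fieldType) (v : F -> int).
Hypothesis HF : nonarch_local_field p v.
Local Notation G := (vge v).
Variables (C : closedFieldType) (V : lmodType C) (rho : 'M[F]_2 -> V -> V).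
Hypothesis Hr : is_rep rho.
Variables (w : F) (ks : seq F).
Hypotheses (w0 : w != 0) (vw : v w = 1) (rk : isreps v 1 (0 :: ks)) (pC : p \in [pchar C]).

Local Notation fixK := (fixK v rho).
Local Notation ufix := (ufix v rho).
Local Notation fixI := (fixI v rho).
Local Notation T := (Top rho ks).

Lemma vge_int (n : nat) x : G x n -> G x 0. Proof. exact: vgeW. Qed.

Definition KO (g : 'M[F]_2) := exists a b c d, g = mx2 a b c d /\ intGL v a b c d.

Lemma KO_unit g : KO g -> g \in unitmx.
Proof. by move=> [a [b [c [d [-> /intGL_unit]]]]]. Qed.

Lemma KO_mul g h : KO g -> KO h -> KO (g *m h).
Proof.
move=> [a [b [c [d [-> [ga gb gc gd uD]]]]]] [a' [b' [c' [d' [-> [ga' gb' gc' gd' uD']]]]]].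
rewrite mx2_mul; do 4!eexists; split; first by [].
split; try by apply: (vgeD HF) => //; apply: (vge_mull HF).
have -> : (a * a' + b * c') * (c * b' + d * d') - (a * b' + b * d') * (c * a' + d * c')
  = (a * d - b * c) * (a' * d' - b' * c') by ring.
exact: (vunitM HF).
Qed.

Lemma KO_um b : G b 0 -> KO (um b).
Proof.
move=> gb; do 4!eexists; split; first by [].
split=> //; try exact: (vge1 HF); first exact: vge0.
by rewrite mulr0 subr0 mulr1; exact: (vunit1 HF).
Qed.

Lemma KO_sm : KO sm.
Proof.
do 4!eexists; split; first by [].
split=> //; try exact: (vge1 HF); try exact: vge0.
by rewrite mulr0 sub0r mulr1; apply: (vunitN HF); exact: (vunit1 HF).
Qed.

Lemma KO_dg a d : vunit v a -> vunit v d -> KO (dg a d).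
Proof.
move=> ua ud; do 4!eexists; split; first by [].
split=> //; try exact: vge0; try exact: vunit_int.
by rewrite mulr0 subr0; exact: (vunitM HF).
Qed.

Lemma inK_KO n k : inK v n k -> KO k.
Proof.
move=> /(inKE) [a [b [c [d [-> ha hb hc hd]]]]].
have ua : vunit v a by apply: (vunit_1cong HF) ha.
have ud : vunit v d by apply: (vunit_1cong HF) hd.
do 4!eexists; split; first by [].
split; [exact: vunit_int | exact: vge_int hb | exact: vge_int hc | exact: vunit_int |].
apply: (vunit_cong HF (vunitM HF ua ud)); rewrite addrAC subrr add0r; apply: (vgeN HF).
by apply: (vge_mulr HF); [apply: vgeW hb | exact: vge_int hc].
Qed.

(** Normality of K_(n+1) in K, in the form k g = g modulo p^(n+1). *)
Lemma fixK_KO n g x : KO g -> fixK n x -> fixK n (rho g x).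
Proof.
move=> [a [b [c [d [-> ig]]]]] fx k kK; have [ku _] := kK.
have [a' [b' [c' [d' [kE ha hb hc hd]]]]] := inKE kK.
rewrite (actM Hr) // ?(intGL_unit ig) // kE mx2_mul; have [ga gb gc gd _] := ig.
apply: (cong_act HF Hr fx ig).
- have -> : a' * a + b' * c - a = (a' - 1) * a + b' * c by ring.
  by apply: (vgeD HF); apply: (vge_mulr HF).
- have -> : a' * b + b' * d - b = (a' - 1) * b + b' * d by ring.
  by apply: (vgeD HF); apply: (vge_mulr HF).
- have -> : c' * a + d' * c - c = c' * a + (d' - 1) * c by ring.
  by apply: (vgeD HF); apply: (vge_mulr HF).
- have -> : c' * b + d' * d - d = c' * b + (d' - 1) * d by ring.
  by apply: (vgeD HF); apply: (vge_mulr HF).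
Qed.

Lemma cong_actKO n x (g g' : 'M[F]_2) : fixK n x -> KO g' ->
  (forall i j, G (g i j - g' i j) n.+1) -> rho g x = rho g' x.
Proof.
move=> fx [a [b [c [d [-> ig]]]]] h; rewrite [g]mx2_eta.
apply: (cong_act HF Hr fx ig).
- by have := h 0 0; rewrite mx2E.
- by have := h 0 1; rewrite mx2E.
- by have := h 1 0; rewrite mx2E.
- by have := h 1 1; rewrite mx2E.
Qed.

(* K_(n+1)/K_(n+2) is an elementary abelian p-group. *)
Lemma fixK_descend n : (exists2 x, fixK n.+1 x & x <> 0) -> exists2 x, fixK n x & x <> 0.
Proof.
move=> nz; pose e := w ^+ n.+1.
have ge x : G x 0 -> G (e * x) n.+1.
  by move=> gx; have := vge_wXM HF w0 vw n.+1 gx; rewrite addr0.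
have ge2 x : G x 0 -> G (e * e * x) n.+2.
  move=> gx; have := vgeM HF (ge _ (vge1 HF)) (ge _ gx); rewrite mulr1 mulrA.
  by apply: vgeW; lia.
pose I := ((F * F) * (F * F))%type.
pose ki (i : I) := mx2 (1 + e * i.1.1) (e * i.1.2) (e * i.2.1) (1 + e * i.2.2).
pose ok (i : I) := [/\ G i.1.1 0, G i.1.2 0, G i.2.1 0 & G i.2.2 0].
pose l := [seq (x, y) | x <- [seq (a, b) | a <- 0 :: ks, b <- 0 :: ks],
                        y <- [seq (a, b) | a <- 0 :: ks, b <- 0 :: ks]].
have kint := ks_int rk.
have lok i : i \in l -> ok i.
  move=> /allpairsP [[x y] [/allpairsP [[a b] [/kint h1 /kint h2 ->]]
    /allpairsP [[c d] [/kint h3 /kint h4 ->]] ->]] //.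
have kK i : ok i -> inK v n (ki i).
  case=> h1 h2 h3 h4; apply: (inK_mx2 HF); rewrite ?[1 + _]addrC ?addrK; exact: ge.
have kKO i : ok i -> KO (ki i) by move=> /kK; apply: inK_KO.
have ku i : ok i -> ki i \in unitmx by move=> /kKO; apply: KO_unit.
have [||||||x [fx x0 hx]] := @pgroup_fixed_vector C V p 1 I (fun i => rho (ki i)) l (fixK n.+1) pC.
- by move=> i /lok /ku; apply: (act_lin Hr).
- by move=> i x /lok /kKO; apply: fixK_KO.
- move=> i j x /lok oi /lok oj fx; rewrite !(actM Hr) ?ku //.
  apply: (cong_actKO fx); first by apply: KO_mul; apply: kKO.
  case: oi oj => h1 h2 h3 h4 [h1' h2' h3' h4'].
  have D := vgeD HF; have B := vgeB HF; have M := vge_mull HF.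
  move=> a b; rewrite /ki !mx2_mul; case: (ord2 a) => ->; case: (ord2 b) => ->; rewrite !mx2E.
  + set z := (X in G X _); have -> : z = e * e * (i.1.2 * j.2.1 - j.1.2 * i.2.1) by rewrite /z; ring.
    by apply: ge2; auto.
  + set z := (X in G X _); have -> : z = e * e * (i.1.1 * j.1.2 + i.1.2 * j.2.2 - (j.1.1 * i.1.2 + j.1.2 * i.2.2)) by rewrite /z; ring.
    by apply: ge2; auto.
  + set z := (X in G X _); have -> : z = e * e * (i.2.1 * j.1.1 + i.2.2 * j.2.1 - (j.2.1 * i.1.1 + j.2.2 * i.2.1)) by rewrite /z; ring.
    by apply: ge2; auto.
  + set z := (X in G X _); have -> : z = e * e * (i.2.1 * j.1.2 - j.2.1 * i.1.2) by rewrite /z; ring.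
    by apply: ge2; auto.
- move=> i x /lok oi fx; rewrite expn1.
  (* Since 2(n+1) >= n+2, the power (1 + eA)^m acts as 1 + m e A on a vector fixed by K_(n+2); for m
     = p this matrix lies in K_(n+2). *)
  pose mi (m : nat) : I := ((m%:R * i.1.1, m%:R * i.1.2), (m%:R * i.2.1, m%:R * i.2.2)).
  have D := vgeD HF; have B := vgeB HF; have M := vge_mull HF; have gN := vge_natmul HF.
  have omi m : ok (mi m) by case: oi => h1 h2 h3 h4; split; apply: M.
  have it m : iter m (rho (ki i)) x = rho (ki (mi m)) x.
    elim: m => [|m IH].
      by rewrite /= /ki /= !mul0r !mulr0 !addr0 mx2_scalar (act1 Hr).
    rewrite iterS IH (actM Hr) ?ku //; apply: (cong_actKO fx); first exact: kKO.
    case: oi => h1 h2 h3 h4 a b; rewrite /ki mx2_mul.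
    case: (ord2 a) => ->; case: (ord2 b) => ->; rewrite !mx2E /= -natr1.
    + set z := (X in G X _); have -> : z = e * e * (m%:R * (i.1.1 * i.1.1 + i.1.2 * i.2.1)) by rewrite /z; ring.
      by apply: ge2; auto.
    + set z := (X in G X _); have -> : z = e * e * (m%:R * (i.1.1 * i.1.2 + i.1.2 * i.2.2)) by rewrite /z; ring.
      by apply: ge2; auto.
    + set z := (X in G X _); have -> : z = e * e * (m%:R * (i.2.1 * i.1.1 + i.2.2 * i.2.1)) by rewrite /z; ring.
      by apply: ge2; auto.
    + set z := (X in G X _); have -> : z = e * e * (m%:R * (i.2.1 * i.1.2 + i.2.2 * i.2.2)) by rewrite /z; ring.
      by apply: ge2; auto.
  rewrite it; apply: fx; case: oi => h1 h2 h3 h4.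
  have gp y : G y 0 -> G (e * (p%:R * y)) n.+2.
    move=> gy; rewrite mulrCA; have := vgeM HF (pi_vge HF) (ge _ gy).
    by rewrite -PoszD add1n.
  by apply: (inK_mx2 HF); rewrite ?[1 + _]addrC ?addrK; apply: gp.
- exact: subspace_fixK.
- exact: nz.
exists x => // k kK_; have [a [b [c [d [-> ha hb hc hd]]]]] := inKE kK_.
have [a' ga' ea] := vge_dvd HF w0 vw ha; have [b' gb' eb] := vge_dvd HF w0 vw hb.
have [c' gc' ec] := vge_dvd HF w0 vw hc; have [d' gd' ed] := vge_dvd HF w0 vw hd.
case: (rk) => _ _ cov _.
have [a2 a2k ha2] := cov _ ga'; have [b2 b2k hb2] := cov _ gb'.
have [c2 c2k hc2] := cov _ gc'; have [d2 d2k hd2] := cov _ gd'.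
have il : ((a2, b2), (c2, d2)) \in l.
  by apply/allpairsP; exists ((a2, b2), (c2, d2)); split=> //;
   apply/allpairsP; [exists (a2, b2) | exists (c2, d2)].
rewrite -[RHS](hx _ il); apply: (cong_actKO fx); first exact: kKO (lok _ il).
have g2 y : G y 1 -> G (e * y) n.+2.
  by move=> /(vge_wXM HF w0 vw n.+1); rewrite -PoszD addn1.
have aE : a = 1 + e * a' by rewrite /e exprnP -ea addrC subrK.
have dE : d = 1 + e * d' by rewrite /e exprnP -ed addrC subrK.
rewrite aE dE eb ec -exprnP -/e => i j; case: (ord2 i) => ->; case: (ord2 j) => ->; rewrite !mx2E /=.
- by rewrite opprD addrACA subrr add0r -mulrBr; exact: g2.
- by rewrite -mulrBr; exact: g2.
- by rewrite -mulrBr; exact: g2.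
- by rewrite opprD addrACA subrr add0r -mulrBr; exact: g2.
Qed.

Lemma fixK0_exists : smooth_rep v rho -> (exists x : V, x != 0) ->
  exists2 x, fixK 0 x & x <> 0.
Proof.
move=> [_ sm] [x x0]; have [n fx] := sm x.
have : exists2 x, fixK n x & x <> 0 by exists x => //; apply/eqP.
by elim: n {fx} => // n IH /fixK_descend.
Qed.

Definition Kst (W : V -> Prop) := forall g x, KO g -> W x -> W (rho g x).
Definition Heig x := forall a d, vunit v a -> vunit v d -> exists c : C, rho (dg a d) x = c *: x.

Lemma um_cong_fixK x b b' : fixK 0 x -> G b 0 -> G (b - b') 1 -> rho (um b) x = rho (um b') x.
Proof.
move=> fx gb h; have -> : b' = b + (b' - b) by ring.
rewrite -(um_um Hr); congr (rho _ _); rewrite [RHS]fx //.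
by apply: (inK_mx2 HF); rewrite ?subrr; by [exact: vge0|apply: (vgeBC HF)].
Qed.

Lemma ufixed_vector W : subspace W -> (forall x, W x -> fixK 0 x) ->
  (forall b x, G b 0 -> W x -> W (rho (um b) x)) -> (exists2 x, W x & x <> 0) ->
  exists x, [/\ W x, x <> 0 & ufix x].
Proof.
move=> sW WK st nz; have kint := ks_int rk.
have [||||x [Wx x0 hx]] := @pgroup_fixed_vector C V p 1 F (fun b => rho (um b)) (0 :: ks) W pC
   _ _ _ _ sW nz.
- by move=> b _; apply: (um_lin Hr).
- by move=> b x /kint; apply: st.
- by move=> b c x _ _ _; rewrite !(um_um Hr) addrC.
- move=> b x /kint gb Wx; rewrite expn1.
  have -> m : iter m (rho (um b)) x = rho (um (m%:R * b)) x.
    elim: m => [|m IH]; first by rewrite mul0r (um0 Hr).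
    by rewrite iterS IH (um_um Hr) -natr1 mulrDl mul1r addrC.
  rewrite -[RHS](um0 Hr); apply: (um_cong_fixK (WK _ Wx)).
    by apply: (vge_mull HF) => //; apply: (vge_natmul HF).
  by rewrite subr0; apply: (vge_mulr HF) => //; apply: (pi_vge HF).
exists x; split=> // b gb; case: (rk) => _ _ cov _; have [c ck bc] := cov b gb.
by rewrite (um_cong_fixK (WK _ Wx) gb bc) hx.
Qed.

(** On vectors fixed by I_1 the unit torus acts through T(O/p), which is generated by the finitely
    many diag(a, 1) and diag(1, d) with a, d in [ks], all periodic. *)
Lemma Heig_vector W : subspace W -> (forall x, W x -> fixI x) ->
  (forall a d x, vunit v a -> vunit v d -> W x -> W (rho (dg a d) x)) ->
  (exists2 x, W x & x <> 0) -> exists x, [/\ W x, x <> 0 & Heig x].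
Proof.
move=> sW WI st nz; have kun := ks_unit rk; have u1 := vunit1 HF.
pose l := [seq (a, (1 : F)) | a <- ks] ++ [seq ((1 : F), d) | d <- ks].
have lu i : i \in l -> vunit v i.1 /\ vunit v i.2.
  by rewrite mem_cat => /orP[] /mapP [a /kun ua ->].
have dgc a d a' d' x : fixI x -> vunit v a -> vunit v d -> vunit v a' -> vunit v d' ->
    G (a - a') 1 -> G (d - d') 1 -> rho (dg a d) x = rho (dg a' d') x.
  move=> fx ua ud ua' ud' ha hd.
  have := vunit_neq0 ua; have := vunit_neq0 ud; have := vunit_neq0 ua'; have := vunit_neq0 ud'.
  move=> d'0 a'0 d0 a0; have [[_ dx] _] := fx.
  have -> : a = a' * (a / a') by field.
  have -> : d = d' * (d / d') by field.
  have gV e : vunit v e -> G e^-1 0 by move=> /(vunitV HF) /vunit_int.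
  rewrite -(dg_dg Hr) ?mulf_neq0 ?invr_neq0 // dx //.
    have -> : a / a' - 1 = (a - a') / a' by field.
    by apply: (vge_mulr HF) => //; apply: gV.
  have -> : d / d' - 1 = (d - d') / d' by field.
  by apply: (vge_mulr HF) => //; apply: gV.
have [|||||x [Wx x0 hx]] := @exists_common_eigenvector C V _ (fun i => rho (dg i.1 i.2)) l W
   _ _ _ _ _ sW nz.
- by move=> i /lu [/vunit_neq0 h1 /vunit_neq0 h2]; apply: (dg_lin Hr).
- by move=> i x /lu []; apply: st.
- move=> i j x /lu [/vunit_neq0 h1 /vunit_neq0 h2] /lu [/vunit_neq0 h3 /vunit_neq0 h4] _.
  by rewrite !(dg_dg Hr) // mulrC [i.2 * _]mulrC.
- by move=> i x /lu [/vunit_neq0 h1 /vunit_neq0 h2] _; apply: (act_inj Hr); apply: dg_GL.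
- move=> i x; rewrite mem_cat => il Wx; have fx := WI _ Wx.
  have it a d m : a != 0 -> d != 0 -> iter m (rho (dg a d)) x = rho (dg (a ^+ m) (d ^+ m)) x.
    move=> a0 d0; elim: m => [|m IH]; first by rewrite !expr0 (dg11 Hr).
    by rewrite iterS IH (dg_dg Hr) ?expf_neq0 // -!exprS.
  have uX e m : vunit v e -> vunit v (e ^+ m).
    by move=> ue; elim: m => [|m IH]; rewrite ?expr0 // exprS; apply: (vunitM HF).
  case/orP: il => /mapP [a /kun ua ->] /=; have [m [n [mn h]]] := vunit_exp_cong HF rk ua;
    exists m, n; split=> //; rewrite !it ?oner_neq0 ?(vunit_neq0 ua) //;
    apply: dgc; rewrite ?expr1n ?subrr //; auto; exact: vge0.
exists x; split=> // a d ua ud; case: (rk) => _ _ cov _.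
have nz_unit a' e : vunit v e -> a' \in 0 :: ks -> G (e - a') 1 -> a' \in ks /\ vunit v a'.
  move=> ue ak h; have ua' : vunit v a' by apply: (vunit_cong HF ue); exact: (vgeBC HF).
  by split=> //; move: ak; rewrite inE (negPf (vunit_neq0 ua')).
have [a' ak ha] := cov _ (vunit_int ua); have [d' dk hd] := cov _ (vunit_int ud).
have [{}ak ua'] := nz_unit _ _ ua ak ha; have [{}dk ud'] := nz_unit _ _ ud dk hd.
have [|c1 h1] := hx (a', 1); first by rewrite mem_cat map_f.
have [|c2 h2] := hx (1, d'); first by rewrite mem_cat orbC map_f.
move: h1 h2 => /= h1 h2; have a0 := vunit_neq0 ua'; have d0 := vunit_neq0 ud'.
rewrite (dgc a d a' d' x (WI _ Wx)) //; exists (c2 * c1).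
have -> : dg a' d' = dg (a' * 1) (1 * d') by rewrite mulr1 mul1r.
have o0 := oner_neq0 F.
by rewrite -(dg_dg Hr) // h2 (linZ (dg_lin Hr a0 o0)) h1 scalerA.
Qed.

Lemma subspaceI (W W' : V -> Prop) : subspace W -> subspace W' -> subspace (fun x => W x /\ W' x).
Proof.
move=> sW sW'; split; first by split; apply: subspace0.
by move=> c x y [h1 h2] [h3 h4]; split; apply: subspaceP.
Qed.

Lemma subspace_pre (g : V -> V) (W : V -> Prop) : is_linear g -> subspace W ->
  subspace (fun x => W (g x)).
Proof.
move=> lg sW; split; first by rewrite (lin0 lg); exact: subspace0.
by move=> c x y h1 h2; rewrite lg; apply: subspaceP.
Qed.

Lemma ufix_dg a d x : vunit v a -> vunit v d -> ufix x -> ufix (rho (dg a d) x).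
Proof.
move=> ua ud ux b gb; have a0 := vunit_neq0 ua; have d0 := vunit_neq0 ud.
rewrite (um_dg Hr) // ux // -mulrA; apply: (vge_mulr HF) => //.
by apply: vunit_int; apply: (vunitM HF) => //; apply: (vunitV HF).
Qed.

Lemma Kst_Top W x : subspace W -> Kst W -> W x -> W (T x).
Proof.
move=> sW st Wx; apply: (subspace_sum sW) => l lk _.
by apply: (st); [apply: KO_um; exact: (ks_int rk lk) | apply: (st) => //; exact: KO_sm].
Qed.

(* The data of a weight sigma: its U-invariants are the line through x, and J is the
   augmentation hyperplane sum (u - 1) sigma, a complement of the line through s x. *)
Definition weight (sigma : V -> Prop) (x : V) (J : V -> Prop) :=
  [/\ [/\ subspace sigma, Kst sigma & forall y, sigma y -> fixK 0 y],
      [/\ sigma x, x <> 0, ufix x & forall y, sigma y -> ufix y -> exists c : C, y = c *: x]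
    & [/\ subspace J, (forall b y, G b 0 -> sigma y -> J (rho (um b) y - y)),
      (forall a d y, vunit v a -> vunit v d -> J y -> J (rho (dg a d) y)),
      (forall y, sigma y -> exists c : C, J (y - c *: rho sm x)) & ~ J (rho sm x)]].

(** * Invariants and coinvariants of U(O) on an irreducible K-subrepresentation *)

Section Irreducible.
Variable sigma : V -> Prop.
Hypotheses (ss : subspace sigma) (st : Kst sigma) (sK : forall y, sigma y -> fixK 0 y)
  (sn : exists2 x, sigma x & x <> 0)
  (sm_min : forall D, subspace D -> Kst D -> (exists2 x, D x & x <> 0) ->
     (forall x, D x -> sigma x) -> forall x, sigma x -> D x).

(** By the two cells of K, every K-translate of x is a multiple of x or of some u s x with u in
    U(O). The intersection of all subspaces containing these is therefore K-stable, and minimality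
    of sigma applies. *)
Lemma irr_gen x : sigma x -> x <> 0 -> ufix x -> Heig x ->
  forall S, subspace S -> S x -> (forall b, G b 0 -> S (rho (um b) (rho sm x))) ->
  forall z, sigma z -> S z.
Proof.
move=> sx x0 ux hx S sS Sx Sb z sz.
pose D z := sigma z /\ forall S : V -> Prop, subspace S -> S x ->
  (forall b, G b 0 -> S (rho (um b) (rho sm x))) -> S z.
suff : D z by case=> _; apply.
have fx := fixI_intro HF (sK sx) ux.
have Dx : D x by split.
move: z sz; apply: sm_min => //; last 2 first.
- by exists x.
- by move=> z [].
- split; first by split; [exact: subspace0 | move=> S' sS' _ _; exact: subspace0].
  move=> c y z [sy hy] [sz hz]; split; first exact: subspaceP.
  by move=> S' sS' h1 h2; apply: subspaceP => //; [apply: hy | apply: hz].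
move=> g z gK [sz hz]; split; first exact: st.
move=> S' sS' Sx' Sb'.
have key h : KO h -> S' (rho h x).
  move=> [a [b [c [d [-> [ga gb gc gd uD]]]]]].
  have D0 := vunit_neq0 uD.
  have [c1|uc] := vunit_dec gc.
    have uad : vunit v (a * d).
      apply: (vunit_cong HF uD); have -> : a * d - (a * d - b * c) = b * c by ring.
      exact: (vge_mull HF).
    have ud : vunit v d.
      have [d1|//] := vunit_dec gd; case: (not_vge1 uad); exact: (vge_mull HF).
    have d0 := vunit_neq0 ud; have gd1 := vunit_int (vunitV HF ud).
    have [_ nx] := fx; rewrite (mx2_bigcell Hr) // nx; last exact: (vge_mulr HF).
    have [e ->] := hx ((a * d - b * c) / d) d (vunitM HF uD (vunitV HF ud)) ud.
    rewrite (linZ (um_lin Hr _)); apply: (subspaceZ sS'); rewrite ux //.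
    exact: (vge_mulr HF).
  have c0 := vunit_neq0 uc; have gc1 := vunit_int (vunitV HF uc).
  have u1 : vunit v (- (a * d - b * c) / c).
    by apply: (vunitM HF); [apply: (vunitN HF) | apply: (vunitV HF)].
  rewrite (mx2_scell Hr) // ux; last exact: (vge_mulr HF).
  rewrite -(sm_dg Hr) //; last exact: vunit_neq0 u1.
  have [e ->] := hx _ _ uc u1.
  rewrite (linZ (sm_lin Hr)) (linZ (um_lin Hr _)); apply: (subspaceZ sS'); apply: Sb'.
  exact: (vge_mulr HF).
have gu := KO_unit gK.
apply: (hz _ (subspace_pre (act_lin Hr gu) sS')); first exact: key.
move=> b gb; rewrite !(actM Hr) ?unitmx_mul ?um_GL ?sm_GL ?gu //.
by apply: key; apply: KO_mul; [apply: KO_mul => //; exact: KO_um | exact: KO_sm].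
Qed.

(** The generator x of [irr_gen] is recovered from the others: x = e^-1 T x if e is nonzero, and by
    [Top0_bigcell] if e = 0. *)
Lemma irr_genU x e : sigma x -> x <> 0 -> ufix x -> Heig x -> T x = e *: x ->
  forall S, subspace S -> (forall b, G b 0 -> S (rho (um b) (rho sm x))) ->
  forall z, sigma z -> S z.
Proof.
move=> sx x0 ux hx Tx S sS Sb; apply: (irr_gen sx x0 ux hx sS _ Sb) => //.
have kun := ks_unit rk; have gV := fun l (lk : l \in ks) => vunit_int (vunitV HF (kun l lk)).
have [e0|e0] := eqVneq e 0.
  rewrite (Top0_bigcell HF Hr rk ux); last by rewrite Tx e0 scale0r.
  apply: (subspaceN sS); apply: (subspace_sum sS) => l lk _.
  have ul := kun l lk; have ul' : vunit v (- l^-1) by apply/(vunitN HF)/(vunitV HF).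
  rewrite -(sm_dg Hr) ?(vunit_neq0 ul) ?(vunit_neq0 ul') //.
  have [c ->] := hx _ _ ul ul'.
  rewrite (linZ (sm_lin Hr)) (linZ (um_lin Hr _)); apply: (subspaceZ sS); apply: Sb.
  exact: gV.
have -> : x = e^-1 *: T x by rewrite Tx scalerA mulVf // scale1r.
apply: (subspaceZ sS); apply: (subspace_sum sS) => l lk _; apply: Sb; exact: (ks_int rk lk).
Qed.

(* Any U-cyclic generator s x makes N = sum u factor through the augmentation. *)
Lemma irr_norm x e : sigma x -> x <> 0 -> ufix x -> Heig x -> T x = e *: x ->
  forall z, sigma z -> exists c : C, \sum_(l <- 0 :: ks) rho (um l) z = c *: T x.
Proof.
move=> sx x0 ux hx Tx; have [_ nx] := fixI_intro HF (sK sx) ux.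
pose N z := \sum_(l <- 0 :: ks) rho (um l) z.
have lN : is_linear N.
  move=> a y z; rewrite /N scaler_sumr -big_split; apply: eq_bigr => l _ /=.
  by rewrite (um_lin Hr).
apply: (irr_genU sx x0 ux hx Tx (S := fun z => exists c, N z = c *: T x)).
  split; first by exists 0; rewrite (lin0 lN) scale0r.
  move=> a y z [c1 h1] [c2 h2]; exists (a * c1 + c2).
  by rewrite lN h1 h2 scalerDl scalerA.
move=> b gb; exists 1; rewrite scale1r /N.
rewrite /Top -(sum_shift HF (H := fun l => rho (um l) (rho sm x)) rk gb); last first.
  by move=> l l' _ _; apply: (um_cong_sm Hr).
by apply: eq_bigr => l _; rewrite (um_um Hr).
Qed.

(** Since s x generates sigma over U(O), the coinvariants are spanned by the class of s x, and they
    are nonzero for a p-group. A second invariant line would contain, after subtracting a multiple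
    of x, a torus eigenvector incompatible with these facts. *)
Lemma irr_weight : exists x J, weight sigma x J.
Proof.
have uW : subspace (fun z => sigma z /\ ufix z) by apply: subspaceI => //; exact: (subspace_ufix v Hr).
have dgst a d z : vunit v a -> vunit v d -> sigma z -> sigma (rho (dg a d) z).
  by move=> ua ud sz; apply: st => //; exact: KO_dg.
have eig W : subspace W -> (forall z, W z -> sigma z /\ ufix z) ->
    (forall a d z, vunit v a -> vunit v d -> W z -> W (rho (dg a d) z)) ->
    (exists2 z, W z & z <> 0) -> exists z, [/\ W z, z <> 0 & Heig z].
  move=> sW Ws; apply: Heig_vector => // z /Ws [sz uz]; apply: (fixI_intro HF) => //; exact: sK.
have dg_un a d : vunit v a -> vunit v d -> dg a d \in unitmx.
  by move=> /vunit_neq0 a0 /vunit_neq0 d0; apply: dg_GL.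
have [x1 [sx1 x10 ux1]] : exists x, [/\ sigma x, x <> 0 & ufix x].
  by apply: ufixed_vector => // b z gb; apply: st; exact: KO_um.
have [x [sx x0 ux hx]] : exists x, [/\ sigma x, x <> 0, ufix x & Heig x].
  have [|||x [[sx ux] x0 hx]] := eig _ uW; last by exists x.
  - by [].
  - by move=> a d z ua ud [sz uz]; split; [exact: dgst | exact: ufix_dg].
  - by exists x1.
have Tst z : sigma z -> ufix z -> sigma (T z) /\ ufix (T z).
  move=> sz uz; split; first exact: Kst_Top.
  by apply: (Top_ufix HF Hr rk); case: (fixI_intro HF (sK sz) uz).
have [{sx x0 ux hx}x [e [sx x0 ux hx Tx]]] :
    exists x e, [/\ sigma x, x <> 0, ufix x, Heig x & T x = e *: x].
  (* If T x is nonzero it replaces x: by [Top_Top] it is an eigenvector of T, and T only swaps the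
     two torus entries. *)
  case: (pselect (T x = 0)) => Tx; first by exists x, 0; split=> //; rewrite Tx scale0r.
  have [sT uT] := Tst x sx ux; have fx := fixI_intro HF (sK sx) ux.
  have [|chi hchi] := @choice F C (fun l c => l \in ks -> rho (dg l (- l^-1)) x = c *: x).
    move=> l; case: (boolP (l \in ks)) => lk; last by exists 0.
    have ul := ks_unit rk lk; have [|c hc] := hx l (- l^-1) ul; last by exists c.
    by apply/(vunitN HF)/(vunitV HF).
  exists (T x), (\sum_(l <- ks) chi l); split=> //; last exact: (Top_Top HF Hr rk pC fx hchi).
  move=> a d ua ud; have [c hc] := hx d a ud ua; exists c.
  by rewrite -(Top_dg HF Hr rk) // hc (linZ (Top_lin Hr ks)).
have gen := irr_genU sx x0 ux hx Tx; have norm := irr_norm sx x0 ux hx Tx.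
have sst z : sigma z -> sigma (rho sm z) by apply: st; exact: KO_sm.
pose J z := sigma z /\ forall S : V -> Prop, subspace S ->
  (forall b y, G b 0 -> sigma y -> S (rho (um b) y - y)) -> S z.
have sJ : subspace J.
  split; first by split; [exact: subspace0 | move=> S sS _; exact: subspace0].
  move=> c y z [sy hy] [sz hz]; split; first exact: subspaceP.
  by move=> S sS h; apply: subspaceP => //; [apply: hy | apply: hz].
have Ju b y : G b 0 -> sigma y -> J (rho (um b) y - y).
  move=> gb sy; split; last by move=> S _; apply.
  by apply: subspaceB => //; apply: st => //; exact: KO_um.
have Jd a d y : vunit v a -> vunit v d -> J y -> J (rho (dg a d) y).
  move=> ua ud [sy hy]; split; first exact: dgst.
  move=> S sS h; have du := dg_un a d ua ud.
  apply: (hy _ (subspace_pre (act_lin Hr du) sS)) => b z gb sz.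
  have a0 := vunit_neq0 ua; have d0 := vunit_neq0 ud.
  rewrite (linB (act_lin Hr du)) (dg_um Hr) //; apply: h; last exact: dgst.
  apply: (vge_mulr HF); last exact: (vunit_int (vunitV HF ud)).
  by apply: (vge_mull HF) => //; exact: vunit_int.
have Jgen y e' : sigma y -> y <> 0 -> ufix y -> Heig y -> T y = e' *: y ->
    J (rho sm y) -> forall z, sigma z -> J z.
  move=> sy y0 uy hy Ty Jy; apply: (irr_genU sy y0 uy hy Ty) => // b gb.
  by rewrite -[rho (um b) _](subrK (rho sm y)); apply: subspaceD => //; apply: Ju => //; exact: sst.
(* Otherwise J would contain the U(O)-translates of s x, hence all of sigma, against the
   nonvanishing of the coinvariants of U(O/p). *)
have Jx : ~ J (rho sm x).
  move=> Jx.
  have [||||||S [sS [z sz nS] hS]] := @pgroup_coinvariants_neq0 C V p 1 F (fun b => rho (um b))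
     (0 :: ks) sigma pC.
  - by move=> b _; apply: (um_lin Hr).
  - by move=> b y bk; apply: st; apply: KO_um; exact: (ks_int rk bk).
  - by move=> b c y _ _ _; rewrite !(um_um Hr) addrC.
  - move=> b y bk sy; have gb := ks_int rk bk; rewrite expn1.
    have -> m : iter m (rho (um b)) y = rho (um (m%:R * b)) y.
      elim: m => [|m IH]; first by rewrite mul0r (um0 Hr).
      by rewrite iterS IH (um_um Hr) -natr1 mulrDl mul1r addrC.
    rewrite -[RHS](um0 Hr); apply: (um_cong_fixK (sK sy)).
      by apply: (vge_mull HF) => //; apply: (vge_natmul HF).
    by rewrite subr0; apply: (vge_mulr HF) => //; apply: (pi_vge HF).
  - by [].
  - by [].
  apply: nS; have [_] := Jgen x e sx x0 ux hx Tx Jx z sz; apply=> // b y gb sy.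
  case: (rk) => _ _ cov _; have [c ck bc] := cov b gb.
  by rewrite (um_cong_fixK (sK sy) gb bc); apply: hS.
have Jc y : sigma y -> exists c : C, J (y - c *: rho sm x).
  move: y; apply: gen.
    split; first by exists 0; rewrite scale0r subrr; exact: subspace0.
    move=> a y z [c1 h1] [c2 h2]; exists (a * c1 + c2).
    have -> : a *: y + z - (a * c1 + c2) *: rho sm x =
      a *: (y - c1 *: rho sm x) + (z - c2 *: rho sm x).
      by rewrite scalerBr scalerDl scalerA opprD addrACA.
    exact: subspaceP.
  by move=> b gb; exists 1; rewrite scale1r; apply: Ju => //; exact: sst.
exists x, J; split=> //; split=> // y sy uy.
have [a ha] : exists a, T y = (a * e) *: x.
  by have [a ha] := norm (rho sm y) (sst y sy); exists a; rewrite -scalerA -Tx -ha.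
(* Case e = 0: if y <> c x there is an invariant torus eigenvector y' with s y' in J. The norm of s
   y' is T y', a multiple of T x = 0, so y' generates like x and J would be all of sigma. *)
have [e0|e0] := eqVneq e 0.
  have [c hc] := Jc (rho sm y) (sst y sy); exists c; apply/eqP; rewrite -subr_eq0; apply/eqP.
  apply: contrapT => y0.
  have [||||y' [[[sy' uy'] Jy'] y'0 hy']] := eig (fun z => (sigma z /\ ufix z) /\ J (rho sm z)).
  - by apply: subspaceI => //; apply: (subspace_pre (sm_lin Hr)).
  - by move=> z [].
  - move=> b d z ub ud [[sz uz] Jz]; split; first by split; [exact: dgst | exact: ufix_dg].
    by rewrite (sm_dg Hr) ?(vunit_neq0 ub) ?(vunit_neq0 ud) //; apply: Jd.
  - exists (y - c *: x) => //; split; last by rewrite (linB (sm_lin Hr)) (linZ (sm_lin Hr)).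
    by apply: (subspaceB uW) => //; apply: (subspaceZ uW).
  apply: Jx; apply: (Jgen y' 0) => //; last exact: sst.
  have [a' ha'] := norm (rho sm y') (sst y' sy').
  have -> : T y' = a' *: T x := ha'.
  by rewrite Tx e0 !scale0r scaler0.
(* Case e <> 0: if y <> a x there is an invariant torus eigenvector y' with T y' = 0. By [irr_norm]
   at y', all norms vanish, in particular the norm T x of s x. *)
exists a; apply/eqP; rewrite -subr_eq0; apply/eqP; apply: contrapT => y0.
have [||||y' [[[sy' uy'] Ty'] y'0 hy']] := eig (fun z => (sigma z /\ ufix z) /\ T z = 0).
- apply: subspaceI => //; split; first exact: (lin0 (Top_lin Hr ks)).
  by move=> c z z' h1 h2; rewrite (Top_lin Hr ks) h1 h2 scaler0 addr0.
- by move=> z [].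
- move=> b d z ub ud [[sz uz] Tz]; split; first by split; [exact: dgst | exact: ufix_dg].
  rewrite (Top_dg HF Hr rk) //; last exact: (fixI_intro HF (sK sz) uz).
  by rewrite Tz (lin0 (act_lin Hr (dg_un _ _ ud ub))).
- exists (y - a *: x) => //; split; first by apply: (subspaceB uW) => //; apply: (subspaceZ uW).
  by rewrite (linB (Top_lin Hr ks)) (linZ (Top_lin Hr ks)) ha Tx scalerA subrr.
have [|b hb] := irr_norm (e := 0) sy' y'0 uy' hy' _ (sst x sx); first by rewrite Ty' scale0r.
have : T x = 0 by have -> : T x = b *: T y' := hb; rewrite Ty' scaler0.
by rewrite Tx => /eqP; rewrite scaler_eq0 (negPf e0) => /eqP.
Qed.

End Irreducible.

Lemma exists_weight (E : V -> Prop) n (e : 'I_n -> V) :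
  subspace E -> Kst E -> (forall y, E y -> fixK 0 y) -> (exists2 x, E x & x <> 0) ->
  (forall y, E y -> exists r : 'I_n -> C, y = \sum_i r i *: e i) ->
  exists sigma x J, weight sigma x J /\ (forall y, sigma y -> E y).
Proof.
move=> sE stE EK nE fE.
have [S [sS stS nS SE min]] := minimal_subspace sE stE nE fE.
have [|x [J wt]] := irr_weight sS stS _ nS min; first by move=> y /SE /EK.
by exists S, x, J.
Qed.

End Weights.

(** * Frobenius reciprocity *)

Section Induction.
Variables (p : nat) (F : fieldType) (v : F -> int).
Hypothesis HF : nonarch_local_field p v.
Local Notation G := (vge v).
Variables (C : closedFieldType) (V : lmodType C) (rho : 'M[F]_2 -> V -> V).
Hypothesis Hr : is_rep rho.

(** Lets the quotient map be given by its graph r, with W the domain of r. By linearity,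
    single-valuedness only has to be checked over the zero function. *)
Lemma subquotient_of_rel (chi : F -> F -> C) (r : ('M[F]_2 -> C) -> V -> Prop) :
  (forall phi x, r phi x -> in_Ind v chi phi) -> r (fun=> 0) 0 ->
  (forall a phi psi x y, r phi x -> r psi y ->
     r (fun g => a * phi g + psi g) (a *: x + y)) ->
  (forall h phi x, inGL2 h -> r phi x -> r (fun g => phi (g *m h)) (rho h x)) ->
  (forall x, r (fun=> 0) x -> x = 0) -> (forall x, exists phi, r phi x) ->
  subquotient_of_Ind v chi rho.
Proof.
move=> rI r0 rP rG rinj rs.
have rfun phi x y : r phi x -> r phi y -> x = y.
  move=> h1 h2; apply/eqP; rewrite -subr_eq0; apply/eqP; apply: rinj.
  have := rP (-1) _ _ _ _ h2 h1; rewrite scaleN1r addrC.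
  by congr (r _ _); apply: funext => g; rewrite mulN1r addNr.
pose q phi := if pselect (exists x, r phi x) is left e then projT1 (cid e) else 0.
have qE phi x : r phi x -> q phi = x.
  move=> h; rewrite /q; case: pselect => [e|[]]; last by exists x.
  by case: (cid e) => y hy /=; apply: rfun hy h.
exists (fun phi => exists x, r phi x), q; split.
- by move=> phi [x /rI].
- split; first by exists 0.
  split; first by move=> a phi psi [x hx] [y hy]; exists (a *: x + y); apply: rP.
  by move=> h phi hu [x hx]; exists (rho h x); apply: rG.
- by move=> a phi psi [x hx] [y hy]; rewrite (qE _ _ (rP a _ _ _ _ hx hy)) (qE _ _ hx) (qE _ _ hy).
- by move=> h phi hu [x hx]; rewrite (qE _ _ (rG h _ _ hu hx)) (qE _ _ hx).
- by move=> x; have [phi h] := rs x; exists phi; split; [exists x | exact: qE].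
Qed.

(* Frobenius reciprocity: a P-eigenfunctional L embeds rho through x |-> (g |-> L (g x)). *)
Lemma subquotient_of_functional (L : V -> C) : smooth_rep v rho -> irreducible_rep rho ->
  (forall a x y, L (a *: x + y) = a * L x + L y) -> (exists x, L x != 0) ->
  (forall b x, L (rho (um b) x) = L x) ->
  (forall a d, a != 0 -> d != 0 -> exists c, forall x, L (rho (dg a d) x) = c * L x) ->
  exists chi, smooth_char_T v chi /\ subquotient_of_Ind v chi rho.
Proof.
move=> [_ sm] [_ irr] lL [x0 Lx0] Lu Ld.
pose chi a d := L (rho (dg a d) x0) / L x0.
have chiE a d x : a != 0 -> d != 0 -> L (rho (dg a d) x) = chi a d * L x.
  by move=> a0 d0; have [c hc] := Ld a d a0 d0; rewrite /chi !hc mulfK.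
have chi11 : chi 1 1 = 1 by rewrite /chi (dg11 Hr) divff.
have chiM a a' d d' : a != 0 -> a' != 0 -> d != 0 -> d' != 0 ->
    chi (a * a') (d * d') = chi a d * chi a' d'.
  move=> a0 a'0 d0 d'0; rewrite {1}/chi -(dg_dg Hr) // chiE //.
  by rewrite chiE // mulrA mulfK.
have LP b x : inP b -> L (rho b x) = chi (b 0 0) (b 1 1) * L x.
  move=> /inPE [z [a [d [a0 d0 -> -> ->]]]].
  by rewrite -(actM Hr) ?um_GL ?dg_GL // Lu chiE.
have L0 : L 0 = 0.
  have h := lL 1 0 0; rewrite scale1r addr0 mul1r in h.
  by apply: (addrI (L 0)); rewrite addr0 -h.
exists chi; split.
  split=> //; last first.
  - have [n hn] := sm x0; exists n => a d ha hd.
    rewrite /chi hn ?divff //; apply: (inK_mx2 HF) => //; exact: vge0.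
  - move=> a d a0 d0; apply/eqP => h.
    have := chiM a a^-1 d d^-1 a0 (invr_neq0 a0) d0 (invr_neq0 d0).
    by rewrite !divff // chi11 h mul0r => /eqP; rewrite oner_eq0.
pose r (phi : 'M[F]_2 -> C) x := phi = fun g => if g \in unitmx then L (rho g x) else 0.
apply: (@subquotient_of_rel chi r).
- move=> phi x ->; split.
  + by move=> g /negP/negPf ->.
  + move=> b g bP gu; have [bu _] := bP; rewrite unitmx_mul bu (gu : g \in unitmx) /=.
    by rewrite -(actM Hr) // LP.
  + have [n hn] := sm x; exists n => g k gu kK; have [ku _] := kK.
    by rewrite unitmx_mul ku (gu : g \in unitmx) -(actM Hr) // hn.
- apply: funext => g; case: ifP => // gu.
  by rewrite (lin0 (act_lin Hr gu)) L0.
- move=> a phi psi x y -> ->; apply: funext => g; case: ifP => gu; last by rewrite mulr0 addr0.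
  by rewrite (act_lin Hr gu) lL.
- move=> h phi x hu ->; apply: funext => g; rewrite unitmx_mul (hu : h \in unitmx) andbT.
  by case: ifP => // gu; rewrite -(actM Hr).
- move=> x; rewrite /r => e; have h g : g \in unitmx -> L (rho g x) = 0.
    by move=> gu; have := congr1 (fun f => f g) e; rewrite gu.
  (* The kernel is the largest G-stable subspace on which L vanishes; L is nonzero, so
     irreducibility makes it trivial. *)
  have [||| //|k] := irr (fun x => forall g, g \in unitmx -> L (rho g x) = 0); last first.
  + by move: Lx0; rewrite -[x0](act1 Hr) k ?unitmx1 ?eqxx.
  + by move=> h0; apply: h0.
  + by move=> g y gu hy g' gu'; rewrite (actM Hr) // hy ?unitmx_mul ?gu'.
  + by move=> a y z hy hz g gu; rewrite (act_lin Hr gu) lL hy // hz // mulr0 addr0.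
  + by move=> g gu; rewrite (lin0 (act_lin Hr gu)).
- by move=> x; eexists.
Qed.
End Induction.

(** * Relations between P-translates of a weight *)

Section FormalRelations.
Variables (p : nat) (F : fieldType) (v : F -> int).
Hypothesis HF : nonarch_local_field p v.
Local Notation G := (vge v).
Variables (C : closedFieldType) (V : lmodType C) (rho : 'M[F]_2 -> V -> V).
Hypothesis Hr : is_rep rho.
Variables (w : F) (ks : seq F).
Hypotheses (w0 : w != 0) (vw : v w = 1) (rk : isreps v 1 (0 :: ks)) (pC : p \in [pchar C]).

Local Notation ufix := (ufix v rho).
Local Notation S := (Sop rho w ks).
Local Notation tm := (tm w).
Local Notation reps := (reps ks w).

(** The K-factor only has to have a bottom row proportional to that of g: s u(d/c) if d/c is
    integral, the lower unipotent of c/d otherwise. *)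
Lemma iwasawa (g : 'M[F]_2) : g \in unitmx ->
  exists b k, [/\ inP b, KO v k & g = b *m k].
Proof.
rewrite [g]mx2_eta; move: (g 0 0) (g 0 1) (g 1 0) (g 1 1) => a b c d.
rewrite mx2_unit => D0.
have [c0|c0] := eqVneq c 0.
  exists (mx2 a b c d), 1%:M; rewrite mulmx1; split=> //.
    have [a0 d0] : a != 0 /\ d != 0.
      by apply/andP; move: D0; rewrite c0 mulr0 subr0 mulf_eq0 negb_or.
    by rewrite c0; apply: inP_mx2.
  by rewrite -mx2_scalar; apply: (KO_dg HF); exact: (vunit1 HF).
have o1 := oner_neq0 F.
have [h|[d0 h]] := vge_div HF d c0.
  exists (um (a / c) *m dg (- (a * d - b * c) / c) c), (sm *m um (d / c)); split.
  - by rewrite mx2_mul !(mul0r, mulr0, addr0, add0r, mul1r); apply: inP_mx2 => //;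
      rewrite mulf_neq0 ?invr_neq0 // oppr_eq0.
  - by apply: (KO_mul HF); [exact: (KO_sm HF) | exact: (KO_um HF)].
  - by rewrite !mx2_mul; congr mx2; field.
exists (um (b / d) *m dg ((a * d - b * c) / d) d), (nm (c / d)); split.
- by rewrite mx2_mul !(mul0r, mulr0, addr0, add0r, mul1r); apply: inP_mx2 => //;
    rewrite mulf_neq0 ?invr_neq0.
- do 4!eexists; split; first by [].
  split; try exact: (vge1 HF); try exact: vge0; first exact: vgeW h.
  by rewrite mul0r subr0 mulr1; exact: (vunit1 HF).
- by rewrite !mx2_mul; congr mx2; field.
Qed.

(** From t u(a) = u(w a) t: each application of S adds a new lowest digit. *)
Lemma iter_Sop n x : iter n S x = \sum_(a <- reps n) rho (um a) (rho (tm n) x).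
Proof.
elim: n => [|n IH]; first by rewrite big_seq1 (um0 Hr) (tm0 Hr).
rewrite iterS IH {1}/Sop -[reps n.+1]/[seq a + w * y | a <- 0 :: ks, y <- reps n].
rewrite [RHS]big_allpairs_dep; apply: eq_bigr => l _.
rewrite (lin_sum (tm_lin Hr w0 1)) (lin_sum (um_lin Hr l)); apply: eq_bigr => a _.
by rewrite (tm_um Hr w0) (tm_tm Hr w0) (um_um Hr) expr1z -PoszD add1n.
Qed.

Section ClassSum.
Variables (U : nmodType) (I : eqType) (m_ : I -> nat) (b_ : I -> F) (H : I -> U) (M : nat).
Definition cls (m : nat) (a : F) i := (m_ i == m) && vgeb v (b_ i - a) m.

(** Regroups terms attached to u(b) t^m by the vertex (m, b mod p^m) of the tree on which they
    sit. *)
Lemma class_sum (l : seq I) : (forall i, i \in l -> (m_ i < M)%N /\ G (b_ i) 0) ->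
  \sum_(m < M) \sum_(a <- reps m) \sum_(i <- l | cls m a i) H i = \sum_(i <- l) H i.
Proof.
move=> hl; under eq_bigr => m _ do rewrite (exchange_big_dep predT) //=.
rewrite (exchange_big_dep predT) //=; apply: eq_big_seq => i /hl [mi gb].
have [ur ir cr jr] := isreps_reps HF rk w0 vw (m_ i).
have [a ar ha] := cr _ gb.
rewrite (bigD1 (Ordinal mi)) //= [X in _ + X]big1 ?addr0; last first.
  move=> m; rewrite -val_eqE /= => mn; rewrite big1_seq // => a'.
  by rewrite /cls eq_sym (negPf mn).
rewrite big_mkcond (bigD1_seq a) //= [X in _ + X]big1_seq ?addr0.
  by rewrite /cls eqxx /=; case: vgeP.
move=> a' /andP[ne a'r]; rewrite /cls eqxx /=; case: vgeP => // ha'.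
move: ne; rewrite (jr a' a) ?eqxx //.
by apply: (vge_trans HF) ha; apply: (vgeBC HF).
Qed.
End ClassSum.

Section Weight.
Variables (sigma : V -> Prop) (x : V) (J : V -> Prop).
Hypothesis wt : weight v rho sigma x J.

Let ss : subspace sigma. Proof. by case: wt => [[]]. Qed.
Let sst : Kst v rho sigma. Proof. by case: wt => [[]]. Qed.
Let sK : forall y, sigma y -> fixK v rho 0 y. Proof. by case: wt => [[]]. Qed.
Let sx : sigma x. Proof. by case: wt => [_ []]. Qed.
Let x0 : x <> 0. Proof. by case: wt => [_ []]. Qed.
Let ux : ufix x. Proof. by case: wt => [_ []]. Qed.
Let sU : forall y, sigma y -> ufix y -> exists c : C, y = c *: x.
Proof. by case: wt => [_ []]. Qed.

Lemma weight_Heig : Heig v rho x.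
Proof.
by move=> a d ua ud; apply: sU; [apply: sst => //; exact: (KO_dg HF) | exact: (ufix_dg HF Hr)].
Qed.

(** A formal relation between translates of sigma: one vector of u(a) t^m sigma for each vertex (m,
    a mod p^m), m < M, with total sum 0. Keeping a function of all a in O, rather than of chosen
    representatives, lets U(O) act by [famact] without choices. *)
Definition vfamily (M : nat) (Phi : nat * F -> V) :=
  [/\ [/\ (forall (m : nat) a, G a 0 -> exists2 y, sigma y & Phi (m, a) = rho (um a) (rho (tm m) y)),
      (forall (m : nat) a a', G a 0 -> G a' 0 -> G (a - a') m -> Phi (m, a) = Phi (m, a')),
      (forall m a, ~ G a 0 -> Phi (m, a) = 0) &
      (forall m a, (M <= m)%N -> Phi (m, a) = 0)]
    & \sum_(m < M) \sum_(a <- reps m) Phi (m : nat, a) = 0].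

Definition famact (b : F) (Phi : nat * F -> V) : nat * F -> V :=
  fun ma => rho (um b) (Phi (ma.1, ma.2 - b)).

Lemma subspace_family M : subspace (vfamily M).
Proof.
split.
  split; last by rewrite big1 // => m _; rewrite big1.
  split=> // m a ga; exists 0; first exact: subspace0.
  by rewrite (lin0 (tm_lin Hr w0 m)) (lin0 (um_lin Hr a)).
move=> c Phi Psi [[h1 h2 h3 h4] h5] [[k1 k2 k3 k4] k5].
have E ma : (c *: Phi + Psi) ma = c *: Phi ma + Psi ma by [].
split; last first.
  transitivity (c *: (\sum_(m < M) \sum_(a <- reps m) Phi (m : nat, a)) +
    \sum_(m < M) \sum_(a <- reps m) Psi (m : nat, a)).
    rewrite scaler_sumr -big_split /=; apply: eq_bigr => m _.
    by rewrite scaler_sumr -big_split.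
  by rewrite h5 k5 scaler0 addr0.
split.
- move=> m a ga; have [y sy ey] := h1 m a ga; have [z sz ez] := k1 m a ga.
  exists (c *: y + z); first exact: subspaceP.
  by rewrite E ey ez (tm_lin Hr w0) (um_lin Hr).
- by move=> m a a' ga ga' h; rewrite !E (h2 m a a') ?(k2 m a a').
- by move=> m a na; rewrite E h3 // k3 // scaler0 addr0.
- by move=> m a na; rewrite E h4 // k4 // scaler0 addr0.
Qed.

Lemma famact_family M b Phi : G b 0 -> vfamily M Phi -> vfamily M (famact b Phi).
Proof.
move=> gb [[h1 h2 h3 h4] h5]; split; last first.
  rewrite -[RHS](lin0 (um_lin Hr b)) -[in RHS]h5 (lin_sum (um_lin Hr b)).
  apply: eq_bigr => m _; rewrite (lin_sum (um_lin Hr b)).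
  rewrite -(sum_shift HF (H := fun a => rho (um b) (Phi (m : nat, a)))
    (isreps_reps HF rk w0 vw m) (vgeN HF gb)) // => a a' ga ga' h.
  by rewrite (h2 _ a a').
split.
- move=> m a ga; have [y sy ey] := h1 m (a - b) (vgeB HF ga gb).
  by exists y => //; rewrite /famact ey (um_um Hr) addrC subrK.
- move=> m a a' ga ga' h; rewrite /famact /= (h2 m (a - b) (a' - b)) //; try exact: (vgeB HF).
  by have -> : a - b - (a' - b) = a - a' by ring.
- move=> m a na; rewrite /famact /= h3 ?(lin0 (um_lin Hr b)) // => h; apply: na.
  by rewrite -[a](subrK b); apply: (vgeD HF).
- by move=> m a na; rewrite /famact /= h4 ?(lin0 (um_lin Hr b)).
Qed.

(** For m < M, conjugation by t^-m carries u(p^M) into K_1, which fixes sigma pointwise. So U(O)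
    acts on families through O/p^M, a p-group of exponent dividing p^M. *)
Lemma famact_cong (M : nat) b b' Phi : G b 0 -> G b' 0 -> G (b - b') M -> vfamily M Phi ->
  famact b Phi = famact b' Phi.
Proof.
move=> gb gb' h [[h1 h2 h3 h4] _]; apply: funext => -[m a]; rewrite /famact /=.
case: (leqP M m) => Mm; first by rewrite !h4 // !(lin0 (um_lin Hr _)).
case: (pselect (G a 0)) => ga; last first.
  rewrite !h3 ?(lin0 (um_lin Hr _)) // => h'; apply: ga.
    by rewrite -[a](subrK b'); apply: (vgeD HF).
  by rewrite -[a](subrK b); apply: (vgeD HF).
have gab' := vgeB HF ga gb'.
rewrite (h2 m (a - b) (a - b')) //; [|exact: (vgeB HF)|]; last first.
  have -> : a - b - (a - b') = - (b - b') by ring.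
  by apply: (vgeN HF); apply: vgeW h; lia.
have [y sy ->] := h1 m _ gab'.
have -> : b = b' + (b - b') by ring.
rewrite -(um_um Hr); congr (rho _ _).
rewrite (um_um Hr) [b - b' + _]addrC -(um_um Hr (a - b') (b - b')); congr (rho _ _).
rewrite (um_tm Hr w0); congr (rho _ _); apply: (sK sy).
have g1 : G (w ^ (- m%:Z) * (b - b')) 1.
  by apply: vgeW (vge_wzM HF w0 vw (- m%:Z) h); lia.
by apply: (inK_mx2 HF); rewrite ?subrr //; exact: vge0.
Qed.

(* The U(O)-invariants of an induced representation of functions O/p^m -> t^m sigma
   are the sums over O/p^m of a vector of t^m sigma^U. *)
Lemma family_relation M Phi : vfamily M Phi -> Phi <> 0 ->
  exists P : {poly C}, P != 0 /\ pact S P x = 0.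
Proof.
move=> fP nP.
have rint := reps_int HF rk w0 vw.
have [||||||{fP nP}Phi' [fP nP hP]] := @pgroup_fixed_vector C (nat * F -> V) p M F famact (reps M)
    (vfamily M) pC.
- by move=> b _ c f g; apply: funext => ma; exact: (um_lin Hr).
- by move=> b f /rint gb; apply: famact_family.
- move=> b b' f _ _ _; apply: funext => -[m a]; rewrite /famact /= !(um_um Hr) [b' + b]addrC.
  by congr (rho _ (f (_, _))); ring.
- move=> b f /rint gb ff.
  have it k : iter k (famact b) f = famact (k%:R * b) f.
    elim: k => [|k IH].
      by apply: funext => -[m a]; rewrite /famact mul0r /= (um0 Hr) subr0.
    apply: funext => -[m a]; rewrite iterS IH /famact /= (um_um Hr) -natr1 mulrDl mul1r [b + _]addrC.
    by congr (rho _ (f (_, _))); ring.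
  rewrite it (@famact_cong M _ 0 f) //.
  + by apply: funext => -[m a]; rewrite /famact /= (um0 Hr) subr0.
  + by apply: (vge_mull HF) => //; exact: (vge_natmul HF).
  + exact: vge0.
  + by rewrite subr0; apply: (vge_mulr HF) => //; exact: (pX_vge HF).
- exact: subspace_family.
- by exists Phi.
have fix_ b : G b 0 -> famact b Phi' = Phi'.
  move=> gb; have [_ _ cr _] := isreps_reps HF rk w0 vw M; have [b' br h] := cr _ gb.
  by rewrite (famact_cong gb (rint _ _ br) h fP) hP.
have [[h1 h2 h3 h4] h5] := fP.
have PhiE (m : nat) a : G a 0 -> Phi' (m, a) = rho (um a) (Phi' (m, 0)).
  by move=> ga; rewrite -{1}(fix_ a ga) /famact /= subrr.
(* u(p^m) preserves the vertex (m, 0). Writing the vector there as t^m y, invariance makes y fixed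
   by U(O), hence a multiple of x. *)
have [|c hc] := @choice nat C (fun m c => Phi' (m, 0) = c *: rho (tm m) x).
  move=> m; have [y sy ey] := h1 m 0 (vge0 v 0); rewrite (um0 Hr) in ey.
  have [|c yc] := sU sy; last by exists c; rewrite ey yc (linZ (tm_lin Hr w0 m)).
  move=> z gz; have gz' : G (w ^ m%:Z * z) m.
    by have := vge_wzM HF w0 vw m gz; rewrite addr0.
  have g0 : G (w ^ m%:Z * z) 0 by apply: vgeW gz'.
  have := congr1 (fun f => f (m, 0)) (fix_ _ g0); rewrite /famact /= sub0r.
  rewrite (h2 m (- (w ^ m%:Z * z)) 0) ?subr0; [|exact: (vgeN HF)|exact: vge0|exact: (vgeN HF)].
  rewrite ey -(tm_um Hr w0) => e; apply/eqP; rewrite -subr_eq0; apply/eqP.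
  by apply: (act_inj Hr (tm_GL w0 m)); rewrite (linB (tm_lin Hr w0 m)) e subrr.
pose P : {poly C} := \poly_(m < M) c m.
exists P; split; last first.
  rewrite (pact_wide _ _ (size_poly _ _)) -[RHS]h5; apply: eq_bigr => m _.
  rewrite coef_poly ltn_ord iter_Sop scaler_sumr; apply: eq_big_seq => a /rint ga.
  by rewrite PhiE // hc (linZ (um_lin Hr a)).
apply/eqP => P0; apply: nP; apply: funext => -[m a].
case: (leqP M m) => Mm; first by rewrite h4.
case: (pselect (G a 0)) => ga; last by rewrite h3.
rewrite PhiE // hc; have -> : c m = P`_m by rewrite coef_poly Mm.
by rewrite P0 coef0 scale0r (lin0 (um_lin Hr a)).
Qed.

End Weight.
End FormalRelations.

(** * A weight whose vector satisfies no polynomial relation under S *)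

Section UniversalCase.
Variables (p : nat) (F : fieldType) (v : F -> int).
Hypothesis HF : nonarch_local_field p v.
Local Notation G := (vge v).
Variables (C : closedFieldType) (V : lmodType C) (rho : 'M[F]_2 -> V -> V).
Hypothesis Hs : smooth_rep v rho.
Let Hr : is_rep rho. Proof. by case: Hs. Qed.
Hypotheses (irr : irreducible_rep rho) (cc : has_central_character rho).
Variables (w : F) (ks : seq F).
Hypotheses (w0 : w != 0) (vw : v w = 1) (rk : isreps v 1 (0 :: ks)) (pC : p \in [pchar C]).

Local Notation ufix := (ufix v rho).
Local Notation S := (Sop rho w ks).
Local Notation tm := (tm w).
Local Notation reps := (reps ks w).

Variables (sigma : V -> Prop) (x : V) (J : V -> Prop).
Hypothesis wt : weight v rho sigma x J.

Let ss : subspace sigma. Proof. by case: wt => [[]]. Qed.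
Let sst : Kst v rho sigma. Proof. by case: wt => [[]]. Qed.
Let sx : sigma x. Proof. by case: wt => [_ []]. Qed.
Let x0 : x <> 0. Proof. by case: wt => [_ []]. Qed.
Let sJ : subspace J. Proof. by case: wt => [_ _ []]. Qed.
Let Ju b y : G b 0 -> sigma y -> J (rho (um b) y - y).
Proof. by case: wt => [_ _ [_ h _ _ _]]; apply: h. Qed.
Let Jd a d y : vunit v a -> vunit v d -> J y -> J (rho (dg a d) y).
Proof. by case: wt => [_ _ [_ _ h _ _]]; apply: h. Qed.
Let Jx : ~ J (rho sm x). Proof. by case: wt => [_ _ []]. Qed.

(** l reads off the coordinate of s x in sigma modulo J. It comes from a choice on V and is
    controlled on sigma only. *)
Lemma weight_functional : exists l : V -> C,
  [/\ (forall c y z, sigma y -> sigma z -> l (c *: y + z) = c * l y + l z),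
      (forall b y, G b 0 -> sigma y -> l (rho (um b) y) = l y),
      (forall a d, vunit v a -> vunit v d -> exists c,
         forall y, sigma y -> l (rho (dg a d) y) = c * l y)
    & l (rho sm x) = 1].
Proof.
have [|l hl] := @choice V C (fun y c => sigma y -> J (y - c *: rho sm x)).
  move=> y; case: (pselect (sigma y)) => [sy|]; last by exists 0.
  by case: wt => [_ _ [_ _ _ /(_ y sy) [c hc] _]]; exists c.
have uniq y c : sigma y -> J (y - c *: rho sm x) -> l y = c.
  move=> sy h; apply/eqP; rewrite -subr_eq0; apply/eqP; apply: contrapT => /eqP n0.
  apply: Jx; have -> : rho sm x = (l y - c)^-1 *: ((y - c *: rho sm x) - (y - l y *: rho sm x)).
    have -> : y - c *: rho sm x - (y - l y *: rho sm x) = (l y - c) *: rho sm x.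
      by rewrite opprB addrC addrA subrK scalerBl.
    by rewrite scalerA mulVf // scale1r.
  by apply: (subspaceZ sJ); apply: (subspaceB sJ) => //; apply: hl.
have dg_un a d : vunit v a -> vunit v d -> dg a d \in unitmx.
  by move=> /vunit_neq0 a0 /vunit_neq0 d0; apply: dg_GL.
exists l; split.
- move=> c y z sy sz; apply: uniq; first exact: subspaceP.
  have -> : c *: y + z - (c * l y + l z) *: rho sm x =
    c *: (y - l y *: rho sm x) + (z - l z *: rho sm x).
    by rewrite scalerBr scalerDl scalerA opprD addrACA.
  by apply: (subspaceP sJ); apply: hl.
- move=> b y gb sy; apply: uniq; first by apply: sst => //; exact: (KO_um HF).
  rewrite -[rho (um b) y](subrK y) -addrA; apply: (subspaceD sJ); [exact: Ju | exact: hl].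
- move=> a d ua ud; have [c hc] := weight_Heig HF Hr wt ud ua; exists c => y sy.
  apply: uniq; first by apply: sst => //; exact: (KO_dg HF).
  have := Jd ua ud (hl y sy); rewrite (linB (act_lin Hr (dg_un _ _ ua ud))).
  rewrite (linZ (act_lin Hr (dg_un _ _ ua ud))).
  by rewrite -(sm_dg Hr) ?(vunit_neq0 ua) ?(vunit_neq0 ud) // hc (linZ (sm_lin Hr)) scalerA mulrC.
- apply: uniq; first by apply: sst => //; exact: (KO_sm HF).
  by rewrite scale1r subrr; exact: subspace0.
Qed.

Let I : eqType := (int * F * V)%type.
Definition tot (l : seq I) := \sum_(i <- l) rho (um i.1.2) (rho (tm i.1.1) i.2).

(** diag(a, d) = d t^k diag(e, 1) with k the valuation of a/d; the scalar d acts through the central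
    character. *)
Lemma dg_tm_decomp a d : a != 0 -> d != 0 -> exists k e c, vunit v e /\
  forall y, rho (dg a d) y = rho (tm k) (c *: rho (dg e 1) y).
Proof.
move=> a0 d0; have [om hom] := cc; have ad0 : a / d != 0 by rewrite mulf_neq0 ?invr_neq0.
have wk0 := wX_neq0 w0 (v (a / d)).
set e := a / d / w ^ v (a / d); have e0 : e != 0 by rewrite mulf_neq0 ?invr_neq0.
exists (v (a / d)), e, (om d); split.
  by split=> //; rewrite (vM HF) ?invr_neq0 // (vV HF) // (vXz HF) // vw mul1r subrr.
move=> y; have o0 := oner_neq0 F.
rewrite -hom // -mx2_scalar (dg_dg Hr _ d0 d0 e0 o0).
rewrite (dg_dg Hr _ wk0 o0 (mulf_neq0 d0 e0) (mulf_neq0 d0 o0)).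
by congr (rho (dg _ _) y); rewrite ?mulr1 ?mul1r // /e; field; rewrite ?d0 ?wk0.
Qed.

(** By the Iwasawa decomposition and [dg_tm_decomp], every G-translate of sigma is some u(b) t^k
    sigma; irreducibility makes their span everything. *)
Lemma span_vertices z : exists2 l : seq I, (forall i, i \in l -> sigma i.2) & z = tot l.
Proof.
pose D z := exists2 l : seq I, (forall i, i \in l -> sigma i.2) & z = tot l.
have D0 : D 0 by exists [::] => //; rewrite /tot big_nil.
have DP c y y' : D y -> D y' -> D (c *: y + y').
  move=> [l sl ->] [l' sl' ->].
  exists ([seq (i.1, c *: i.2) | i <- l] ++ l').
    by move=> i; rewrite mem_cat => /orP[/mapP [j /sl sj ->] /=|/sl' //]; apply: subspaceZ.
  rewrite /tot big_cat big_map scaler_sumr /=; congr (_ + _); apply: eq_bigr => i _.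
  by rewrite (linZ (tm_lin Hr w0 _)) (linZ (um_lin Hr _)).
have sD : subspace D by [].
have Dg g y : g \in unitmx -> sigma y -> D (rho g y).
  move=> gu sy; have [b [k [bP kK ->]]] := iwasawa HF gu.
  have [b' [a [d [a0 d0 _ _ ->]]]] := inPE bP.
  have ku := KO_unit kK.
  rewrite -(actM Hr) ?unitmx_mul ?um_GL ?dg_GL // -(actM Hr) ?um_GL ?dg_GL //.
  have [m [e [c [ue ->]]]] := dg_tm_decomp a0 d0.
  exists [:: (m, b', c *: rho (dg e 1) (rho k y))]; last by rewrite /tot big_seq1.
  move=> i; rewrite inE => /eqP-> /=; apply: (subspaceZ ss); apply: sst; last exact: sst.
  by apply: (KO_dg HF) => //; exact: (vunit1 HF).
have [_ irr'] := irr; have [| | |h|h] := irr' D => //.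
- move=> g y gu [l sl ->]; rewrite /tot (lin_sum (act_lin Hr gu)).
  apply: (subspace_sum sD) => i /sl si _.
  by rewrite !(actM Hr) ?unitmx_mul ?um_GL ?tm_GL ?gu //; apply: Dg => //;
     rewrite !unitmx_mul ?um_GL ?tm_GL ?gu.
- by case: x0; apply: h; rewrite -[x](act1 Hr); apply: Dg; rewrite ?unitmx1.
- exact: h.
Qed.

Section NoRelation.
Hypothesis norel : forall P : {poly C}, P != 0 -> pact S P x <> 0.

Variable l : V -> C.
Hypotheses (lP : forall c y z, sigma y -> sigma z -> l (c *: y + z) = c * l y + l z)
  (lu : forall b y, G b 0 -> sigma y -> l (rho (um b) y) = l y).

Let l0 : l 0 = 0.
Proof.
have h := @lP 1 0 0 (subspace0 ss) (subspace0 ss); rewrite scale1r addr0 mul1r in h.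
by apply: (addrI (l 0)); rewrite addr0 -h.
Qed.
Let lsum (A : eqType) (r : seq A) (Q : pred A) (f : A -> V) :
  (forall i, i \in r -> Q i -> sigma (f i)) ->
  l (\sum_(i <- r | Q i) f i) = \sum_(i <- r | Q i) l (f i).
Proof.
elim: r => [|i r IH] h; first by rewrite !big_nil.
have h' j : j \in r -> Q j -> sigma (f j) by move=> jr; apply: h; rewrite inE jr orbT.
rewrite !big_cons; case: ifP => Qi; last exact: IH.
rewrite -[f i]scale1r lP ?mul1r ?scale1r ?IH //; first by apply: h => //; rewrite mem_head.
exact: subspace_sum.
Qed.

(** Collected by vertices, the relation becomes a [vfamily], which vanishes in the absence of
    polynomial relations. So the vectors at each vertex sum to 0, and l, being U(O)-invariant, sees
    only these sums. *)
Lemma tot0_functional_nat (r : seq (nat * F * V)) :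
  (forall i, i \in r -> G i.1.2 0 /\ sigma i.2) ->
  \sum_(i <- r) rho (um i.1.2) (rho (tm i.1.1) i.2) = 0 -> \sum_(i <- r) l i.2 = 0.
Proof.
move=> hr r0.
pose M := (\max_(i <- r) i.1.1).+1.
have rM i : i \in r -> (i.1.1 < M)%N.
  by move=> ir; rewrite ltnS /M (leq_bigmax_seq (F := fun i : nat * F * V => i.1.1)).
pose m_ (i : nat * F * V) := i.1.1; pose b_ (i : nat * F * V) := i.1.2.
have rok i : i \in r -> (m_ i < M)%N /\ G (b_ i) 0.
  by move=> ir; split; [exact: rM | case: (hr i ir)].
(* u(b) t^m y = u(a) t^m u(w^-m (b - a)) y moves all terms of one vertex to the common base point a
   by an element of U(O). *)
pose Y (m : nat) a := \sum_(i <- r | cls v m_ b_ m a i) rho (um (w ^ (- m%:Z) * (b_ i - a))) i.2.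
pose Phi (ma : nat * F) := if vgeb v ma.2 0 then rho (um ma.2) (rho (tm ma.1) (Y ma.1 ma.2)) else 0.
have gz m a i : cls v m_ b_ m a i -> G (w ^ (- m%:Z) * (b_ i - a)) 0.
  by move=> /andP[_ /vgeP h]; have := vge_wzM HF w0 vw (- m%:Z) h; rewrite addNr.
have PhiE m a : G a 0 -> Phi (m, a) =
    \sum_(i <- r | cls v m_ b_ m a i) rho (um i.1.2) (rho (tm i.1.1) i.2).
  move=> ga; rewrite /Phi /=; case: vgeP => // _; rewrite /Y (lin_sum (tm_lin Hr w0 m)) (lin_sum (um_lin Hr a)).
  apply: eq_bigr => i /andP[/eqP mi _].
  rewrite (tm_um Hr w0) (um_um Hr) mulrA -expfzDr // subrr expr0z mul1r addrC subrK.
  by rewrite -mi.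
have sY m a : sigma (Y m a).
  apply: (subspace_sum ss) => i ir /gz h; apply: sst; last by case: (hr i ir).
  exact: (KO_um HF).
have fP : vfamily v rho w ks sigma M Phi.
  split; last first.
    rewrite -[RHS]r0 -(class_sum HF w0 vw rk _ rok); apply: eq_bigr => m _.
    by apply: eq_big_seq => a /(reps_int HF rk w0 vw) ga; rewrite PhiE.
  split.
  - move=> m a ga; exists (Y m a) => //; rewrite /Phi /=; by case: vgeP.
  - move=> m a a' ga ga' h; rewrite !PhiE //; apply: eq_bigl => i; rewrite /cls.
    congr andb; apply/vgeP/vgeP => h'; first exact: (vge_trans HF) h' h.
    by apply: (vge_trans HF) h' _; exact: (vgeBC HF).
  - by move=> m a na; rewrite /Phi /=; case: vgeP.
  - move=> m a Mm; case: (pselect (G a 0)) => ga; last by rewrite /Phi /=; case: vgeP.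
    rewrite PhiE // big1_seq // => i /andP[/andP[/eqP mi _] /rok [lt _]].
    by move: lt; rewrite mi ltnNge Mm.
have Phi0 : Phi = 0.
  apply: contrapT => n0; have [P [P0 hP]] := family_relation HF Hr w0 vw rk pC wt fP n0.
  exact: norel hP.
rewrite -(class_sum HF w0 vw rk (fun i => l i.2) rok); apply: big1 => m _.
apply: big1_seq => a /= /(reps_int HF rk w0 vw) ga.
have Y0 : Y m a = 0.
  have := congr1 (fun f => f (m : nat, a)) Phi0; rewrite /Phi /=; case: vgeP => // _ e.
  exact: (act_inj Hr (tm_GL w0 m) (act_inj Hr (um_GL a) e)).
transitivity (l (Y m a)); last by rewrite Y0.
rewrite /Y lsum; last by move=> i ir /gz h; apply: sst; [exact: (KO_um HF) | case: (hr i ir)].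
rewrite big_seq_cond [RHS]big_seq_cond; apply: eq_bigr => i /andP[ir /gz h].
by rewrite lu //; case: (hr i ir).
Qed.

Lemma tot0_functional (r : seq I) : (forall i, i \in r -> sigma i.2) -> tot r = 0 ->
  \sum_(i <- r) l i.2 = 0.
Proof.
move=> hr r0.
(* Translating the relation by t^N makes all its exponents and unipotents integral and leaves the
   vectors of sigma unchanged. *)
have [N hN] : exists N : nat, forall i, i \in r -> 0 <= N%:Z + i.1.1 /\ G (w ^ N%:Z * i.1.2) 0.
  elim: r {hr r0} => [|i r [N hN]]; first by exists 0%N.
  exists (N + `|i.1.1| + `|v i.1.2|)%N => j; rewrite inE => /orP[/eqP->|/hN [h1 h2]].
    split; first by lia.
    by apply: vgeW (vge_wzM HF w0 vw _ (vge_id v i.1.2)); lia.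
  split; first by lia.
  rewrite -[(_ + _)%N]addnA PoszD addrC expfzDr // -mulrA.
  by have := vge_wzM HF w0 vw (`|i.1.1| + `|v i.1.2|)%N h2; apply: vgeW; lia.
pose r' : seq (nat * F * V) := [seq ((absz (N%:Z + i.1.1), w ^ N%:Z * i.1.2), i.2) | i <- r].
have := @tot0_functional_nat r'; rewrite /r' !big_map /=; apply.
  by move=> j /mapP [i ir ->] /=; have [_ h] := hN i ir; split=> //; exact: hr.
have := congr1 (rho (tm N%:Z)) r0.
rewrite (lin0 (tm_lin Hr w0 _)) /tot (lin_sum (tm_lin Hr w0 _)) => e; rewrite -[RHS]e.
apply: eq_big_seq => i ir; have [h _] := hN i ir.
by rewrite (tm_um Hr w0) (tm_tm Hr w0) gez0_abs.
Qed.

End NoRelation.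

Lemma weight_relation :
  (forall chi, smooth_char_T v chi -> ~ subquotient_of_Ind v chi rho) ->
  exists P : {poly C}, P != 0 /\ pact S P x = 0.
Proof.
move=> nsub; apply: contrapT => nP.
have norel (P : {poly C}) : P != 0 -> pact S P x <> 0 by move=> P0 e; apply: nP; exists P.
have [l [lP lu ld lx]] := weight_functional.
(* Graph of the extension of l that has the same value on each translate u(b) t^k y as on y;
   [tot0_functional] makes it single-valued. *)
pose R z c := exists r : seq I, [/\ forall i, i \in r -> sigma i.2, z = tot r & c = \sum_(i <- r) l i.2].
have Rtot z : exists c, R z c.
  by have [r hr ->] := span_vertices z; exists (\sum_(i <- r) l i.2), r.
have l0 : l 0 = 0.
  have h := lP 1 0 0 (subspace0 ss) (subspace0 ss); rewrite scale1r addr0 mul1r in h.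
  by apply: (addrI (l 0)); rewrite addr0 -h.
have lZ c y : sigma y -> l (c *: y) = c * l y.
  by move=> sy; rewrite -[_ *: _]addr0 lP ?l0 ?addr0 //; exact: subspace0.
have RP a y z c d : R y c -> R z d -> R (a *: y + z) (a * c + d).
  move=> [r [sr -> ->]] [r' [sr' -> ->]].
  exists ([seq (i.1, a *: i.2) | i <- r] ++ r'); split.
  - by move=> i; rewrite mem_cat => /orP[/mapP [j /sr sj ->] /=|/sr' //]; apply: subspaceZ.
  - rewrite /tot big_cat big_map scaler_sumr /=; congr (_ + _); apply: eq_bigr => i _.
    by rewrite (linZ (tm_lin Hr w0 _)) (linZ (um_lin Hr _)).
  - rewrite big_cat big_map mulr_sumr /=; congr (_ + _); apply: eq_big_seq => i /sr si.
    by rewrite lZ.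
have Rfun z c d : R z c -> R z d -> c = d.
  move=> h1 h2; have [r [sr r0 e]] := RP (-1) z z _ _ h2 h1.
  apply/eqP; rewrite -subr_eq0 addrC -mulN1r e; apply/eqP.
  by apply: (tot0_functional norel lP lu) => //; rewrite -r0 scaleN1r addNr.
have [L hL] := choice Rtot.
have RL z c : R z c -> L z = c by apply: Rfun.
have [] := @subquotient_of_functional p F v HF C V rho Hr L Hs irr.
- by move=> a y z; apply: RL; apply: RP.
- exists (rho sm x); rewrite (RL _ 1) ?oner_neq0 //.
  exists [:: ((0, 0), rho sm x)]; split.
  + by move=> i; rewrite inE => /eqP-> /=; apply: sst => //; exact: (KO_sm HF).
  + by rewrite /tot big_seq1 (um0 Hr) (tm0 Hr).
  + by rewrite big_seq1.
- move=> b z; apply: RL; have [r [sr e1 ->]] := hL z.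
  exists [seq ((i.1.1, b + i.1.2), i.2) | i <- r]; split.
  + by move=> i /mapP [j /sr sj ->].
  + rewrite {1}e1 /tot big_map (lin_sum (um_lin Hr b)); apply: eq_bigr => i _.
    by rewrite (um_um Hr).
  + by rewrite big_map.
- move=> a d a0 d0; have [k [e [c [ue hdg]]]] := dg_tm_decomp a0 d0.
  have u1 := vunit1 HF; have [c' hc'] := ld e 1 ue u1.
  exists (c * c') => z; apply: RL; have [r [sr e1 ->]] := hL z.
  exists [seq ((i.1.1 + k, a * i.1.2 / d), c *: rho (dg e 1) i.2) | i <- r].
  have sd y : sigma y -> sigma (rho (dg e 1) y) by apply: sst; exact: (KO_dg HF).
  split.
  + by move=> i /mapP [j /sr sj ->] /=; apply: (subspaceZ ss); exact: sd.
  + rewrite {1}e1 /tot big_map (lin_sum (dg_lin Hr a0 d0)); apply: eq_bigr => i _ /=.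
    by rewrite (dg_um Hr) // (dg_tm Hr w0) // hdg (tm_tm Hr w0).
  + rewrite big_map mulr_sumr; apply: eq_big_seq => i /sr si /=.
    by rewrite lZ ?hc' ?mulrA //; exact: sd.
by move=> chi [sc sub]; apply: nsub sub.
Qed.

End UniversalCase.

(** * Eigenvectors of S with nonzero eigenvalue *)

Section Eigenvector.
Variables (p : nat) (F : fieldType) (v : F -> int).
Hypothesis HF : nonarch_local_field p v.
Local Notation G := (vge v).
Variables (C : closedFieldType) (V : lmodType C) (rho : 'M[F]_2 -> V -> V).
Hypothesis Hr : is_rep rho.
Variables (w : F) (ks : seq F).
Hypotheses (w0 : w != 0) (vw : v w = 1) (rk : isreps v 1 (0 :: ks)).

Local Notation S := (Sop rho w ks).
Local Notation tm := (tm w).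
Local Notation reps := (reps ks w).

Variables (x : V) (alpha : C) (om : F -> C) (th : F -> C).
Hypotheses (fx : fixI v rho x) (x0 : x <> 0) (Sx : S x = alpha *: x) (al0 : alpha != 0)
  (hom : forall a y, a != 0 -> rho a%:M y = om a *: y)
  (hth : forall e, vunit v e -> rho (dg e 1) x = th e *: x).

Let o0 : (1 : F) != 0. Proof. exact: oner_neq0. Qed.
Let u1 : vunit v 1. Proof. exact: vunit1 HF. Qed.

Lemma scale_x_inj (c d : C) : c *: x = d *: x -> c = d.
Proof.
move=> /eqP; rewrite -subr_eq0 -scalerBl scaler_eq0 => /orP[|/eqP //].
by rewrite subr_eq0 => /eqP.
Qed.

Lemma omM a b : a != 0 -> b != 0 -> om (a * b) = om a * om b.
Proof.
move=> a0 b0; apply: scale_x_inj; rewrite -scalerA -!hom ?mulf_neq0 //.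
by rewrite -!mx2_scalar (dg_dg Hr).
Qed.

Lemma om1 : om 1 = 1.
Proof. by apply: scale_x_inj; rewrite -hom // (act1 Hr) scale1r. Qed.

Lemma om_neq0 a : a != 0 -> om a != 0.
Proof.
move=> a0; apply/eqP => h; have := omM a0 (invr_neq0 a0).
by rewrite divff // om1 h mul0r => /eqP; rewrite oner_eq0.
Qed.

Lemma thM e f : vunit v e -> vunit v f -> th (e * f) = th e * th f.
Proof.
move=> ue uf; have e0 := vunit_neq0 ue; have f0 := vunit_neq0 uf.
apply: scale_x_inj; rewrite -hth; last exact: (vunitM HF).
have -> : dg (e * f) 1 = dg (f * e) (1 * 1) by rewrite mulr1 mulrC.
by rewrite -(dg_dg Hr) // hth // (linZ (dg_lin Hr f0 o0)) hth // scalerA.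
Qed.

Lemma th_1unit e : G (e - 1) 1 -> th e = 1.
Proof.
move=> h; have ue : vunit v e by apply: (vunit_1cong HF) h.
apply: scale_x_inj; rewrite -hth // scale1r; case: fx => [[_ dx] _]; apply: dx => //.
by rewrite subrr; exact: vge0.
Qed.

Lemma om_1unit e : G (e - 1) 1 -> om e = 1.
Proof.
move=> h; have ue : vunit v e by apply: (vunit_1cong HF) h.
apply: scale_x_inj; rewrite -hom ?(vunit_neq0 ue) // -mx2_scalar scale1r.
by case: fx => [[_ dx] _]; apply: dx.
Qed.

Lemma th_neq0 e : vunit v e -> th e != 0.
Proof.
move=> ue; apply/eqP => h; have := thM ue (vunitV HF ue).
rewrite divff ?(vunit_neq0 ue) // th_1unit ?subrr ?h ?mul0r; last exact: vge0.
by move/eqP; rewrite oner_eq0.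
Qed.

(** Forced by the model: diag(a, d) is a times s diag(d/a, 1) s, unit diag(e, 1) act on x by [th],
    and the value at diag(1, w) must be alpha for S to act on [phi0] by alpha. *)
Definition chi (a d : F) : C := om a * (alpha ^ v (d / a) * th (d / a / w ^ v (d / a))).

Lemma unit_part z : z != 0 -> vunit v (z / w ^ v z).
Proof.
move=> z0; have wk := wX_neq0 w0 (v z); split; first by rewrite mulf_neq0 ?invr_neq0.
by rewrite (vM HF) ?invr_neq0 // (vV HF) // (vXz HF) // vw mul1r subrr.
Qed.

Lemma chiM a a' d d' : a != 0 -> a' != 0 -> d != 0 -> d' != 0 ->
  chi (a * a') (d * d') = chi a d * chi a' d'.
Proof.
move=> a0 a'0 d0 d'0; rewrite /chi omM //.
have -> : d * d' / (a * a') = (d / a) * (d' / a') by field; rewrite ?a0 ?a'0.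
have z0 : d / a != 0 by rewrite mulf_neq0 ?invr_neq0.
have z'0 : d' / a' != 0 by rewrite mulf_neq0 ?invr_neq0.
move: (d / a) (d' / a') z0 z'0 => z z' z0 z'0; rewrite (vM HF) // !expfzDr //.
have wz := wX_neq0 w0 (v z); have wz' := wX_neq0 w0 (v z').
have -> : z * z' / (w ^ v z * w ^ v z') = (z / w ^ v z) * (z' / w ^ v z').
  by field; rewrite ?wz ?wz'.
by rewrite (thM (unit_part z0) (unit_part z'0)); ring.
Qed.

Lemma chi_neq0 a d : a != 0 -> d != 0 -> chi a d != 0.
Proof.
move=> a0 d0; rewrite !mulf_neq0 ?om_neq0 ?expfz_neq0 ?th_neq0 //.
by apply: unit_part; rewrite mulf_neq0 ?invr_neq0.
Qed.

Lemma chi_1unit a d : G (a - 1) 1 -> G (d - 1) 1 -> chi a d = 1.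
Proof.
move=> ha hd.
have ua : vunit v a by apply: (vunit_1cong HF) ha.
have ud : vunit v d by apply: (vunit_1cong HF) hd.
have a0 := vunit_neq0 ua; have [_ v0] := vunitM HF ud (vunitV HF ua).
rewrite /chi v0 !expr0z divr1 om_1unit // th_1unit ?mulr1 //.
have -> : d / a - 1 = ((d - 1) - (a - 1)) / a by field.
apply: (vge_mulr HF); first exact: (vgeB HF).
exact: vunit_int (vunitV HF ua).
Qed.

Lemma chi_1w (m : int) : chi 1 (w ^ m) = alpha ^ m.
Proof.
rewrite /chi om1 divr1 (vXz HF) // vw !mul1r divff ?wX_neq0 // th_1unit ?subrr ?mulr1 //.
exact: vge0.
Qed.

Lemma chi_smooth : smooth_char_T v chi.
Proof.
split; [exact: chi_neq0 | exact: chiM | exists 0%N => a d; exact: chi_1unit].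
Qed.

(* The function supported on P s U(O) with value chi(b) at b s u, u in U(O). *)
Definition phi0 (g : 'M[F]_2) : C :=
  let D := g 0 0 * g 1 1 - g 0 1 * g 1 0 in
  if [&& D != 0, g 1 0 != 0 & vgeb v (g 1 1 / g 1 0) 0] then chi (- D / g 1 0) (g 1 0) else 0.

Lemma phi0_eq0 a b c d : (c != 0 -> ~ G (d / c) 0) -> phi0 (mx2 a b c d) = 0.
Proof.
rewrite /phi0 !mx2E => h; case: ifP => // /and3P[_ c0 /vgeP gd].
by case: (h c0).
Qed.

Lemma phi0_val a b c d : a * d - b * c != 0 -> c != 0 -> G (d / c) 0 ->
  phi0 (mx2 a b c d) = chi (- (a * d - b * c) / c) c.
Proof. by rewrite /phi0 !mx2E => -> -> /vgeP ->. Qed.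

Lemma phi0_GL g : g \notin unitmx -> phi0 g = 0.
Proof. by rewrite [g]mx2_eta mx2_unit negbK /phi0 !mx2E => ->. Qed.

Lemma phi0_P b g : inP b -> g \in unitmx -> phi0 (b *m g) = chi (b 0 0) (b 1 1) * phi0 g.
Proof.
move=> /inPE [z [a' [d' [a'0 d'0 -> -> ->]]]].
rewrite [g]mx2_eta; move: (g 0 0) (g 0 1) (g 1 0) (g 1 1) => a b' c d.
rewrite mx2_unit => D0.
have -> : um z *m dg a' d' *m mx2 a b' c d =
    mx2 (a' * a + z * d' * c) (a' * b' + z * d' * d) (d' * c) (d' * d).
  by rewrite !mx2_mul; congr mx2; ring.
have [c0|c0] := eqVneq c 0.
  by rewrite !phi0_eq0 ?mulr0 // c0 ?mulr0 eqxx.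
have e : d' * d / (d' * c) = d / c by field; rewrite ?c0 ?d'0.
case: (pselect (G (d / c) 0)) => h; last first.
  by rewrite !phi0_eq0 ?mulr0 // => _; rewrite ?e.
have D1 : (a' * a + z * d' * c) * (d' * d) - (a' * b' + z * d' * d) * (d' * c)
   = a' * d' * (a * d - b' * c) by ring.
rewrite !phi0_val ?e ?D1 ?mulf_neq0 //.
have -> : - (a' * d' * (a * d - b' * c)) / (d' * c) = a' * (- (a * d - b' * c) / c).
  by field; rewrite ?c0 ?d'0.
by rewrite chiM // mulf_neq0 ?invr_neq0 ?oppr_eq0.
Qed.

Lemma phi0_dg g a' d' : a' != 0 -> d' != 0 -> v (d' / a') = 0 -> g \in unitmx ->
  phi0 (g *m dg a' d') = chi d' a' * phi0 g.
Proof.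
move=> a'0 d'0 uda; rewrite [g]mx2_eta; move: (g 0 0) (g 0 1) (g 1 0) (g 1 1) => a b c d.
rewrite mx2_unit => D0.
have -> : mx2 a b c d *m dg a' d' = mx2 (a * a') (b * d') (c * a') (d * d').
  by rewrite mx2_mul; congr mx2; ring.
have ue : vunit v (d' / a') by split=> //; rewrite mulf_neq0 ?invr_neq0.
have [c0|c0] := eqVneq c 0.
  by rewrite !phi0_eq0 ?mulr0 // c0 ?mul0r eqxx.
have e : d * d' / (c * a') = (d / c) * (d' / a') by field; rewrite ?c0 ?a'0.
case: (pselect (G (d / c) 0)) => h; last first.
  rewrite !phi0_eq0 ?mulr0 // => _; rewrite e => h'; apply: h.
  have -> : d / c = (d / c * (d' / a')) * (d' / a')^-1 by field; rewrite ?c0 ?a'0 ?d'0.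
  by apply: (vge_mulr HF) => //; exact: vunit_int (vunitV HF ue).
have gh : G (d * d' / (c * a')) 0 by rewrite e; apply: (vge_mulr HF) => //; exact: vunit_int.
have D1 : a * a' * (d * d') - b * d' * (c * a') = a' * d' * (a * d - b * c) by ring.
rewrite !phi0_val ?D1 ?mulf_neq0 //.
have -> : - (a' * d' * (a * d - b * c)) / (c * a') = d' * (- (a * d - b * c) / c).
  by field; rewrite ?c0 ?a'0.
by rewrite [c * a']mulrC chiM // mulf_neq0 ?invr_neq0 ?oppr_eq0.
Qed.

Lemma phi0_um g b' : G b' 0 -> g \in unitmx -> phi0 (g *m um b') = phi0 g.
Proof.
move=> gb; rewrite [g]mx2_eta; move: (g 0 0) (g 0 1) (g 1 0) (g 1 1) => a b c d.
rewrite mx2_unit => D0.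
have -> : mx2 a b c d *m um b' = mx2 a (b + a * b') c (d + c * b').
  by rewrite mx2_mul; congr mx2; ring.
have [c0|c0] := eqVneq c 0; first by rewrite !phi0_eq0 // c0 eqxx.
have e : (d + c * b') / c = d / c + b' by field.
case: (pselect (G (d / c) 0)) => h; last first.
  rewrite !phi0_eq0 // => _; rewrite e => h'; apply: h.
  by rewrite -[d / c](addrK b'); apply: (vgeB HF).
have D1 : a * (d + c * b') - (b + a * b') * c = a * d - b * c by ring.
by rewrite !phi0_val ?D1 // e; apply: (vgeD HF).
Qed.

Lemma phi0_nm g c' : G c' 1 -> g \in unitmx -> phi0 (g *m nm c') = phi0 g.
Proof.
(* Points where [phi0] is nonzero suffice: if it vanishes at g but not at g n(c'), use the claim at
   g n(c') with - c'. *)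
suff H h c1 : G c1 1 -> h \in unitmx -> phi0 h != 0 -> phi0 (h *m nm c1) = phi0 h.
  move=> gc gu; have [e|n] := eqVneq (phi0 g) 0; last exact: H.
  have [->//|n] := eqVneq (phi0 (g *m nm c')) 0.
  have := H (g *m nm c') (- c') (vgeN HF gc) _ n; rewrite -mulmxA mx2_mul.
  have -> : mx2 (1 * 1 + 0 * - c') (1 * 0 + 0 * 1) (c' * 1 + 1 * - c') (c' * 0 + 1 * 1)
     = 1%:M by rewrite -mx2_scalar; congr mx2; ring.
  by rewrite mulmx1 unitmx_mul gu nm_GL => <-.
move=> gc; rewrite [h]mx2_eta; move: (h 0 0) (h 0 1) (h 1 0) (h 1 1) => a b c d.
rewrite mx2_unit => D0 n.
have -> : mx2 a b c d *m nm c1 = mx2 (a + b * c1) b (c + d * c1) d.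
  by rewrite mx2_mul; congr mx2; ring.
have c0 : c != 0.
  by apply: contra_neq n => c0; rewrite phi0_eq0 // c0 eqxx.
have gd : G (d / c) 0.
  by apply: contrapT => ngd; move: n; rewrite phi0_eq0 ?eqxx.
have g1 : G (d / c * c1) 1 by apply: (vge_mull HF).
have ue : vunit v (1 + d / c * c1).
  by apply: (vunit_1cong HF (n := 1)) => //; rewrite addrAC subrr add0r.
have e0 := vunit_neq0 ue.
have ce : c + d * c1 = c * (1 + d / c * c1) by field.
have D1 : (a + b * c1) * d - b * (c + d * c1) = a * d - b * c by ring.
have c10 : c + d * c1 != 0 by rewrite ce mulf_neq0.
have gde : G (d / (c + d * c1)) 0.
  have -> : d / (c + d * c1) = d / c * (1 + d / c * c1)^-1.
    by rewrite ce; move: e0; set e := 1 + _ => e0; field; rewrite ?c0 ?e0.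
  by apply: (vge_mulr HF) => //; exact: vunit_int (vunitV HF ue).
rewrite !phi0_val ?D1 //.
have -> : - (a * d - b * c) / (c + d * c1) = (- (a * d - b * c) / c) * (1 + d / c * c1)^-1.
  by rewrite ce; move: e0; set e := 1 + _ => e0; field; rewrite ?c0 ?e0.
rewrite ce chiM ?invr_neq0 ?mulf_neq0 ?oppr_eq0 ?invr_neq0 //.
rewrite [chi _^-1 _]chi_1unit ?mulr1 //; last by rewrite addrAC subrr add0r.
have -> : (1 + d / c * c1)^-1 - 1 = - (1 + d / c * c1 - 1) * (1 + d / c * c1)^-1.
  by move: e0; set e := 1 + _ => e0; field.
apply: (vge_mulr HF); last exact: vunit_int (vunitV HF ue).
by apply: (vgeN HF); rewrite addrAC subrr add0r.
Qed.

(** If d/c is integral, exactly one residue l, that of -d/c, keeps the argument in the support, and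
    it contributes the factor chi(1, w) = alpha; otherwise no term survives. *)
Lemma phi0_S h : h \in unitmx ->
  \sum_(l <- 0 :: ks) phi0 (h *m um l *m tm 1) = alpha * phi0 h.
Proof.
rewrite [h]mx2_eta; move: (h 0 0) (h 0 1) (h 1 0) (h 1 1) => a b c d.
rewrite mx2_unit => D0.
have E l : mx2 a b c d *m um l *m tm 1 = mx2 (a * w) (b + a * l) (c * w) (d + c * l).
  by rewrite !mx2_mul expr1z; congr mx2; ring.
under eq_bigr => l _ do rewrite E.
have [c0|c0] := eqVneq c 0.
  rewrite [phi0 (mx2 a b c d)]phi0_eq0 ?c0 ?eqxx // mulr0 big1 // => l _.
  by rewrite phi0_eq0 // mul0r eqxx.
have e l : (d + c * l) / (c * w) = (l - - (d / c)) / w by field; rewrite ?w0 ?c0.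
have key l : G ((d + c * l) / (c * w)) 0 <-> G (- (d / c) - l) 1.
  rewrite e; split=> h'.
    apply: (vgeBC HF); have := vgeM HF h' (vge_w vw); rewrite divfK //.
  have := vgeM HF (vgeBC HF h') (vge_id v w^-1); rewrite (vV HF) // vw.
  by rewrite subrr.
case: (rk) => uk Ok cov inj.
case: (pselect (G (d / c) 0)) => gd; last first.
  rewrite [phi0 (mx2 a b c d)]phi0_eq0 // mulr0 big1_seq // => l /andP[_ /Ok gl].
  rewrite phi0_eq0 // => _ /key h'; apply: gd; rewrite -[_ / _]opprK; apply: (vgeN HF).
  by rewrite -[- _](subrK l); apply: (vgeD HF) => //; apply: vgeW h'.
have [l0 l0k hl0] := cov _ (vgeN HF gd).
rewrite (bigD1_seq l0) //= [X in _ + X]big1_seq ?addr0; last first.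
  move=> l /andP[ne lk]; rewrite phi0_eq0 // => _ /key h'; move: ne.
  rewrite (inj l l0) ?eqxx //; apply: (vge_trans HF) hl0; exact: (vgeBC HF).
have D1 : a * w * (d + c * l0) - (b + a * l0) * (c * w) = w * (a * d - b * c) by ring.
rewrite !phi0_val ?D1 ?mulf_neq0 //; last exact/key.
have -> : - (w * (a * d - b * c)) / (c * w) = 1 * (- (a * d - b * c) / c).
  by field; rewrite ?c0 ?w0.
rewrite [c * w]mulrC chiM ?mulf_neq0 ?invr_neq0 ?oppr_eq0 //.
by have := chi_1w 1; rewrite !expr1z => ->.
Qed.

Lemma phi0_reps k h : h \in unitmx ->
  \sum_(a <- reps k) phi0 (h *m um a *m tm k) = alpha ^+ k * phi0 h.
Proof.
move=> hu; elim: k h hu => [|k IH] h hu.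
  rewrite big_seq1 expr0 mul1r; congr phi0; rewrite -mulmxA -[RHS]mulmx1 -mx2_scalar.
  by congr (_ *m _); rewrite mx2_mul expr0z; congr mx2; ring.
rewrite -[reps k.+1]/[seq a + w * y | a <- 0 :: ks, y <- reps k] big_allpairs_dep.
rewrite exprSr -mulrA -phi0_S // mulr_sumr; apply: eq_bigr => l _.
rewrite -IH ?unitmx_mul ?hu ?um_GL ?tm_GL //; apply: eq_bigr => a _; congr phi0.
rewrite -!mulmxA; congr (_ *m _); rewrite !mx2_mul exprSz expr1z.
by congr mx2; ring.
Qed.

(** Right factors k under which x and [phi0] change by the same scalar; comparing g x with the
    translate of [phi0] by g may ignore them. *)
Definition eqv (k : 'M[F]_2) (c : C) := [/\ k \in unitmx, rho k x = c *: x
  & forall h, h \in unitmx -> phi0 (h *m k) = c * phi0 h].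

Lemma eqv_mul k k' c c' : eqv k c -> eqv k' c' -> eqv (k *m k') (c * c').
Proof.
move=> [ku hk pk] [ku' hk' pk']; split; first by rewrite unitmx_mul ku ku'.
  by rewrite -(actM Hr) // hk' (linZ (act_lin Hr ku)) hk scalerA mulrC.
by move=> h hu; rewrite mulmxA pk' ?unitmx_mul ?hu // pk // mulrA [c' * c]mulrC.
Qed.
Lemma eqv_um b : G b 0 -> eqv (um b) 1.
Proof.
move=> gb; split; first exact: um_GL.
  by rewrite scale1r; case: fx => [[ux _] _]; apply: ux.
by move=> h hu; rewrite phi0_um // mul1r.
Qed.
Lemma eqv_nm c : G c 1 -> eqv (nm c) 1.
Proof.
move=> gc; split; first exact: nm_GL.
  by rewrite scale1r; case: fx => [_ nx]; apply: nx.
by move=> h hu; rewrite phi0_nm // mul1r.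
Qed.
Lemma eqv_dg a d : a != 0 -> d != 0 -> v (a / d) = 0 -> eqv (dg a d) (chi d a).
Proof.
move=> a0 d0 vad; have ue : vunit v (a / d) by split=> //; rewrite mulf_neq0 ?invr_neq0.
have e0 := vunit_neq0 ue.
split; first exact: dg_GL.
  have -> : dg a d = dg (d * (a / d)) (d * 1) by congr mx2; field.
  rewrite -(dg_dg Hr) // hth // (linZ (dg_lin Hr d0 d0)) [dg d d]mx2_scalar hom // scalerA /chi vad.
  by rewrite !expr0z divr1 mul1r mulrC.
move=> h hu; apply: phi0_dg => //.
by have [] := vunitV HF ue; rewrite invf_div.
Qed.

(** The inverses of p^(m+1) fill the complement of p^(-m), whence the exponent m+1 at infinity. From
    p^(-m) to p^(2m+2) there are 3m+2 digits, the length used in [cells]. *)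
Let inf_ (m : nat) : nat := m.+1.
Let fin_ (m : nat) : nat := (2 * m + 2)%N.
Definition cells (m : nat) := [seq w ^ (- m%:Z) * z | z <- reps (3 * m + 2)%N].

(* The cells y + p^(2m+2) of p^(-m) and the complement of p^(-m) partition P^1(F). *)
Definition qm (m : nat) (phi : 'M[F]_2 -> C) : V :=
  \sum_(y <- cells m) (phi (sm *m um (- y)) * alpha ^- fin_ m) *:
     rho (um y) (rho (tm (fin_ m)) x)
  + (phi 1%:M * alpha ^- inf_ m) *: rho sm (rho (tm (inf_ m)) x).

Lemma qm_ext m phi psi : (forall h, h \in unitmx -> phi h = psi h) -> qm m phi = qm m psi.
Proof.
move=> e; rewrite /qm e ?unitmx1 //; congr (_ + _); apply: eq_bigr => y _.
by rewrite e // unitmx_mul sm_GL um_GL.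
Qed.

Lemma qm_lin m a phi psi : qm m (fun h => a * phi h + psi h) = a *: qm m phi + qm m psi.
Proof.
rewrite /qm scalerDr scaler_sumr addrACA -big_split /=; congr (_ + _).
  by apply: eq_bigr => y _; rewrite scalerA -scalerDl; congr (_ *: _); ring.
by rewrite scalerA -scalerDl; congr (_ *: _); ring.
Qed.

Lemma qm0 m : qm m (fun=> 0) = 0.
Proof.
rewrite /qm big1 => [|y _]; last by rewrite mul0r scale0r.
by rewrite mul0r scale0r addr0.
Qed.

Lemma qm_sum m (I : Type) (r : seq I) (a : I -> C) (phi : I -> 'M[F]_2 -> C) :
  qm m (fun h => \sum_(i <- r) a i * phi i h) = \sum_(i <- r) a i *: qm m (phi i).
Proof.
elim: r => [|i r IH].
  by rewrite big_nil -[RHS](qm0 m); apply: qm_ext => h _; rewrite big_nil.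
rewrite big_cons -IH -qm_lin; apply: qm_ext => h _; by rewrite big_cons.
Qed.

(** [qm] rebuilds g x from finitely many values of the translate of [phi0] by g. If one m serves
    finitely many g, every linear relation between these translates passes to the vectors g x. *)
Definition good m g := rho g x = qm m (fun h => phi0 (h *m g)).

Lemma good_eqv m g k c : g \in unitmx -> eqv k c -> good m g -> good m (g *m k).
Proof.
move=> gu [ku hk pk] gg; rewrite /good -(actM Hr) // hk (linZ (act_lin Hr gu)) gg.
rewrite -[LHS]addr0 -(qm0 m) -qm_lin; apply: qm_ext => h hu.
by rewrite addr0 mulmxA pk // unitmx_mul hu.
Qed.

(** Both x and [phi0] are alpha^-k times the sum of their subdivisions by u(a) t^k, so a cell is
    good when its subcells are. The division uses alpha <> 0. *)
Lemma good_sum m g k : g \in unitmx -> (forall a, a \in reps k -> good m (g *m um a *m tm k)) ->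
  good m g.
Proof.
move=> gu hg; have ak0 : alpha ^+ k != 0 by rewrite expf_neq0.
have xE : x = (alpha ^+ k)^-1 *: \sum_(a <- reps k) rho (um a) (rho (tm k) x).
  rewrite -(iter_Sop Hr _ w0).
  have -> : iter k S x = alpha ^+ k *: x.
    elim: k {hg ak0} => [|k IH]; first by rewrite scale1r.
    by rewrite iterS IH (linZ (Sop_lin Hr w0 ks)) Sx scalerA exprSr.
  by rewrite scalerA mulVf // scale1r.
rewrite /good {1}xE (linZ (act_lin Hr gu)) (lin_sum (act_lin Hr gu)) scaler_sumr.
transitivity (\sum_(a <- reps k) (alpha ^+ k)^-1 *: qm m (fun h => phi0 (h *m (g *m um a *m tm k)))).
  apply: eq_big_seq => a ar; congr (_ *: _); rewrite -(hg a ar).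
  by rewrite !(actM Hr) ?unitmx_mul ?gu ?um_GL ?tm_GL // mulmxA.
rewrite -qm_sum; apply: qm_ext => h hu; rewrite -mulr_sumr.
under eq_bigr => a _ do rewrite !mulmxA.
by rewrite phi0_reps ?unitmx_mul ?hu // mulrA mulVf // mul1r.
Qed.

Lemma cells_int m y : y \in cells m -> G y (- m%:Z).
Proof.
move=> /mapP [z /(reps_int HF rk w0 vw) gz ->].
by have := vge_wzM HF w0 vw (- m%:Z) gz; rewrite addr0.
Qed.

Lemma good_fin m y : G y (- m%:Z) -> good m (um y *m tm (fin_ m)).
Proof.
move=> gy; set n := fin_ m.
have wn0 := wX_neq0 w0 n%:Z.
have E y' : sm *m um (- y') *m (um y *m tm n) = mx2 0 1 (w ^ n%:Z) (y - y').
  by rewrite !mx2_mul; congr mx2; ring.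
have [ur ir cr jr] := isreps_reps HF rk w0 vw (3 * m + 2)%N.
have [z gz yz] := vge_dvd HF w0 vw gy.
have nE : (n%:Z = - m%:Z + (3 * m + 2)%N%:Z) by rewrite /n /fin_; lia.
have [z' zr hz] := cr z gz.
have cong a b : G (w ^ (- m%:Z) * a - w ^ (- m%:Z) * b) n -> G (a - b) (3 * m + 2)%N.
  rewrite -mulrBr => h; have := vge_wzM HF w0 vw m%:Z h; rewrite mulrA -expfzDr //.
  by rewrite subrr expr0z mul1r nE; apply: vgeW; lia.
set y' := w ^ (- m%:Z) * z'.
have y'c : y' \in cells m by apply: map_f.
have hy' : G (y - y') n.
  by rewrite yz /y' -mulrBr nE; apply: (vge_wzM HF).
(* Evaluation at y1 tests whether y1 lies in y + p^n; the value alpha^n cancels the weight alpha^-n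
   in [qm]. *)
have phiE y1 : phi0 (sm *m um (- y1) *m (um y *m tm n)) =
    if vgeb v (y - y1) n then alpha ^+ n else 0.
  rewrite E; case: vgeP => h; last first.
    rewrite phi0_eq0 // => _ h'; apply: h; have := vgeM HF h' (vge_id v (w ^ n%:Z)).
    by rewrite divfK // (vXz HF) // vw add0r mul1r.
  have D1 : 0 * (y - y1) - 1 * w ^ n%:Z = - w ^ n%:Z by ring.
  rewrite phi0_val ?D1 ?oppr_eq0 //.
    by rewrite opprK divff // chi_1w.
  have := vgeM HF h (vge_id v (w ^ n%:Z)^-1).
  by rewrite (vV HF) // (vXz HF) // vw mul1r subrr.
rewrite /good /qm -(actM Hr) ?um_GL ?tm_GL // mul1mx.
have -> : phi0 (um y *m tm n) = 0.
  have -> : um y *m tm n = mx2 (w ^ n%:Z) y 0 1 by rewrite mx2_mul; congr mx2; ring.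
  by rewrite phi0_eq0 // eqxx.
rewrite mul0r scale0r addr0 (bigD1_seq y') //=; last first.
  by rewrite map_inj_uniq //; apply: mulfI; exact: wX_neq0.
rewrite big1_seq ?addr0; last first.
  move=> y1 /andP[ne /mapP [z1 z1r y1E]]; rewrite phiE; case: vgeP => h; last first.
    by rewrite mul0r scale0r.
  case/eqP: ne; rewrite y1E /y'; congr (_ * _); apply: jr => //; apply: cong.
  by rewrite -/y' -y1E; apply: (vge_trans HF) hy'; exact: (vgeBC HF).
rewrite phiE; case: vgeP => // _; rewrite divff ?expf_neq0 // scale1r.
by apply: (um_cong_tm HF Hr w0 vw) => //; case: fx => [[]].
Qed.

Lemma good_um_tm m y r : G y (- m%:Z) -> - m%:Z <= r -> r <= (fin_ m)%:Z ->
  good m (um y *m tm r).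
Proof.
move=> gy mr rn; have gu : um y *m tm r \in unitmx by rewrite unitmx_mul um_GL tm_GL.
have wr := wX_neq0 w0 r.
apply: (good_sum (k := `|(fin_ m)%:Z - r|%N) gu) => a /(reps_int HF rk w0 vw) ga.
set k := `|_|%N; have kE : (k%:Z = (fin_ m)%:Z - r) by rewrite /k; lia.
have -> : um y *m tm r *m um a *m tm k = um (y + w ^ r * a) *m tm (fin_ m).
  have wE : w ^ (fin_ m)%:Z = w ^ r * w ^ k%:Z by rewrite -expfzDr // kE addrC subrK.
  by rewrite !mx2_mul wE; congr mx2; ring.
apply: good_fin; apply: (vgeD HF) => //.
by apply: vgeW (vge_wzM HF w0 vw r ga); rewrite addr0.
Qed.

Lemma good_P m y a d : a != 0 -> d != 0 -> G y (- m%:Z) -> - m%:Z <= v (a / d) ->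
  v (a / d) <= (fin_ m)%:Z -> good m (um y *m dg a d).
Proof.
move=> a0 d0 gy h1 h2; set r := v (a / d); have wr := wX_neq0 w0 r.
have ad0 : a / d != 0 by rewrite mulf_neq0 ?invr_neq0.
have ar0 : a / w ^ r != 0 by rewrite mulf_neq0 ?invr_neq0.
have -> : um y *m dg a d = um y *m tm r *m dg (a / w ^ r) d.
  by rewrite !mx2_mul; congr mx2; field.
apply: good_eqv (good_um_tm gy h1 h2); first by rewrite unitmx_mul um_GL tm_GL.
apply: eqv_dg => //; have -> : a / w ^ r / d = a / d / w ^ r by field; rewrite ?d0 ?wr.
by case: (unit_part ad0).
Qed.

Lemma good_inf m : good m (sm *m tm (inf_ m)).
Proof.
set n := inf_ m; have wn0 := wX_neq0 w0 n%:Z.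
have E y : sm *m um (- y) *m (sm *m tm n) = mx2 (w ^ n%:Z) 0 (- y * w ^ n%:Z) 1.
  by rewrite !mx2_mul; congr mx2; ring.
rewrite /good /qm -(actM Hr) ?sm_GL ?tm_GL // mul1mx big1_seq ?add0r; last first.
  move=> y /andP[_ yc]; rewrite E phi0_eq0 ?mul0r ?scale0r // => yw0 h.
  have gy : G (- y * w ^ n%:Z) 1.
    have := vgeM HF (vgeN HF (cells_int yc)) (vge_id v (w ^ n%:Z)).
    by rewrite (vXz HF) // vw mul1r; apply: vgeW; rewrite /n /inf_; lia.
  apply: (not_vge1 u1); have := vgeM HF h gy; by rewrite divfK.
have -> : sm *m tm n = mx2 0 1 (w ^ n%:Z) 0 by rewrite mx2_mul; congr mx2; ring.
rewrite phi0_val //; last 2 first.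
- by rewrite mul0r sub0r mul1r oppr_eq0.
- by rewrite mul0r; exact: vge0.
have -> : - (0 * 0 - 1 * w ^ n%:Z) / w ^ n%:Z = 1 by field.
by rewrite chi_1w divff ?expf_neq0 // scale1r.
Qed.

Lemma vge_lt b (k : int) : ~ G b k -> b != 0 /\ v b < k.
Proof.
move=> h; split; first by apply/eqP => b0; apply: h; left.
by rewrite ltNge; apply/negP => h'; apply: h; right.
Qed.

(** The subdivision has pieces indexed by b in p^N. With b in p^(m+1) the piece is the cell at
    infinity; otherwise it is a finite cell around 1/b in p^(-m), of level m + 1 - 2 v(b), within
    the range of [good_P]. *)
Lemma good_inf2 m N : 0 <= N -> N <= (inf_ m)%:Z -> good m (sm *m tm N).
Proof.
move=> N0 Nm; have gu : sm *m tm N \in unitmx by rewrite unitmx_mul sm_GL tm_GL.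
have wN := wX_neq0 w0 N.
apply: (good_sum (k := `|(inf_ m)%:Z - N|%N) gu) => a /(reps_int HF rk w0 vw) ga.
set k := `|_|%N; have kE : (k%:Z = (inf_ m)%:Z - N) by rewrite /k; lia.
set n := inf_ m; have wn := wX_neq0 w0 n%:Z.
have wE : w ^ n%:Z = w ^ N * w ^ k%:Z by rewrite -expfzDr // kE addrC subrK.
set b := w ^ N * a; have gb : G b 0 by apply: vgeW (vge_wzM HF w0 vw N ga); rewrite addr0.
have -> : sm *m tm N *m um a *m tm k = mx2 0 1 (w ^ n%:Z) b.
  by rewrite !mx2_mul wE /b; congr mx2; ring.
case: (pselect (G b n)) => hb.
  have [c gc bE] := vge_dvd HF w0 vw hb.
  have -> : mx2 0 1 (w ^ n%:Z) b = sm *m tm n *m um c.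
    by rewrite bE !mx2_mul; congr mx2; ring.
  apply: good_eqv (eqv_um gc) (good_inf m).
  by rewrite unitmx_mul sm_GL tm_GL.
have [b0 vb] := vge_lt hb; have vb0 : 0 <= v b by case: gb => // e; rewrite e eqxx in b0.
have b1 : - (w ^ n%:Z / b) != 0 by rewrite oppr_eq0 mulf_neq0 ?invr_neq0.
have -> : mx2 0 1 (w ^ n%:Z) b = um b^-1 *m dg (- (w ^ n%:Z / b)) b *m nm (w ^ n%:Z / b).
  by rewrite !mx2_mul; congr mx2; field.
have vr : v (- (w ^ n%:Z / b) / b) = n%:Z - v b - v b.
  have bn := invr_neq0 b0; have wb := mulf_neq0 wn bn.
  by rewrite mulNr (vN HF) (vM HF wb bn) (vM HF wn bn) (vV HF b0) (vXz HF _ w0) vw mul1r.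
apply: good_eqv (eqv_nm _) (good_P _ _ _ _ _) => //.
- by rewrite unitmx_mul um_GL dg_GL.
- right; rewrite (vM HF) ?invr_neq0 // (vV HF) // (vXz HF) // vw; lia.
- by right; rewrite (vV HF) //; move: vb; rewrite /n /inf_; lia.
- by rewrite vr; move: vb; rewrite /n /inf_; lia.
- by rewrite vr; rewrite /n /inf_ /fin_; lia.
Qed.

Definition ev g := exists M : nat, forall m, (M <= m)%N -> good m g.

Lemma ev_eqv g k c : g \in unitmx -> eqv k c -> ev g -> ev (g *m k).
Proof. by move=> gu ek [M hM]; exists M => m /hM; apply: good_eqv ek. Qed.

Lemma ev_seq (I : eqType) (r : seq I) (g : I -> 'M[F]_2) : (forall i, i \in r -> ev (g i)) ->
  exists M : nat, forall m, (M <= m)%N -> forall i, i \in r -> good m (g i).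
Proof.
elim: r => [|i r IH] h; first by exists 0%N.
have [|M1 h1] := IH; first by move=> j jr; apply: h; rewrite inE jr orbT.
have [|M2 h2] := h i; first exact: mem_head.
exists (maxn M1 M2) => m; rewrite geq_max => /andP[/h1 k1 /h2 k2] j.
by rewrite inE => /orP[/eqP-> //|]; apply: k1.
Qed.

Lemma ev_sum g k : g \in unitmx -> (forall a, a \in reps k -> ev (g *m um a *m tm k)) -> ev g.
Proof.
by move=> gu /ev_seq [M hM]; exists M => m /hM h; apply: good_sum gu h.
Qed.

Lemma ev_P y a d : a != 0 -> d != 0 -> ev (um y *m dg a d).
Proof.
move=> a0 d0; exists (`|v y| + `|v (a / d)|)%N => m Mm; apply: good_P => //.
- right; lia.
- by move: (v (a / d)) Mm => z Mm; lia.
- by move: (v (a / d)) Mm; rewrite /fin_ => z Mm; lia.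
Qed.

Lemma ev_inf N : 0 <= N -> ev (sm *m tm N).
Proof. by move=> N0; exists `|N|%N => m Mm; apply: good_inf2 => //; rewrite /inf_; lia. Qed.

Lemma ev_all g : g \in unitmx -> ev g.
Proof.
rewrite [g]mx2_eta; move: (g 0 0) (g 0 1) (g 1 0) (g 1 1) => a b c d.
rewrite mx2_unit => D0.
have [c0|c0] := eqVneq c 0.
  have [a0 d0] : a != 0 /\ d != 0.
    by apply/andP; move: D0; rewrite c0 mulr0 subr0 mulf_eq0 negb_or.
  have -> : mx2 a b c d = um (b / d) *m dg a d by rewrite c0 mx2_mul; congr mx2; field.
  exact: ev_P.
have a10 : - (a * d - b * c) / c != 0 by rewrite mulf_neq0 ?invr_neq0 ?oppr_eq0.
have -> : mx2 a b c d = um (a / c) *m dg (- (a * d - b * c) / c) c *m sm *m um (d / c).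
  by rewrite !mx2_mul; congr mx2; field.
clear D0; move: (d / c) (a / c) a10 => z y; move: (_ / c) => a1 a10.
move: a1 c a10 c0 => {a b d} a d a0 d0.
have da0 : d / a != 0 by rewrite mulf_neq0 ?invr_neq0.
set r := v (d / a); have wr := wX_neq0 w0 r.
(* Chosen so that k + r >= 0 and y w^(k+r) lies in p. When z + e lies in p^k, the P-part then
   crosses s t^(k+r) to the right and becomes a lower unipotent of p and a torus element of unit
   ratio, both covered by [eqv]. *)
pose k := (`|r| + `|v y| + 1)%N; have wk := wX_neq0 w0 k%:Z.
have gu : um y *m dg a d *m sm *m um z \in unitmx.
  by rewrite !unitmx_mul !um_GL sm_GL dg_GL.
apply: (ev_sum (k := k) gu) => e _.
have -> : um y *m dg a d *m sm *m um z *m um e *m tm k = um y *m dg a d *m mx2 0 1 (w ^ k%:Z) (z + e).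
  by rewrite -!mulmxA; congr (_ *m (_ *m _)); rewrite !mx2_mul; congr mx2; ring.
set b := z + e; case: (pselect (G b k)) => hb.
  have [c gc bE] := vge_dvd HF w0 vw hb.
  have wE : w ^ (k%:Z + r) = w ^ k%:Z * w ^ r by rewrite expfzDr.
  have -> : um y *m dg a d *m mx2 0 1 (w ^ k%:Z) b =
      sm *m tm (k%:Z + r) *m nm (y * w ^ (k%:Z + r)) *m dg (d / w ^ r) a *m um c.
    by rewrite bE !mx2_mul wE; congr mx2; field.
  apply: (ev_eqv _ (eqv_um gc)).
    by rewrite !unitmx_mul sm_GL (tm_GL w0) nm_GL dg_GL // mulf_neq0 ?invr_neq0.
  apply: (ev_eqv _ (eqv_dg _ _ _)) => //.
  - by rewrite !unitmx_mul sm_GL (tm_GL w0) nm_GL.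
  - by rewrite mulf_neq0 ?invr_neq0.
  - have -> : d / w ^ r / a = d / a / w ^ r by field; rewrite ?a0 ?wr.
    by case: (unit_part da0).
  apply: (ev_eqv _ (eqv_nm _)).
  - by rewrite unitmx_mul sm_GL tm_GL.
  - have := vgeM HF (vge_id v y) (vge_id v (w ^ (k%:Z + r))).
    by rewrite (vXz HF) // vw; apply: vgeW; rewrite /k; lia.
  by apply: ev_inf; rewrite /k; lia.
have [b0 _] := vge_lt hb; have db0 : b * d != 0 by rewrite mulf_neq0.
have ab0 : - a * w ^ k%:Z / b != 0 by rewrite !mulf_neq0 ?invr_neq0 ?oppr_eq0.
have -> : um y *m dg a d *m mx2 0 1 (w ^ k%:Z) b =
    um (y + a / (b * d)) *m dg (- a * w ^ k%:Z / b) (b * d) *m nm (w ^ k%:Z / b).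
  by rewrite !mx2_mul; congr mx2; field; rewrite ?b0 ?d0.
apply: (ev_eqv _ (eqv_nm _) (ev_P _ ab0 db0)).
  by rewrite unitmx_mul um_GL dg_GL.
by have [_ vb] := vge_lt hb; right; rewrite (vM HF) ?invr_neq0 // (vV HF) // (vXz HF) // vw; lia.
Qed.

(** Needed for smoothness: the translate of [phi0] by g is fixed by g K_1 g^-1, which must contain
    some K_(n+1). *)
Lemma conj_bounded (g : 'M[F]_2) : g \in unitmx ->
  exists n, forall k, inK v n k -> inK v 0 (invmx g *m k *m g).
Proof.
rewrite [g]mx2_eta; move: (g 0 0) (g 0 1) (g 1 0) (g 1 1) => a b c d.
move=> gu; have := gu; rewrite mx2_unit; set D := a * d - b * c => D0.
have gV : invmx (mx2 a b c d) = mx2 (d / D) (- b / D) (- c / D) (a / D).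
  have e : mx2 a b c d *m mx2 (d / D) (- b / D) (- c / D) (a / D) = 1%:M.
    by rewrite mx2_mul -mx2_scalar /D in D0 *; congr mx2; field.
  by rewrite -[RHS]mul1mx -(mulVmx gu) -mulmxA e mulmx1.
pose e : nat := (`|v a| + `|v b| + `|v c| + `|v d|)%N.
have [ga gb gc gd] : [/\ G a (- e%:Z), G b (- e%:Z), G c (- e%:Z) & G d (- e%:Z)].
  by split; right; rewrite /e; lia.
have gD : G D^-1 (- v D) by rewrite -(vV HF) //; exact: vge_id.
(* Entries of g^-1 (k - 1) g are sums of u z y / D with u, y entries of g up to sign, losing at most
   2e + |v D|. *)
exists (2 * e + `|v D|)%N => k kK; have [ku _] := kK.
have [a' [b' [c' [d' [kE ha hb hc hd]]]]] := inKE kK.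
pose A := a' - 1; pose E := d' - 1.
have key u z y : G u (- e%:Z) -> G y (- e%:Z) -> G z ((2 * e + `|v D|)%N.+1)%:Z -> G (u * z * y / D) 1.
  move=> hu hy hz; have := vgeM HF (vgeM HF (vgeM HF hu hz) hy) gD; apply: vgeW; lia.
rewrite kE gV !mx2_mul.
have N u : G u (- e%:Z) -> G (- u) (- e%:Z) by apply: (vgeN HF).
apply: (inK_mx2 HF).
- set t := (X in G X _).
  have -> : t = d * (a' - 1) * a / D + d * b' * c / D + (- b) * c' * a / D + (- b) * (d' - 1) * c / D.
    by rewrite /t /D in D0 *; field.
  by do 3?[apply: (vgeD HF)]; apply: key => //; apply: N.
- set t := (X in G X _).
  have -> : t = d * (a' - 1) * b / D + d * b' * d / D + (- b) * c' * b / D + (- b) * (d' - 1) * d / D.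
    by rewrite /t /D in D0 *; field.
  by do 3?[apply: (vgeD HF)]; apply: key => //; apply: N.
- set t := (X in G X _).
  have -> : t = (- c) * (a' - 1) * a / D + (- c) * b' * c / D + a * c' * a / D + a * (d' - 1) * c / D.
    by rewrite /t /D in D0 *; field.
  by do 3?[apply: (vgeD HF)]; apply: key => //; apply: N.
- set t := (X in G X _).
  have -> : t = (- c) * (a' - 1) * b / D + (- c) * b' * d / D + a * c' * b / D + a * (d' - 1) * d / D.
    by rewrite /t /D in D0 *; field.
  by do 3?[apply: (vgeD HF)]; apply: key => //; apply: N.
Qed.

Lemma eqv_K k : inK v 0 k -> eqv k 1.
Proof.
move=> kK; have [ku _] := kK; have [a [b [c [d [kE ha hb hc hd]]]]] := inKE kK.
have ua : vunit v a by apply: (vunit_1cong HF) ha.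
have ud : vunit v d by apply: (vunit_1cong HF) hd.
have d0 := vunit_neq0 ud; have gd1 := vunit_int (vunitV HF ud).
have ga : G (a - b * c / d - 1) 1.
  have -> : a - b * c / d - 1 = (a - 1) - b * c / d by ring.
  apply: (vgeB HF) => //; apply: (vge_mulr HF) => //.
  by apply: (vge_mulr HF) => //; apply: vgeW hc.
have ue : vunit v (a - b * c / d) by apply: (vunit_1cong HF) ga.
have -> : k = um (b / d) *m dg (a - b * c / d) d *m nm (c / d).
  by rewrite kE !mx2_mul; congr mx2; field.
have -> : 1 = 1 * chi d (a - b * c / d) * 1 by rewrite chi_1unit // !mulr1.
apply: eqv_mul; last by apply: eqv_nm; apply: (vge_mulr HF).
apply: eqv_mul; first by apply: eqv_um; apply: (vge_mulr HF) => //; apply: vgeW hb.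
apply: eqv_dg => //; first exact: vunit_neq0 ue.
by have [] := vunitM HF ue (vunitV HF ud).
Qed.

(** The quotient map sends the right translate of [phi0] by g to g x; its domain is the G-span of
    [phi0], and it is onto by irreducibility. *)
Lemma eigenvector_subquotient : irreducible_rep rho -> subquotient_of_Ind v chi rho.
Proof.
move=> [_ irr].
pose I := (C * 'M[F]_2)%type.
pose r (phi : 'M[F]_2 -> C) y := exists l : seq I, [/\ forall i, i \in l -> i.2 \in unitmx,
  phi = (fun h => \sum_(i <- l) i.1 * phi0 (h *m i.2)) & y = \sum_(i <- l) i.1 *: rho i.2 x].
have rlin a phi psi y z : r phi y -> r psi z ->
    r (fun g => a * phi g + psi g) (a *: y + z).
  move=> [l [lu -> ->]] [l' [lu' -> ->]]; exists ([seq (a * i.1, i.2) | i <- l] ++ l'); split.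
  - by move=> i; rewrite mem_cat => /orP[/mapP [j /lu ju ->]|/lu'].
  - apply: funext => h; rewrite big_cat big_map mulr_sumr /=; congr (_ + _).
    by apply: eq_bigr => i _; rewrite mulrA.
  - rewrite big_cat big_map scaler_sumr /=; congr (_ + _).
    by apply: eq_bigr => i _; rewrite scalerA.
have r0 : r (fun=> 0) 0.
  by exists [::]; split=> //; rewrite ?big_nil //; apply: funext => h; rewrite big_nil.
have rG h phi y : inGL2 h -> r phi y -> r (fun g => phi (g *m h)) (rho h y).
  move=> hu [l [lu -> ->]]; exists [seq (i.1, h *m i.2) | i <- l]; split.
  - by move=> i /mapP [j /lu ju ->]; rewrite unitmx_mul ju andbT.
  - by apply: funext => g; rewrite big_map; apply: eq_bigr => i _; rewrite mulmxA.
  - rewrite big_map (lin_sum (act_lin Hr hu)); apply: eq_big_seq => i /lu iu.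
    by rewrite (linZ (act_lin Hr hu)) (actM Hr).
apply: (@subquotient_of_rel _ _ _ _ rho chi r) => //.
- move=> phi y [l [lu -> _]]; split.
  + move=> g ng; rewrite big1_seq // => i /andP[_ iu]; rewrite phi0_GL ?mulr0 //.
    by rewrite unitmx_mul (lu i iu) andbT; apply/negP.
  + move=> b g bP gu; rewrite mulr_sumr; apply: eq_big_seq => i /lu iu.
    by rewrite -mulmxA phi0_P ?unitmx_mul ?iu ?andbT // mulrCA.
  + have [n hn] : exists n, forall i, i \in l -> forall k, inK v n k -> inK v 0 (invmx i.2 *m k *m i.2).
      elim: l lu => [|i l IH] lu; first by exists 0%N.
      have [|n1 h1] := IH; first by move=> j jl; apply: lu; rewrite inE jl orbT.
      have [|n2 h2] := @conj_bounded i.2; first by apply: lu; exact: mem_head.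
      have mono m n k : (m <= n)%N -> inK v n k -> inK v m k.
        by move=> mn [ku hk]; split=> // i' j'; apply: vgeW (hk i' j'); rewrite lez_nat.
      exists (maxn n1 n2) => j; rewrite inE => /orP[/eqP-> | /h1 hj] k kK.
        by apply: h2; apply: mono kK; exact: leq_maxr.
      by apply: hj; apply: mono kK; exact: leq_maxl.
    exists n => g k gu kK; apply: eq_big_seq => i il; have iu := lu i il.
    have [_ _ pk] := eqv_K (hn i il k kK).
    have := pk (g *m i.2); rewrite unitmx_mul (gu : g \in unitmx) iu mul1r => <- //.
    by rewrite !mulmxA mulmxK.
(* Well-definedness: a single [qm] that is good for all g in the list sends the zero combination of
   translates to the same combination of the g x. *)
- move=> y [l [lu e ->]].
  have [|M hM] := @ev_seq _ l (fun i => i.2); first by move=> i /lu; exact: ev_all.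
  rewrite (eq_big_seq (fun i : I => i.1 *: qm M (fun h => phi0 (h *m i.2)))); last first.
    by move=> i il; rewrite -(hM M (leqnn M) i il).
  by rewrite -qm_sum -[RHS](qm0 M) e.
- have rx : r phi0 x.
    exists [:: (1, 1%:M)]; split.
    + by move=> i; rewrite inE => /eqP-> /=; exact: unitmx1.
    + by apply: funext => h; rewrite big_seq1 mulmx1 mul1r.
    + by rewrite big_seq1 (act1 Hr) scale1r.
  have [||||h] := irr (fun y => exists phi, r phi y) => //.
  + by exists (fun=> 0).
  + by move=> a y z [phi hy] [psi hz]; eexists; apply: rlin hy hz.
  + by move=> g y gu [phi hy]; eexists; apply: rG hy.
  + by move=> h; case: x0; apply: h; exists phi0.
Qed.

End Eigenvector.

(** * Supersingular representations *)

Section Supersingular.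
Variables (p : nat) (F : fieldType) (v : F -> int).
Hypothesis HF : nonarch_local_field p v.
Local Notation G := (vge v).
Variables (C : closedFieldType) (V : lmodType C) (rho : 'M[F]_2 -> V -> V).
Hypothesis Hss : supersingular v rho.
Let Hs : smooth_rep v rho. Proof. by case: Hss. Qed.
Let Hr : is_rep rho. Proof. by case: Hs. Qed.
Let irr : irreducible_rep rho. Proof. by case: Hss. Qed.
Variables (w : F) (ks : seq F).
Hypotheses (w0 : w != 0) (vw : v w = 1) (rk : isreps v 1 (0 :: ks)) (pC : p \in [pchar C]).

Local Notation S := (Sop rho w ks).
Local Notation tm := (tm w).

Lemma weight_nilpotent sigma x J : weight v rho sigma x J -> exists n, iter n S x = 0.
Proof.
move=> wt; have [_ _ cc nsub] := Hss; apply: contrapT => nz.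
have nz' k : iter k S x <> 0 by move=> e; apply: nz; exists k.
have [|P [P0 hP]] := weight_relation HF Hs irr cc w0 vw rk pC wt.
  by move=> chi; apply: nsub.
have [sx x0 ux sK] : [/\ sigma x, x <> 0, ufix v rho x & fixK v rho 0 x].
  by case: wt => [[_ _ sK] [sx x0 ux _] _]; split=> //; apply: sK.
(* Restricting S to vectors with the torus character of x makes the eigenvector inherit that
   character, as the construction of [chi] requires. *)
pose W y := fixI v rho y /\ forall a d c, vunit v a -> vunit v d ->
  rho (dg a d) x = c *: x -> rho (dg a d) y = c *: y.
have dgl a d : vunit v a -> vunit v d -> is_linear (rho (dg a d)).
  by move=> ua ud; apply: (dg_lin Hr); [exact: vunit_neq0 ua | exact: vunit_neq0 ud].
have sW : subspace W.
  have sI := subspace_fixI HF Hr; split.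
    split; first exact: subspace0 sI.
    by move=> a d c ua ud _; rewrite (lin0 (dgl _ _ ua ud)) scaler0.
  move=> a y z [fy hy] [fz hz]; split; first exact: (subspaceP sI).
  move=> b d c ub ud e; rewrite dgl // (hy _ _ _ ub ud e) (hz _ _ _ ub ud e).
  by rewrite scalerDr !scalerA mulrC.
have [|||||al [y [al0 [fy hy] y0 Sy]]] :=
    @eigenvector_of_relation C V S (Sop_lin Hr w0 ks) W P x sW; rewrite //.
- move=> y [fy hy]; split; first exact: (Sop_fixI HF Hr w0 vw rk).
  move=> a d c ua ud e; rewrite -(Sop_dg HF Hr w0 vw rk ua ud); last by case: fy => [[]].
  by rewrite (hy _ _ _ ua ud e) (linZ (Sop_lin Hr w0 ks)).
- by split=> //; exact: (fixI_intro HF).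
have [om hom] := cc.
have [|th hth] := @choice F C (fun e c => vunit v e -> rho (dg e 1) x = c *: x).
  move=> e; case: (pselect (vunit v e)) => ue; last by exists 0.
  by have [c hc] := weight_Heig HF Hr wt ue (vunit1 HF); exists c.
have hthy e : vunit v e -> rho (dg e 1) y = th e *: y.
  by move=> ue; apply: hy => //; [exact: (vunit1 HF) | exact: hth].
have hom' a z : a != 0 -> rho a%:M z = om a *: z by exact: hom.
have sc := chi_smooth HF Hr w0 vw fy y0 al0 hom' hthy.
exact: nsub sc (eigenvector_subquotient HF Hr w0 vw rk fy y0 Sy al0 hom' hthy irr).
Qed.

(** Impredicative span of K y: a property cutting out a subspace is proved for z by checking it on
    the g y. *)
Definition Kspan (y z : V) := forall D : V -> Prop, subspace D ->
  (forall g, KO v g -> D (rho g y)) -> D z.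

Lemma subspace_Kspan y : subspace (Kspan y).
Proof.
split; first by move=> D sD _; exact: subspace0.
by move=> c u z hu hz D sD h; apply: (subspaceP sD); [apply: hu | apply: hz].
Qed.

Lemma KO1 : KO v 1%:M.
Proof. by rewrite -mx2_scalar; apply: (KO_dg HF); exact: (vunit1 HF). Qed.

Lemma Kspan_kernel y : fixK v rho 0 y -> y <> 0 ->
  exists x n, [/\ Kspan y x, fixI v rho x, iter n S x <> 0 & iter n.+1 S x = 0].
Proof.
move=> fy y0; have sE := subspace_Kspan y.
have Eg g : KO v g -> Kspan y (rho g y) by move=> gK D _; apply.
have stE : Kst v rho (Kspan y).
  move=> g z gK hz D sD h.
  apply: (hz _ (subspace_pre (act_lin Hr (KO_unit gK)) sD)) => g' gK'.
  by rewrite (actM Hr) ?(KO_unit gK) ?(KO_unit gK') //; apply: h; apply: (KO_mul HF).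
have EK z : Kspan y z -> fixK v rho 0 z.
  by apply; [exact: subspace_fixK | move=> g gK; apply: (fixK_KO HF Hr)].
have nE : exists2 z, Kspan y z & z <> 0.
  by exists y => //; rewrite -[y in Kspan _ y](act1 Hr); apply: Eg; exact: KO1.
(* Representatives of M_2(O/p). Each element of K is congruent to one of them and y is fixed by K_1,
   so the finitely many [e i] span [Kspan y]. *)
pose rr := [seq (a, b) | a <- 0 :: ks, b <- 0 :: ks].
pose l := [seq (a, b) | a <- rr, b <- rr].
pose e (i : 'I_(size l)) := let z := nth ((0, 0), (0, 0)) l i in
  rho (mx2 z.1.1 z.1.2 z.2.1 z.2.2) y.
have fE z : Kspan y z -> exists r : 'I_(size l) -> C, z = \sum_i r i *: e i.
  move=> hz; apply: (hz (fun z => exists r : 'I_(size l) -> C, z = \sum_i r i *: e i)).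
    split; first by exists (fun=> 0); rewrite big1 // => i _; rewrite scale0r.
    move=> c z1 z2 [r1 ->] [r2 ->]; exists (fun i => c * r1 i + r2 i).
    rewrite scaler_sumr -big_split; apply: eq_bigr => i _ /=.
    by rewrite scalerDl scalerA.
  move=> g gK; have [a [b [c [d [gE [ga gb gc gd _]]]]]] := gK.
  case: (rk) => _ _ cov _.
  have [a2 a2k ha] := cov _ ga; have [b2 b2k hb] := cov _ gb.
  have [c2 c2k hc] := cov _ gc; have [d2 d2k hd] := cov _ gd.
  have zl : ((a2, b2), (c2, d2)) \in l.
    by apply/allpairsP; exists ((a2, b2), (c2, d2)); split=> //;
     apply/allpairsP; [exists (a2, b2) | exists (c2, d2)].
  have il : (index ((a2, b2), (c2, d2)) l < size l)%N by rewrite index_mem.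
  exists (fun i => (i == Ordinal il)%:R).
  rewrite (bigD1 (Ordinal il)) //= eqxx scale1r big1 ?addr0; last first.
    by move=> i /negPf ->; rewrite scale0r.
  rewrite /e /= nth_index //= ; symmetry; apply: (cong_actKO HF Hr fy gK).
  rewrite gE => i j; case: (ord2 i) => ->; case: (ord2 j) => ->; rewrite !mx2E;
    exact: (vgeBC HF).
have [sigma [x [J [wt sE']]]] := exists_weight HF Hr rk pC sE stE EK nE fE.
have [n hn] := weight_nilpotent wt.
have [sx x0 ux] : [/\ sigma x, x <> 0 & ufix v rho x] by case: wt => [_ []].
have Ex := sE' _ sx; have fx : fixI v rho x by apply: (fixI_intro HF) => //; exact: EK.
suff [m [h1 h2]] : exists m, iter m S x <> 0 /\ iter m.+1 S x = 0 by exists x, m.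
elim: n hn => [|n IH] hn; first by [].
by case: (pselect (iter n S x = 0)) => h; [exact: IH | exists n].
Qed.

(** Pi normalises I_1, exchanging U(O) with the lower unipotents of p. *)
Lemma fixI_Pi x : fixI v rho x -> fixI v rho (rho sm (rho (tm 1) x)).
Proof.
move=> [[ux dx] nx]; split; [split|].
- move=> b gb; rewrite (um_sm Hr) (nm_tm Hr w0) nx //.
  by apply: (vge_mull HF) => //; right; rewrite expr1z vw.
- move=> a d ha hd; have a0 := one_cong_neq0 HF ha; have d0 := one_cong_neq0 HF hd.
  by rewrite -(sm_dg Hr) // (dg_tm Hr w0) // dx.
- move=> c gc; rewrite (nm_sm Hr) (um_tm_fix HF Hr w0 vw) //.
Qed.

(** * From P-equivariance to G-equivariance *)

Section Equivariance.
Variables (V' : lmodType C) (rho' : 'M[F]_2 -> V' -> V').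
Hypothesis Hs' : smooth_rep v rho'.
Let Hr' : is_rep rho'. Proof. by case: Hs'. Qed.
Variable f : V -> V'.
Hypotheses (lf : is_linear f) (fP : equivariant_on (@inP F) rho rho' f).
Local Notation S' := (Sop rho' w ks).

Let fum b y : f (rho (um b) y) = rho' (um b) (f y).
Proof. by apply: fP; exact: um_P. Qed.
Let fdg a d y : a != 0 -> d != 0 -> f (rho (dg a d) y) = rho' (dg a d) (f y).
Proof. by move=> a0 d0; apply: fP; exact: dg_P. Qed.
Let ftm m y : f (rho (tm m) y) = rho' (tm m) (f y).
Proof. by apply: fP; exact: tm_P. Qed.

Lemma equivariant_Sop y : f (S y) = S' (f y).
Proof. by rewrite /Sop (lin_sum lf); apply: eq_bigr => l _; rewrite fum ftm. Qed.

Lemma equivariant_bfix y : bfix v rho y -> bfix v rho' (f y).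
Proof.
move=> [uy dy]; split; first by move=> b gb; rewrite -fum uy.
move=> a d ha hd; rewrite -fdg ?dy //; exact: (one_cong_neq0 HF).
Qed.

(** The level is j + 1: at j = 0 the vector f x is fixed by the lower unipotents of p, hence by
    I_1. *)
Definition kernel_vector (j : nat) x :=
  [/\ x <> 0, fixI v rho x, S x = 0 & nfix v rho' j.+1 (f x)].

Lemma iter_fixI n x : fixI v rho x -> fixI v rho (iter n S x).
Proof. by move=> fx; elim: n => //= n; exact: (Sop_fixI HF Hr w0 vw rk). Qed.

Lemma kernel_vector_start : exists j x, kernel_vector j x.
Proof.
have [nz _] := irr.
have [y fy y0] := fixK0_exists HF Hr w0 vw rk pC Hs nz.
have [x [n [_ fx h1 h2]]] := Kspan_kernel fy y0.
have [_ sm'] := Hs'; have [j hj] := sm' (f (iter n S x)).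
exists j, (iter n S x); split=> //; first exact: iter_fixI.
by move=> c hc; apply: hj; apply: (inK_mx2 HF); rewrite ?subrr //; exact: vge0.
Qed.

Lemma kernel_vector_step j x : kernel_vector j.+1 x -> exists x', kernel_vector j x'.
Proof.
move=> [x0 fx Sx nx].
set y := rho sm (rho (tm 1) x); have fy : fixI v rho y by apply: fixI_Pi.
have y0 : y <> 0 by move=> /(act_inj Hr (sm_GL F)) /(act_inj Hr (tm_GL w0 1)).
have [x' [n [Ex' fx' h1 h2]]] := Kspan_kernel (fixI_K HF Hr fy) y0.
have lv : nfix v rho' j.+1 (f x').
  have sD : subspace (fun z => nfix v rho' j.+1 (f z)).
    split; first by move=> c _; rewrite (lin0 lf) (lin0 (nm_lin Hr' c)).
    by move=> c z1 z2 hz1 hz2 b gb; rewrite lf (nm_lin Hr') hz1 ?hz2.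
  (* [contraction] applies to the image of u(mu) h t x; what follows reduces every g Pi x, g in K,
     to such vectors. *)
  have Pform mu a d : G mu 0 -> vunit v a -> vunit v d ->
      nfix v rho' j.+1 (f (rho (um mu) (rho (dg a d) (rho (tm 1) x)))).
    move=> gmu ua ud; rewrite fum fdg ?(vunit_neq0 ua) ?(vunit_neq0 ud) // ftm.
    apply: (contraction HF Hr' w0 vw) => //; first by apply: equivariant_bfix; case: fx.
    by rewrite -PoszD addn1.
  apply: (Ex' (fun z => nfix v rho' j.+1 (f z))) => // g [a [b [c [d [-> [ga gb gc gd uD]]]]]].
  have D0 := vunit_neq0 uD; have [[uy _] ny] := fy.
  have [c1|uc] := vunit_dec gc.
    have uad : vunit v (a * d).
      apply: (vunit_cong HF uD); have -> : a * d - (a * d - b * c) = b * c by ring.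
      exact: (vge_mull HF).
    have ud : vunit v d.
      have [d1|//] := vunit_dec gd; case: (not_vge1 uad); exact: (vge_mull HF).
    have d0 := vunit_neq0 ud; have gd1 := vunit_int (vunitV HF ud).
    rewrite (mx2_bigcell Hr) // ny; last exact: (vge_mulr HF).
    (* Here g Pi x is a P-translate of Pi x, so S x = 0 has to be used; in the other cell g Pi x
       already is a P-translate of t x. *)
    rewrite /y (Sop0_bigcell HF Hr w0 vw rk fx Sx).
    have uDd : vunit v ((a * d - b * c) / d) by apply: (vunitM HF) => //; apply: (vunitV HF).
    have a10 := vunit_neq0 uDd.
    rewrite (linN (dg_lin Hr a10 d0)) (linN (um_lin Hr _)); apply: (subspaceN sD).
    rewrite (lin_sum (dg_lin Hr a10 d0)) (lin_sum (um_lin Hr _)).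
    apply: (subspace_sum sD) => l lk _; have ul := ks_unit rk lk; have ulV := vunitV HF ul.
    have uN := vunitN HF ulV.
    rewrite (dg_um Hr) // (um_um Hr) (dg_dg Hr) ?(vunit_neq0 ul) ?(vunit_neq0 uN) //.
    apply: Pform; try by apply: (vunitM HF).
    apply: (vgeD HF); first exact: (vge_mulr HF).
    by apply: (vge_mulr HF) => //; apply: (vge_mulr HF); exact: vunit_int.
  have c0 := vunit_neq0 uc; have gc1 := vunit_int (vunitV HF uc).
  have u1 : vunit v (- (a * d - b * c) / c).
    by apply: (vunitM HF); [apply: (vunitN HF) | apply: (vunitV HF)].
  rewrite (mx2_scell Hr) // uy; last exact: (vge_mulr HF).
  rewrite /y (sm_sm Hr); apply: Pform => //; exact: (vge_mulr HF).
exists (iter n S x'); split=> //; first exact: iter_fixI.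
elim: (n) => [|m IH] //=; rewrite equivariant_Sop; apply: (Sop_nfix HF Hr' w0 vw rk) => //.
  by apply: equivariant_bfix; case: (iter_fixI m fx').
by apply: nfixW IH; lia.
Qed.

Lemma kernel_vector0 : exists x, kernel_vector 0 x.
Proof.
have [j hj] := kernel_vector_start; elim: j hj => // j IH [x /kernel_vector_step].
exact: IH.
Qed.

Lemma equivariant_GL : equivariant_on (@inGL2 F) rho rho' f.
Proof.
have [x [x0 fx Sx nx]] := kernel_vector0.
have fx' : fixI v rho' (f x) by split=> //; apply: equivariant_bfix; case: fx.
have Sx' : S' (f x) = 0 by rewrite -equivariant_Sop Sx (lin0 lf).
have fPi : f (rho sm (rho (tm 1) x)) = rho' sm (rho' (tm 1) (f x)).
  rewrite (Sop0_bigcell HF Hr w0 vw rk fx Sx) (Sop0_bigcell HF Hr' w0 vw rk fx' Sx').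
  rewrite (linN lf) (lin_sum lf); congr (- _); apply: eq_big_seq => l lk.
  have l0 := vunit_neq0 (ks_unit rk lk).
  by rewrite fum fdg ?ftm // oppr_eq0 invr_neq0.
have o0 := oner_neq0 F; have wV0 := invr_neq0 w0.
have fsm : f (rho sm x) = rho' sm (f x).
  (* s = diag(1, 1/w) Pi with the first factor in P, so commutation with Pi at x gives commutation
     with s. *)
  have E (U : lmodType C) (r : 'M[F]_2 -> U -> U) (u : U) : is_rep r ->
      r sm u = r (dg 1 w^-1) (r sm (r (tm 1) u)).
    move=> hr; rewrite (sm_dg hr) ?wX_neq0 // (dg_dg hr) ?wX_neq0 //.
    by rewrite expr1z mulr1 mulVf // (dg11 hr).
  by rewrite (E _ _ _ Hr) fdg // fPi -(E _ _ _ Hr').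
(* D is a G-stable subspace, so by irreducibility it is enough that it contains the nonzero vector
   x; G = P K and the two cells of K settle that. *)
pose D y := forall g, g \in unitmx -> f (rho g y) = rho' g (f y).
have [_ irr'] := irr.
have [||||h g gu y] := irr' D; last exact: h.
- by move=> g gu; rewrite (lin0 (act_lin Hr gu)) !(lin0 lf) (lin0 (act_lin Hr' gu)).
- by move=> a y z hy hz g gu; rewrite (act_lin Hr gu) !lf hy // hz // (act_lin Hr' gu).
- move=> g y gu hy g' gu'; rewrite (actM Hr) // hy ?unitmx_mul ?gu' //.
  by rewrite -(actM Hr') // -hy.
- move=> h; case: x0; apply: h => g gu.
  have [b [k [bP kK ->]]] := iwasawa HF gu; have ku := KO_unit kK; have [bu _] := bP.
  rewrite -(actM Hr) // -(actM Hr') // fP //; congr (rho' _ _).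
  have [a [b' [c [d [-> [ga gb gc gd uD]]]]]] := kK; have D0 := vunit_neq0 uD.
  have [[ux _] nx1] := fx; have [[ux' _] nx1'] := fx'.
  have [c1|uc] := vunit_dec gc.
    have uad : vunit v (a * d).
      apply: (vunit_cong HF uD); have -> : a * d - (a * d - b' * c) = b' * c by ring.
      exact: (vge_mull HF).
    have ud : vunit v d.
      have [d1|//] := vunit_dec gd; case: (not_vge1 uad); exact: (vge_mull HF).
    have d0 := vunit_neq0 ud; have gd1 := vunit_int (vunitV HF ud).
    have gcd : G (c / d) 1 by exact: (vge_mulr HF).
    rewrite (mx2_bigcell Hr) // (mx2_bigcell Hr') // nx1 // nx1' // fum fdg //.
    by rewrite mulf_neq0 ?invr_neq0.
  have c0 := vunit_neq0 uc; have gc1 := vunit_int (vunitV HF uc).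
  have gdc : G (d / c) 0 by exact: (vge_mulr HF).
  rewrite (mx2_scell Hr) // (mx2_scell Hr') // ux // ux' // fum fdg ?fsm //.
  by rewrite mulf_neq0 ?invr_neq0 ?oppr_eq0.
Qed.

End Equivariance.
End Supersingular.

Theorem theorem4p4 (p : nat) (F : fieldType) (v : F -> int)
    (HF : nonarch_local_field p v)
    (C : closedFieldType) (HC : is_Fpbar p C)
    (V V' : lmodType C) (rho : 'M[F]_2 -> V -> V) (rho' : 'M[F]_2 -> V' -> V')
    (Hrho : smooth_rep v rho) (Hrho' : smooth_rep v rho')
    (Hss : supersingular v rho)
    (f : V -> V') (Hf : is_linear f) :
  equivariant_on (@inP F) rho rho' f <-> equivariant_on (@inGL2 F) rho rho' f.
Proof.
split=> [fP|fG]; last by move=> g [gu _]; apply: fG.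
have [_ [w [w0 vw]] _ _ _] := HF; have [ks rk] := exists_isreps1 HF.
have [pC _] := HC.
exact: (equivariant_GL HF Hss w0 vw rk pC Hrho' Hf fP).
Qed.
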